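(* Let $\kappa=\frac12$. Then $\alpha_{OU}$ is the unique quasi-stationary distribution for $X$ absorbed at $(-1,1)^c$, i.e. the unique probability measure $\alpha$ on $(-1,1)$ such that $\mathbb{P}_{\alpha,s}(X_t\in\cdot\mid\tau_X>t)=\alpha$ for all $0\le s\le t$. Moreover there exist constants $C_{OU},\gamma_{OU}>0$ such that for every probability measure $\mu$ on $(-1,1)$ and all $0\le s\le t$, $$\big\|\mathbb{P}_{\mu,s}(X_t\in\cdot\mid\tau_X>t)-\alpha_{OU}\big\|_{TV}\le C_{OU}\left(\frac{s+1}{t+1}\right)^{\gamma_{OU}}.$$ In particular, for every such $\mu$ and $s\ge0$, $\mathbb{P}_{\mu,s}(X_t\in\cdot\mid\tau_X>t)$ converges weakly to $\alpha_{OU}$ as $t\to\infty$.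
   Context: For $s\ge 0$ and $x\in\mathbb{R}$, let $\mathbb{P}_{x,s}$ be a probability measure under which $(X_t)_{t\ge s}$ is given by $X_t=\frac{x(s+1)^{1/2}+W_{t-s}}{(t+1)^{1/2}}$, with $W$ a standard Brownian motion started at $0$ (so $X_t=B_t/\sqrt{t+1}$ with $B_s=x\sqrt{s+1}$). Let $\tau_X:=\inf\{t\ge s:|X_t|=1\}$ and $\mathbb{P}_{\mu,s}:=\int\mathbb{P}_{x,s}\mu(dx)$. Let $Z$ be the Ornstein–Uhlenbeck process with generator $Lf(x)=\frac12 f''(x)-\frac12 xf'(x)$ (i.e. $dZ_t=-\frac12 Z_t\,dt+dW_t$), and $\tau_Z:=\inf\{t\ge0:|Z_t|=1\}$. $\alpha_{OU}$ denotes the unique quasi-stationary distribution of $Z$ absorbed at $(-1,1)^c$, i.e. the unique probability measure $\alpha$ on $(-1,1)$ with $\mathbb{P}^Z_\alpha(Z_t\in\cdot\mid\tau_Z>t)=\alpha$ for all $t\ge0$; explicitly $\alpha_{OU}(dx)=K(1-x^2)e^{-x^2/2}dx$ on $(-1,1)$ with $K$ a normalizing constant. Total variation distance: $\|\mu-\nu\|_{TV}:=\sup_{\|f\|_\infty\le1}|\int f\,d\mu-\int f\,d\nu|$. *)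

(* Defs.v *)
From HB Require Import structures.
From mathcomp Require Import all_boot all_order all_algebra.
From mathcomp Require Import all_classical all_reals all_analysis.
Set Implicit Arguments. Unset Strict Implicit. Unset Printing Implicit Defensive.
Import Order.TTheory GRing.Theory Num.Theory.
Import numFieldNormedType.Exports.
Local Open Scope classical_set_scope.
Local Open Scope ring_scope.

Section defs.
Context {R : realType} {d : measure_display} {T : measurableType d}.

Definition is_std_BM (P : probability T R) (W : R -> T -> R) : Prop :=
  [/\ (forall w, W 0 w = 0),
      (forall w, {within `[0, +oo[, continuous (fun r => W r w)}),
      (forall r, 0 <= r -> measurable_fun setT (W r)) &
      (forall (n : nat) (t : nat -> R) (A : nat -> set R),
          0 <= t 0%N -> (forall i, t i < t i.+1) ->
          (forall i, measurable (A i)) ->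
          P (\bigcap_(i in `I_n) [set w | A i (W (t i.+1) w - W (t i) w)]) =
          (\prod_(i < n) normal_prob 0 (Num.sqrt (t i.+1 - t i)) (A i))%E)].

(* Under P_{x,s}: X_r = (x (s+1)^{1/2} + W_{r-s}) / (r+1)^{1/2}, r >= s. *)
Definition Xproc (W : R -> T -> R) (s x r : R) (w : T) : R :=
  (x * Num.sqrt (s + 1) + W (r - s) w) / Num.sqrt (r + 1).

(* {tau_X > t} under P_{x,s}, tau_X = inf {r >= s : |X_r| = 1} *)
Definition survives (W : R -> T -> R) (s t x : R) (w : T) : Prop :=
  forall r, s <= r -> r <= t -> `|Xproc W s x r w| != 1.

(* E_{mu,s}[ f(X_t) ; tau_X > t ] with P_{mu,s} = \int P_{x,s} mu(dx) *)
Definition surv_expect (P : probability T R) (W : R -> T -> R)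
    (mu : probability R R) (s t : R) (f : R -> R) : \bar R :=
  (\int[mu]_x \int[P]_(w in [set w | survives W s t x w]) (f (Xproc W s x t w))%:E)%E.

Definition cond_expect (P : probability T R) (W : R -> T -> R)
    (mu : probability R R) (s t : R) (f : R -> R) : R :=
  fine (surv_expect P W mu s t f) / fine (surv_expect P W mu s t (fun _ => 1)).

Definition cond_law (P : probability T R) (W : R -> T -> R)
    (mu : probability R R) (s t : R) (A : set R) : R :=
  cond_expect P W mu s t (\1_A).

Definition on_open_unit (mu : probability R R) : Prop := mu `](-1)%R, 1%R[%classic = 1%E.

Definition is_QSD_X (P : probability T R) (W : R -> T -> R)
    (alpha : probability R R) : Prop :=
  on_open_unit alpha /\
  forall s t, 0 <= s -> s <= t ->
    forall A, measurable A -> (cond_law P W alpha s t A)%:E = alpha A.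

Definition dens_OU (x : R) : R := (1 - x ^+ 2) * expR (- (x ^+ 2) / 2).

Definition is_alpha_OU (alpha : probability R R) : Prop :=
  exists K : R, forall A, measurable A ->
    alpha A = (K%:E * \int[lebesgue_measure]_(x in (A `&` `](-1)%R, 1%R[%classic : set R)) (dens_OU x)%:E)%E.

End defs.

(* Main.v *)
(* Over the ratio q = (s+1)/(t+1), X moves by the Ornstein-Uhlenbeck (Mehler)
   operator at time -ln q, for which 1 - x^2 is an eigenfunction of eigenvalue q,
   and 1 - x^2 vanishes at the absorbing boundary.  Killing along finer and finer
   grids shows that the killed semigroup maps phi = 1 - x^2 to exactly q phi: the
   overshoot across the boundary costs only the sum of the (1-q_i)^2, which tends
   to 0.  The Mehler operator is symmetric for the standard Gaussian measure, hence
   so is the killed one, and phi times the Gaussian density is quasi-stationary.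
   For the convergence, the semigroup normalized by phi satisfies a Doeblin
   minorization over a fixed ratio of times: a point reaches {phi >= 1/16} with
   probability at least phi/8, and from there the Gaussian kernel charges a small
   window around 0 more than it does from any point outside the interval.
   Iterating contracts the oscillation of the normalized functions geometrically
   in ln((t+1)/(s+1)), that is, polynomially in q. *)
Require Import Defs.
From HB Require Import structures.
From mathcomp Require Import all_boot all_order all_algebra.
From mathcomp Require Import all_classical all_reals all_analysis.
From mathcomp Require Import measurable_realfun ring lra.
Set Implicit Arguments. Unset Strict Implicit. Unset Printing Implicit Defensive.
Import Order.TTheory GRing.Theory Num.Theory.
Import numFieldNormedType.Exports.
Local Open Scope classical_set_scope.
Local Open Scope ring_scope.

(** Survival is an event of the whole path, while the law of [W] is given through finitely many
    increments. Killing along a grid overestimates survival, because a path may leave the interval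
    and return between two grid times. The excess is first shown to vanish for the single function
    [phi0], from both sides. From above, the overshoot is charged to fourth moments of the jumps,
    which are of order [(1 - q) ^+ 2]. From below, killing takes place outside the closed set where
    [c <= phi]: by continuity, staying there at all dyadic times forces survival. For any other
    bounded [f >= 0] the excess is compared with that of [phi0]: away from the boundary [f] is at
    most a multiple of [phi0], and being inside but very near the boundary at the final time has
    small probability. The semigroup law and the symmetry of the continuously killed evolution are
    then limits of the corresponding identities along grids. *)

Definition push_measure {d d'} {T1 : measurableType d} {T2 : measurableType d'}
    {R : realType} (m : {measure set T1 -> \bar R}) (f : T1 -> T2)
    (mf : measurable_fun setT f) : {measure set T2 -> \bar R} :=
  measure_function_pushforward__canonical__measure_function_Measure m mf.

(** * Integrals against densities and affine changes of variable *)

Section density.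
Local Open Scope ereal_scope.
Import HBNNSimple.

Lemma ge0_integral_density {d} {T : measurableType d} {R : realType}
    (mu nu : {measure set T -> \bar R}) (h : T -> R) (f : T -> \bar R) :
  measurable_fun setT h -> (forall x, (0 <= h x)%R) ->
  (forall A, measurable A -> nu A = \int[mu]_(x in A) (h x)%:E) ->
  measurable_fun setT f -> (forall x, 0 <= f x) ->
  \int[nu]_x f x = \int[mu]_x (f x * (h x)%:E).
Proof.
move=> mh h0 nuE mf f0.
have mhE : measurable_fun setT (EFin \o h) by exact/measurable_EFinP.
pose f_ := nnsfun_approx measurableT mf.
have f_cvg x : (f_ n x)%:E @[n --> \oo] --> f x.
  by apply: cvg_nnsfun_approx => // t _; exact: f0.
have f_nd x : {homo (fun n => (f_ n x)%:E) : n m / (n <= m)%N >-> n <= m}.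
  by move=> m n mn; rewrite lee_fin; exact/lefP/nd_nnsfun_approx.
have mf_ n : measurable_fun setT (fun x => (f_ n x)%:E).
  exact/measurable_EFinP/measurable_funP.
transitivity (limn (fun n => \int[nu]_x (f_ n x)%:E)).
  rewrite -monotone_convergence//=.
  - by apply: eq_integral => x _; apply/esym/cvg_lim.
  - by move=> n x _; rewrite lee_fin.
transitivity (limn (fun n => \int[mu]_x ((f_ n x)%:E * (h x)%:E))); last first.
  rewrite -monotone_convergence//=.
  - apply: eq_integral => x _; apply/cvg_lim => //.
    by apply: cvgeZr.
  - by move=> n; apply: emeasurable_funM => //; exact: mf_.
  - by move=> n x _; rewrite mule_ge0// lee_fin.
  - move=> x _ m n mn; apply: lee_wpmul2r; first by rewrite lee_fin.
    exact: f_nd.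
congr (limn _); apply/funext => n.
under eq_integral do rewrite fimfunE -fsumEFin//.
rewrite ge0_integral_fsum//; last 2 first.
- by move=> r; exact/measurable_EFinP/measurable_funM.
- by move=> r x _; rewrite nnfun_muleindic_ge0.
under [RHS]eq_integral.
  move=> x _; rewrite fimfunE -fsumEFin// ge0_mule_fsuml; last first.
    by move=> r; rewrite nnfun_muleindic_ge0.
  over.
rewrite ge0_integral_fsum//; last 2 first.
- move=> r; apply: emeasurable_funM => //.
  exact/measurable_EFinP/measurable_funM.
- by move=> r x _; rewrite mule_ge0 ?lee_fin// -lee_fin nnfun_muleindic_ge0.
apply: eq_fsbigr => r; rewrite inE/= => -[t _ ftr].
have r0 : (0 <= r)%R by rewrite -ftr.
have mr : measurable (f_ n @^-1` [set r]) by [].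
under eq_integral do rewrite EFinM.
rewrite ge0_integralZl//; last exact/measurable_EFinP.
under [RHS]eq_integral do rewrite EFinM -muleA.
rewrite [RHS]ge0_integralZl//; last 2 first.
- by apply: emeasurable_funM => //; exact/measurable_EFinP.
- by move=> x _; rewrite mule_ge0// lee_fin.
congr (_ * _); rewrite integral_indic// setIT nuE// [LHS]integral_mkcond/=.
apply: eq_integral => x _; rewrite patchE indicE/= -EFinM.
by case: ifPn => _; rewrite ?mul1r ?mul0r.
Qed.

End density.

Section lebesgue_affine.
Context {R : realType}.
Local Notation mu := (@lebesgue_measure R).
Variables (a s : R).
Hypothesis s0 : 0 < s.

Let maff : measurable_fun [set: R] (fun z : R => a + s * z).
Proof. by apply: measurable_funD => //; exact: measurable_funM. Qed.

Lemma lebesgue_measure_affine (A : set R) : measurable A ->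
  mu A = (s%:E * mu ((fun z : R => a + s * z)%R @^-1` A))%E.
Proof.
move=> mA.
pose m' : {measure set (measurableTypeR R) -> \bar R} := mscale (NngNum (ltW s0))
  (@push_measure _ _ (measurableTypeR R) (measurableTypeR R) R mu
    (fun z : R => a + s * z) maff).
have -> : (s%:E * mu ((fun z : R => a + s * z)%R @^-1` A))%E = m' A by [].
apply: (@lebesgue_measure_unique R m') => // _ [[x y] _ <-].
have -> : m' [set` `](x, y).1, (x, y).2]] =
    (s%:E * mu `]((x - a) / s)%R, ((y - a) / s)%R]%classic)%E.
  congr (_ * mu _)%E; apply/seteqP; split => z /=;
    rewrite !in_itv/= ltr_pdivrMr// ler_pdivlMr//;
    by rewrite ltrBlDl lerBrDl (mulrC z).
rewrite !lebesgue_measure_itv/= !lte_fin ltr_pM2r ?invr_gt0// ltrD2r.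
case: ifPn => _; last by rewrite mule0.
by rewrite -!EFinB -EFinM; congr EFin; field; rewrite gt_eqF.
Qed.

Lemma ge0_integral_affine (f : R -> \bar R) :
  measurable_fun setT f -> (forall x, (0 <= f x)%E) ->
  (\int[mu]_y f y = s%:E * \int[mu]_z f (a + s * z)%R)%E.
Proof.
move=> mf f0.
pose m' : {measure set (measurableTypeR R) -> \bar R} := mscale (NngNum (ltW s0))
  (@push_measure _ _ (measurableTypeR R) (measurableTypeR R) R mu
    (fun z : R => a + s * z)%R maff).
rewrite (@eq_measure_integral _ (measurableTypeR R) R setT m'); last first.
  by move=> A mA _; exact: lebesgue_measure_affine.
rewrite (@ge0_integral_mscale _ (measurableTypeR R))//.
by rewrite ge0_integral_pushforward.
Qed.

End lebesgue_affine.

(** * Gaussian integrability and moments *)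

Section gauss.
Context {R : realType}.
Local Notation mu := (@lebesgue_measure R).
Local Notation gamma := (@normal_prob R 0 1).

Lemma ge0_integral_normal_prob (m s : R) (f : R -> \bar R) :
  measurable_fun setT f -> (forall x, 0 <= f x)%E ->
  (\int[normal_prob m s]_x f x = \int[mu]_x (f x * (normal_pdf m s x)%:E))%E.
Proof.
move=> mf f0; apply: ge0_integral_density => //.
- exact: measurable_normal_pdf.
- by move=> x; exact: normal_pdf_ge0.
Qed.

Lemma normal_pdf_affine (m s z : R) : 0 < s ->
  s * normal_pdf m s (m + s * z) = normal_pdf 0 1 z.
Proof.
move=> s0; rewrite !normal_pdfE ?gt_eqF//= /normal_peak /normal_fun.
have -> : m + s * z - m = s * z by rewrite addrC addKr.
rewrite subr0 expr1n mul1r !exprMn mulrA; congr (_ * _).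
  rewrite -mulrnAr sqrtrM ?sqr_ge0// sqrtr_sqr gtr0_norm//.
  by rewrite invfM mulrA divff ?gt_eqF// mul1r.
by congr expR; field; rewrite gt_eqF.
Qed.

Lemma ge0_integral_normal_affine (m s : R) (f : R -> \bar R) : 0 < s ->
  measurable_fun setT f -> (forall x, 0 <= f x)%E ->
  (\int[normal_prob m s]_x f x = \int[gamma]_z f (m + s * z)%R)%E.
Proof.
move=> s0 mf f0.
have maff : measurable_fun [set: R] (fun z : R => m + s * z).
  by apply: measurable_funD => //; exact: measurable_funM.
have mp m' s' : measurable_fun [set: R] (fun x : R => (normal_pdf m' s' x)%:E).
  by apply/measurable_EFinP; exact: measurable_normal_pdf.
have mfp : measurable_fun [set: R] (fun x : R => f x * (normal_pdf m s x)%:E)%E.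
  exact: emeasurable_funM.
rewrite !ge0_integral_normal_prob//; last exact: measurableT_comp.
rewrite (ge0_integral_affine m s0)//; last first.
  by move=> x; rewrite mule_ge0// lee_fin normal_pdf_ge0.
rewrite -ge0_integralZl ?lee_fin ?ltW//.
- apply: eq_integral => z _.
  by rewrite muleCA -EFinM normal_pdf_affine.
- exact: (measurableT_comp mfp maff).
- by move=> x _; rewrite mule_ge0// lee_fin normal_pdf_ge0.
Qed.

(** Growth of order four, because overshoots are controlled through [(y - x) ^+ 4]; it is integrable
    for Gaussian laws and stable under affine substitution. *)
Definition quartic (f : R -> R) :=
  measurable_fun setT f /\ exists C, forall x, `|f x| <= C * (1 + x ^+ 4).

Lemma expR_ge_sqr (u : R) : 0 <= u -> u ^+ 2 / 4 <= expR u.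
Proof.
move=> u0; have -> : expR u = expR (u / 2) ^+ 2.
  by rewrite -expRM_natl; congr expR; rewrite -mulr_natl; field.
have -> : u ^+ 2 / 4 = (u / 2) ^+ 2 by field.
have h := expR_ge1Dx (u / 2).
by apply: ler_pM => //; lra.
Qed.

Lemma integrable_normal_quartic (f : R -> R) : quartic f ->
  mu.-integrable setT (EFin \o (fun x => f x * normal_pdf 0 1 x)).
Proof.
move=> [mf [C fC]].
have C0 : 0 <= C by have := fC 0; rewrite expr0n addr0 mulr1; apply: le_trans.
pose p1 := @normal_peak R 1; pose p2 := @normal_peak R 2.
have p20 : 0 < p2 by apply: normal_peak_gt0; rewrite gt_eqF.
have p10 : 0 <= p1 by exact: normal_peak_ge0.
(* Domination by the Gaussian density of standard deviation 2, which leaves a factor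
   [expR (x ^+ 2 * (3 / 8))] to spare. This factor is at least 1 and at least [x ^+ 4 * (9 / 256)],
   so 65 times it exceeds [1 + x ^+ 4]. *)
pose g : R -> \bar R := EFin \o (fun x => (C * 65 * p1 / p2) * normal_pdf 0 2 x).
apply: (@le_integrable _ _ _ mu setT measurableT
  (EFin \o (fun x : R => f x * normal_pdf 0 1 x)) g).
- apply/measurable_EFinP/measurable_funM => //; exact: measurable_normal_pdf.
- move=> x _ /=; rewrite lee_fin [leRHS]ger0_norm; last first.
    by rewrite !mulr_ge0 ?invr_ge0 ?normal_pdf_ge0 ?(ltW p20)// ler0n.
  rewrite normrM (ger0_norm (normal_pdf_ge0 _ _ _)).
  rewrite !normal_pdfE ?oner_eq0 ?gt_eqF//= /normal_fun subr0 -/p1 -/p2.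
  rewrite expr1n.
  have -> : C * 65 * p1 / p2 * (p2 * expR (- x ^+ 2 / (2 ^+ 2 *+ 2))) =
            C * p1 * (65 * expR (- x ^+ 2 / (2 ^+ 2 *+ 2))).
    by field; rewrite gt_eqF.
  rewrite mulrCA (mulrC C) -mulrA; apply: ler_wpM2l => //.
  apply: (@le_trans _ _ (C * (1 + x ^+ 4) * expR (- x ^+ 2 / (1 *+ 2)))).
    by rewrite ler_wpM2r ?expR_ge0.
  rewrite -mulrA; apply: ler_wpM2l => //.
  have -> : expR (- x ^+ 2 / (2 ^+ 2 *+ 2)) =
     expR (x ^+ 2 * (3 / 8)) * expR (- x ^+ 2 / (1 *+ 2)).
    rewrite -expRD; congr expR.
    have -> : (2 ^+ 2 *+ 2 = 8 :> R) by rewrite -mulr_natl; ring.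
    by rewrite mulr2n; field.
  rewrite mulrA; apply: ler_wpM2r; first exact: expR_ge0.
  have h1 : 1 <= expR (x ^+ 2 * (3 / 8)).
    by rewrite -expR0 ler_expR mulr_ge0 ?sqr_ge0.
  have := @expR_ge_sqr (x ^+ 2 * (3 / 8)).
  rewrite mulr_ge0 ?sqr_ge0// => /(_ isT) h2.
  have h3 : (x ^+ 2 * (3 / 8)) ^+ 2 / 4 = x ^+ 4 * (9 / 256) by field.
  by have := sqr_ge0 (x ^+ 2); rewrite -exprM => h4; lra.
- have := @integrableZl _ _ _ mu _ measurableT (C * 65 * p1 / p2) _
    (integrable_normal_pdf 0 2).
  by apply: eq_integrable.
Qed.

End gauss.

Section gauss2.
Context {R : realType}.
Local Notation mu := (@lebesgue_measure R).
Local Notation gamma := (@normal_prob R 0 1).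

Lemma integrable_gamma (f : R -> R) : quartic f ->
  gamma.-integrable setT (EFin \o f).
Proof.
move=> qf; have [mf _] := qf.
apply/integrableP; split; first exact/measurable_EFinP.
rewrite ge0_integral_normal_prob//; last first.
  by apply: measurableT_comp => //; exact/measurable_EFinP.
have /integrableP[_] := integrable_normal_quartic qf.
under eq_integral do rewrite /= normrM (ger0_norm (normal_pdf_ge0 _ _ _)) EFinM.
by [].
Qed.

Lemma Rintegral_gamma (f : R -> R) : measurable_fun setT f ->
  \int[gamma]_x f x = \int[mu]_x (f x * normal_pdf 0 1 x).
Proof.
move=> mf; rewrite /Rintegral; congr fine.
have mfE : measurable_fun setT (EFin \o f) by exact/measurable_EFinP.
rewrite integralE [RHS]integralE !ge0_integral_normal_prob//; last 2 first.
- exact: measurable_funeneg.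
- exact: measurable_funepos.
congr (_ - _)%E; apply: eq_integral => x _.
  rewrite !funeposE -!EFin_max -EFinM maxr_pMl ?normal_pdf_ge0//.
  by rewrite mul0r.
rewrite !funenegE -!EFinN -!EFin_max -EFinM maxr_pMl ?normal_pdf_ge0//.
by rewrite mul0r mulNr.
Qed.

Lemma quarticD (f g : R -> R) : quartic f -> quartic g -> quartic (fun x => f x + g x).
Proof.
move=> [mf [C fC]] [mg [D gD]]; split; first exact: measurable_funD.
exists (C + D) => x; rewrite mulrDl (le_trans (ler_normD _ _))//.
exact: lerD.
Qed.

Lemma quarticZ (a : R) (f : R -> R) : quartic f -> quartic (fun x => a * f x).
Proof.
move=> [mf [C fC]]; split; first exact: measurable_funM.
by exists (`|a| * C) => x; rewrite normrM -mulrA ler_wpM2l.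
Qed.

Lemma quarticX (k : nat) : (k <= 4)%N -> quartic (fun x : R => x ^+ k).
Proof.
move=> k4; split; first exact: measurable_funX.
exists 1 => x; rewrite mul1r normrX.
have -> : x ^+ 4 = `|x| ^+ 4 by rewrite -normrX ger0_norm// (exprM x 2 2) sqr_ge0.
have [x1|x1] := leP `|x| 1.
  by rewrite (@le_trans _ _ 1) ?exprn_ile1// lerDl exprn_ge0.
by rewrite (@le_trans _ _ (`|x| ^+ 4)) ?lerDr// ler_weXn2l// ltW.
Qed.

Lemma quartic_cst (a : R) : quartic (fun=> a).
Proof.
have := quarticZ a (quarticX (leq0n _)).
by congr quartic; apply/funext => x; rewrite expr0 mulr1.
Qed.

Lemma quartic_bounded (f : R -> R) (M : R) : measurable_fun setT f ->
  (forall x, `|f x| <= M) -> quartic f.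
Proof.
move=> mf fM; split => //; exists M => x; apply: (le_trans (fM x)).
have M0 : 0 <= M by exact: le_trans (fM 0).
by rewrite ler_peMr// lerDl (exprM x 2 2) sqr_ge0.
Qed.

Lemma is_derive_gauss (k : nat) (x : R) :
  is_derive x 1 (fun x => - (x ^+ k * normal_pdf 0 1 x))
    ((x ^+ k.+1 - k%:R * x ^+ k.-1) * normal_pdf 0 1 x).
Proof.
rewrite normal_pdfE ?oner_eq0//.
have -> : (fun x => - (x ^+ k * (normal_peak 1 * normal_fun 0 1 x))) =
  (fun x : R => - normal_peak 1 * (x ^+ k * expR (- 2^-1 * x ^+ 2))).
  apply/funext => y; rewrite /normal_fun.
  have -> : - (y - 0) ^+ 2 / (1 ^+ 2 *+ 2) = - 2^-1 * y ^+ 2.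
    by rewrite subr0 expr1n mulr2n; field.
  by ring.
have -> : normal_fun 0 1 x = expR (- 2^-1 * x ^+ 2).
  by rewrite /normal_fun subr0 expr1n mulr2n; congr expR; field.
have hX (m : nat) : is_derive x (1 : R) (fun y : R => y ^+ m) (m%:R * x ^+ m.-1).
  have -> : (fun y : R => y ^+ m) = id ^+ m by apply/funext => y; rewrite exprfctE.
  by apply: is_derive_eq; rewrite /GRing.scale/= mulr1.
have hQ : is_derive x (1 : R) (fun y : R => - 2^-1 * y ^+ 2) (- x).
  have h2 := hX 2%N.
  have -> : (fun y : R => - 2^-1 * y ^+ 2) = - 2^-1 \*: (fun y : R => y ^+ 2) by [].
  by apply: is_derive_eq; rewrite /GRing.scale/= expr1; field.
have hE : is_derive x (1 : R) (fun y => expR (- 2^-1 * y ^+ 2))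
    (- x * expR (- 2^-1 * x ^+ 2)).
  have := @is_derive1_comp R expR (fun y : R => - 2^-1 * y ^+ 2) x _ _
    (is_derive_expR _) hQ.
  by rewrite mulrC.
have hk := hX k.
have -> : (fun y : R => - normal_peak 1 * (y ^+ k * expR (- 2^-1 * y ^+ 2))) =
    - normal_peak 1 \*: ((fun y : R => y ^+ k) * (fun y => expR (- 2^-1 * y ^+ 2))).
  by [].
apply: is_derive_eq; rewrite /GRing.scale/= [x ^+ k.+1]exprS; ring.
Qed.

(** Integration by parts: the integrand times the density is the derivative of
    [- (x ^+ k * normal_pdf 0 1 x)], which vanishes at infinity. The cases 0, 1, 2 give the mean,
    the variance and the third moment; at 0 the truncated predecessor is multiplied by zero. *)
Lemma gauss_moment (k : nat) : (k <= 2)%N ->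
  \int[gamma]_x (x ^+ k.+1 - k%:R * x ^+ k.-1) = 0.
Proof.
move=> k2.
pose P (x : R) : R := x ^+ k.+1 - k%:R * x ^+ k.-1.
have qP : quartic P.
  have -> : P = (fun x => x ^+ k.+1 + (- k%:R) * x ^+ k.-1).
    by apply/funext => x; rewrite mulNr.
  apply: quarticD; first by apply: quarticX; rewrite ltnS (leq_trans k2).
  by apply: quarticZ; apply: quarticX; case: k k2 {P} => //= k /ltnW/leq_trans ->.
rewrite Rintegral_gamma; last by case: qP.
pose f (x : R) : R := P x * normal_pdf 0 1 x.
have intf := integrable_normal_quartic qP.
have cP : continuous P.
  move=> x; apply: cvgB; first exact: exprn_continuous.
  by apply: cvgM; [exact: cvg_cst|exact: exprn_continuous].
have cf : continuous f.
  by move=> x; apply: cvgM; [exact: cP|exact: continuous_normal_pdf (oner_neq0 _) x].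
pose F x : R := - (x ^+ k * normal_pdf 0 1 x).
have dF (x : R) : is_derive x 1 F (f x) by exact: is_derive_gauss.
have cF : continuous F.
  by move=> x; apply/differentiable_continuous/derivable1_diffP; exact: ex_derive.
have FTC (n : nat) : (\int[mu]_(x in `[(- n.+1%:R : R)%R, n.+1%:R%R]) (f x)%:E =
    (F n.+1%:R)%:E - (F (- n.+1%:R)%R)%:E)%E.
  apply: continuous_FTC2.
  - by rewrite (@lt_trans _ _ 0)// ?oppr_lt0 ltr0n.
  - exact: continuous_subspaceT.
  - split.
    + by move=> x _; exact: ex_derive.
    + by apply: cvg_at_right_filter; exact: cF.
    + by apply: cvg_at_left_filter; exact: cF.
  - by move=> x _; rewrite derive1E; exact: derive_val.
pose p1 := @normal_peak R 1.
have p10 : 0 <= p1 by exact: normal_peak_ge0.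
(* For [y >= 1] one has [y ^+ k <= y ^+ 2], and [expR (y ^+ 2 / 2)] is at least [y ^+ 4 / 16], hence
   at least [y ^+ 3 / 16]; two boundary terms double the 16. *)
have Fb (n : nat) : `|F n.+1%:R - F (- n.+1%:R)| <= 32 * p1 * n.+1%:R^-1.
  pose y : R := n.+1%:R; have y1 : 1 <= y by rewrite /y ler1n.
  have y0 : 0 < y by exact: lt_le_trans y1.
  suff B z : `|z| = y -> `|F z| <= 16 * p1 * y^-1.
    have := ler_normB (F y) (F (- y)).
    have By : `|F y| <= 16 * p1 * y^-1 by apply: B; rewrite gtr0_norm.
    have BNy : `|F (- y)| <= 16 * p1 * y^-1 by apply: B; rewrite normrN gtr0_norm.
    rewrite -/y => h; rewrite (le_trans h)// (le_trans (lerD By BNy))//.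
    by rewrite -mulrDl -mulrDl -natrD.
  move=> zy; rewrite /F normrN normrM normrX zy.
  rewrite (ger0_norm (normal_pdf_ge0 _ _ _)) normal_pdfE ?oner_eq0//.
  rewrite -/p1 /normal_fun subr0 expr1n -(real_normK (num_real z)) zy mulr2n.
  have -> : 16 * p1 * y^-1 = y ^+ 2 * (p1 * (16 * y ^- 3)) by field; rewrite gt_eqF.
  apply: ler_pM.
  - by rewrite exprn_ge0 ?ltW.
  - by rewrite mulr_ge0 ?expR_ge0.
  - exact: ler_weXn2l.
  rewrite ler_wpM2l// mulNr expRN -[leRHS]invrK lef_pV2 ?posrE ?expR_gt0//; last first.
    by rewrite invr_gt0 mulr_gt0// invr_gt0 exprn_gt0.
  have h := @expR_ge_sqr R (y ^+ 2 / (1 + 1)).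
  rewrite divr_ge0 ?sqr_ge0// in h; have {}h := h isT.
  apply: le_trans h; rewrite invfM invrK.
  have -> : (y ^+ 2 / (1 + 1)) ^+ 2 / 4 = 16^-1 * y ^+ 4 by field.
  by rewrite ler_wpM2l// ler_weXn2l.
pose fn (n : nat) (x : R) : \bar R := ((EFin \o f) \_ `[- n.+1%:R, n.+1%:R]) x.
have mf : measurable_fun setT (EFin \o f).
  by apply/measurable_EFinP; exact: (continuous_measurable_fun cf).
have mfn n : measurable_fun setT (fn n).
  exact: ((measurable_restrictT _ (measurable_itv _)).1 (measurable_funTS mf)).
have cvg1 : (\int[mu]_x fn n x @[n --> \oo] --> \int[mu]_x (f x)%:E)%E.
  apply: (@dominated_cvg _ _ _ mu setT measurableT fn (EFin \o f) (fun x => `|(f x)%:E|%E)).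
  - exact: mfn.
  - move=> x _; apply: cvg_near_cst; near=> n.
    rewrite /fn patchE mem_set//= in_itv/= -ler_norml.
    have xn : `|x| <= n%:R by near: n; exact: nbhs_infty_ger.
    by rewrite (le_trans xn)// ler_nat.
  - by [].
  - by have := integrable_abse intf; exact.
  - move=> n x _; rewrite /fn patchE; case: ifPn => _ //=.
    by rewrite normr0 lee_fin.
have cvg2 : (\int[mu]_x fn n x @[n --> \oo] --> 0)%E.
  have -> : (fun n => \int[mu]_x fn n x)%E =
      EFin \o (fun n => F n.+1%:R - F (- n.+1%:R)).
    by apply/funext => n; rewrite /fn -integral_mkcond FTC.
  apply: cvg_EFin; first by near=> n.
  apply/norm_cvg0P; apply: (@squeeze_cvgr _ _ _ _ (fun=> 0) (fun n => 32 * p1 * n.+1%:R^-1)).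
  - by near=> n; rewrite normr_ge0/= Fb.
  - exact: cvg_cst.
  - rewrite -(mulr0 (32 * p1)); apply: cvgMr; exact: cvg_harmonic.
rewrite /Rintegral -/f.
by have /= -> := cvg_unique _ cvg1 cvg2.
Unshelve. all: by end_near. Qed.

Lemma gauss_mean : \int[gamma]_x x = 0.
Proof.
transitivity (\int[gamma]_x (x ^+ 1 - 0%:R * x ^+ 0)).
  by apply: eq_Rintegral => x _; rewrite mul0r subr0 expr1.
exact: (@gauss_moment 0 isT).
Qed.

Lemma Rintegral_gamma_cst (a : R) : \int[gamma]_x a = a.
Proof. by rewrite Rintegral_cst//= probability_setT mulr1. Qed.

Lemma Rintegral_gammaD (f g : R -> R) : quartic f -> quartic g ->
  \int[gamma]_x (f x + g x) = \int[gamma]_x f x + \int[gamma]_x g x.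
Proof. by move=> qf qg; rewrite RintegralD//; exact: integrable_gamma. Qed.

Lemma Rintegral_gammaZ (a : R) (f : R -> R) : quartic f ->
  \int[gamma]_x (a * f x) = a * \int[gamma]_x f x.
Proof. by move=> qf; rewrite RintegralZl//; exact: integrable_gamma. Qed.

Lemma gauss_var : \int[gamma]_x (x ^+ 2) = 1.
Proof.
have := @gauss_moment 1 isT.
under eq_Rintegral do rewrite mul1r expr0.
rewrite Rintegral_gammaD ?Rintegral_gamma_cst; last 2 first.
- exact: quarticX.
- exact: quartic_cst.
by move/eqP; rewrite subr_eq0 => /eqP.
Qed.

Lemma gauss_skew : \int[gamma]_x (x ^+ 3) = 0.
Proof.
have := @gauss_moment 2 isT.
under eq_Rintegral do rewrite /= expr1 -mulNr.
rewrite Rintegral_gammaD; last 2 first.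
- exact: quarticX.
- by apply: quarticZ; exact: (@quarticX 1).
rewrite Rintegral_gammaZ; last exact: (@quarticX 1).
by rewrite gauss_mean mulr0 addr0.
Qed.

End gauss2.

(** * The Mehler operator: moments, kernel and symmetry *)

Section mehler.
Context {R : realType}.
Local Notation mu := (@lebesgue_measure R).
Local Notation gamma := (@normal_prob R 0 1).

(* For q = (s+1)/(t+1), the transition of X from time s to time t, without killing. *)
Definition mehler (q : R) (f : R -> R) (x : R) : R :=
  \int[gamma]_z f (Num.sqrt q * x + Num.sqrt (1 - q) * z).

Definition bounded_mfun (f : R -> R) :=
  measurable_fun setT f /\ exists M, forall x, `|f x| <= M.

Lemma measurable_affine (a b : R) : measurable_fun [set: R] (fun z : R => a + b * z).
Proof. by apply: measurable_funD => //; exact: measurable_funM. Qed.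

Lemma exprD4_le (a b : R) : (a + b) ^+ 4 <= 8 * (a ^+ 4 + b ^+ 4).
Proof.
have h1 := sqr_ge0 (a - b); have h2 := sqr_ge0 (a ^+ 2 - b ^+ 2).
have h3 := mulr_ge0 (sqr_ge0 (a + b)) h1.
have h4 := mulr_ge0 (addr_ge0 (sqr_ge0 a) (sqr_ge0 b)) h1.
suff -> : 8 * (a ^+ 4 + b ^+ 4) = (a + b) ^+ 4 + ((a + b) ^+ 2 * (a - b) ^+ 2
  + 2 * ((a ^+ 2 + b ^+ 2) * (a - b) ^+ 2) + 4 * (a ^+ 2 - b ^+ 2) ^+ 2) by lra.
by ring.
Qed.

Lemma quartic_affine (a b : R) (f : R -> R) :
  quartic f -> quartic (fun z => f (a + b * z)).
Proof.
move=> [mf [C fC]]; split.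
  exact: (measurableT_comp mf (measurable_affine a b)).
have C0 : 0 <= C by have := fC 0; rewrite expr0n addr0 mulr1; apply: le_trans.
exists (C * (1 + 8 * a ^+ 4 + 8 * b ^+ 4)) => z; apply: (le_trans (fC _)).
rewrite -mulrA ler_wpM2l//.
have h := exprD4_le a (b * z); rewrite exprMn in h.
have e4 (y : R) : 0 <= y ^+ 4 by rewrite (exprM y 2 2) sqr_ge0.
have := mulr_ge0 (e4 a) (e4 z); have := e4 b; have := e4 z; have := e4 a.
by lra.
Qed.

Lemma bounded_mfun_quartic f : bounded_mfun f -> quartic f.
Proof. by move=> [mf [M fM]]; exact: quartic_bounded fM. Qed.

Lemma eq_mehler (q : R) f g x : (forall y, f y = g y) -> mehler q f x = mehler q g x.
Proof. by move=> fg; apply: eq_Rintegral => z _; rewrite fg. Qed.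

Lemma mehlerD (q : R) f g x : quartic f -> quartic g ->
  mehler q (fun y => f y + g y) x = mehler q f x + mehler q g x.
Proof. by move=> qf qg; rewrite /mehler Rintegral_gammaD//; exact: quartic_affine. Qed.

Lemma mehlerZ (q : R) a f x : quartic f ->
  mehler q (fun y => a * f y) x = a * mehler q f x.
Proof. by move=> qf; rewrite /mehler Rintegral_gammaZ//; exact: quartic_affine. Qed.

Lemma mehler_cst (q : R) a x : mehler q (fun=> a) x = a.
Proof. by rewrite /mehler Rintegral_gamma_cst. Qed.

Lemma le_mehler (q : R) f g x : quartic f -> quartic g -> (forall y, f y <= g y) ->
  mehler q f x <= mehler q g x.
Proof.
move=> qf qg fg; apply: le_Rintegral => //; try exact: integrable_gamma (quartic_affine _ _ _).
Qed.

Lemma mehler1 f x : mehler 1 f x = f x.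
Proof.
rewrite /mehler sqrtr1 subrr sqrtr0.
under eq_Rintegral do rewrite mul1r mul0r addr0.
exact: Rintegral_gamma_cst.
Qed.

Lemma mehler_sqr (q : R) x : 0 <= q <= 1 ->
  mehler q (fun y => y ^+ 2) x = q * x ^+ 2 + (1 - q).
Proof.
move=> /andP[q0 q1]; rewrite /mehler.
pose a := Num.sqrt q * x; pose b := Num.sqrt (1 - q).
under eq_Rintegral => z _.
  rewrite (_ : (Num.sqrt q * x + Num.sqrt (1 - q) * z) ^+ 2 =
    a ^+ 2 + (2 * a * b * z ^+ 1 + b ^+ 2 * z ^+ 2)); last by rewrite -/a -/b; ring.
  over.
have q_1 := @quarticX R 1 isT; have q_2 := @quarticX R 2 isT.
rewrite Rintegral_gammaD; [|exact: quartic_cst|by apply: quarticD; exact: quarticZ].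
rewrite Rintegral_gammaD; [|exact: quarticZ|exact: quarticZ].
rewrite Rintegral_gamma_cst !Rintegral_gammaZ// gauss_var gauss_mean.
by rewrite mulr0 add0r mulr1 exprMn !sqr_sqrtr// subr_ge0.
Qed.

Definition m4 : R := \int[gamma]_x (x ^+ 4).

Lemma m4_ge0 : 0 <= m4.
Proof. by apply: Rintegral_ge0 => x _; rewrite (exprM x 2 2) sqr_ge0. Qed.

Lemma mehler_quart (q : R) x : 0 <= q <= 1 ->
  mehler q (fun y => y ^+ 4) x =
  q ^+ 2 * x ^+ 4 + 6 * q * (1 - q) * x ^+ 2 + (1 - q) ^+ 2 * m4.
Proof.
move=> /andP[q0 q1]; rewrite /mehler.
pose a := Num.sqrt q * x; pose b := Num.sqrt (1 - q).
under eq_Rintegral => z _.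
  rewrite (_ : (Num.sqrt q * x + Num.sqrt (1 - q) * z) ^+ 4 =
    a ^+ 4 + (4 * a ^+ 3 * b * z ^+ 1 + (6 * a ^+ 2 * b ^+ 2 * z ^+ 2 +
     (4 * a * b ^+ 3 * z ^+ 3 + b ^+ 4 * z ^+ 4)))); last by rewrite -/a -/b; ring.
  over.
have qZ (c : R) k : (k <= 4)%N -> quartic (fun z : R => c * z ^+ k).
  by move=> k4; apply: quarticZ; exact: quarticX.
have q34 := quarticD (qZ (4 * a * b ^+ 3) 3 isT) (qZ (b ^+ 4) 4 isT).
have q234 := quarticD (qZ (6 * a ^+ 2 * b ^+ 2) 2 isT) q34.
have q1234 := quarticD (qZ (4 * a ^+ 3 * b) 1 isT) q234.
rewrite Rintegral_gammaD//; last exact: quartic_cst.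
rewrite Rintegral_gammaD//; last exact: qZ.
rewrite Rintegral_gammaD//; last exact: qZ.
rewrite Rintegral_gammaD//; [|exact: qZ|exact: qZ].
rewrite Rintegral_gamma_cst !Rintegral_gammaZ; try exact: quarticX.
rewrite gauss_var gauss_mean gauss_skew -/m4 !mulr0 add0r mulr1 add0r.
have a2 : a ^+ 2 = q * x ^+ 2 by rewrite exprMn sqr_sqrtr.
have b2 : b ^+ 2 = 1 - q by rewrite sqr_sqrtr// subr_ge0.
by rewrite (exprM a 2 2) (exprM b 2 2) a2 b2; ring.
Qed.

(** Up to sign this is the second Hermite polynomial; the Mehler operator at ratio [q] multiplies
    the n-th one by the n-th power of [Num.sqrt q]. *)
Lemma mehler_phi (q : R) x : 0 <= q <= 1 ->
  mehler q (fun y => 1 - y ^+ 2) x = q * (1 - x ^+ 2).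
Proof.
move=> q01; rewrite (@eq_mehler _ _ (fun y => 1 + (- 1) * y ^+ 2)); last first.
  by move=> y; rewrite mulN1r.
have q_2 := @quarticX R 2 isT.
rewrite mehlerD; [|exact: quartic_cst|exact: quarticZ].
by rewrite mehler_cst mehlerZ// mehler_sqr//; ring.
Qed.

Lemma quartic_diff4 (x : R) : quartic (fun y => (y - x) ^+ 4).
Proof.
have := quartic_affine (- x) 1 (@quarticX R 4 isT).
by congr quartic; apply/funext => y; rewrite mul1r addrC.
Qed.

(** The displacement is a drift [(Num.sqrt q - 1) * x] plus noise of variance [1 - q]. Since
    [(1 - Num.sqrt q) ^+ 2 <= 1 - q], both have fourth moments of order [(1 - q) ^+ 2]; summed over
    a fine grid this tends to 0. *)
Lemma mehler_diff4 (q : R) x : 0 <= q <= 1 -> `|x| <= 1 ->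
  mehler q (fun y => (y - x) ^+ 4) x <= 8 * (1 + m4) * (1 - q) ^+ 2.
Proof.
move=> /andP[q0 q1] x1.
have s0 : 0 <= 1 - q by rewrite subr_ge0.
have b2 : Num.sqrt (1 - q) ^+ 2 = 1 - q by rewrite sqr_sqrtr.
have a2 : Num.sqrt q ^+ 2 = q by rewrite sqr_sqrtr.
have a0 : 0 <= Num.sqrt q by rewrite sqrtr_ge0.
have a1 : Num.sqrt q <= 1 by rewrite -sqrtr1 ler_wsqrtr.
apply: (@le_trans _ _ (\int[gamma]_z (8 * (1 - q) ^+ 2 + 8 * (1 - q) ^+ 2 * z ^+ 4))).
  have q4 := @quarticX R 4 isT.
  apply: le_Rintegral => //.
  - exact: integrable_gamma (quartic_affine _ _ (quartic_diff4 x)).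
  - by apply: integrable_gamma; apply: quarticD; [exact: quartic_cst|exact: quarticZ].
  move=> z _.
  have -> : Num.sqrt q * x + Num.sqrt (1 - q) * z - x =
    (Num.sqrt q - 1) * x + Num.sqrt (1 - q) * z by ring.
  apply: (le_trans (exprD4_le _ _)).
  have -> : 8 * (1 - q) ^+ 2 + 8 * (1 - q) ^+ 2 * z ^+ 4 =
    8 * ((1 - q) ^+ 2 + (1 - q) ^+ 2 * z ^+ 4) by ring.
  rewrite ler_wpM2l//.
  rewrite !exprMn (exprM (Num.sqrt (1 - q)) 2 2) b2 lerD2r.
  have x4 : x ^+ 4 <= 1.
    by rewrite -[leLHS]ger0_norm ?(exprM x 2 2) ?sqr_ge0// normrX normrX -exprM exprn_ile1.
  have d0 : 0 <= 1 - Num.sqrt q by rewrite subr_ge0.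
  have d1 : (1 - Num.sqrt q) ^+ 2 <= 1 - q.
    by rewrite -[in leRHS]a2; nra.
  have d2 : (Num.sqrt q - 1) ^+ 4 <= (1 - q) ^+ 2.
    have -> : (Num.sqrt q - 1) ^+ 4 = ((1 - Num.sqrt q) ^+ 2) ^+ 2 by ring.
    by rewrite ler_sqr ?nnegrE// sqr_ge0.
  apply: (le_trans _ d2); rewrite ler_piMr//.
  by rewrite (exprM _ 2 2) sqr_ge0.
have q4 := @quarticX R 4 isT.
rewrite Rintegral_gammaD; [|exact: quartic_cst|exact: quarticZ].
by rewrite Rintegral_gamma_cst Rintegral_gammaZ// -/m4; lra.
Qed.

Lemma EFin_Rintegral_gamma (f : R -> R) : quartic f ->
  (\int[gamma]_x (f x)%:E = (\int[gamma]_x f x)%:E)%E.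
Proof.
move=> qf; rewrite /Rintegral fineK//; apply: integrable_fin_num => //.
exact: integrable_gamma.
Qed.

Lemma bounded_mfun_cst (a : R) : bounded_mfun (fun=> a).
Proof. by split=> //; exists `|a|. Qed.

Lemma bounded_mfunD f g : bounded_mfun f -> bounded_mfun g ->
  bounded_mfun (fun x => f x + g x).
Proof.
move=> [mf [M fM]] [mg [N gN]]; split; first exact: measurable_funD.
by exists (M + N) => x; rewrite (le_trans (ler_normD _ _))// lerD.
Qed.

Lemma bounded_mfunM f g : bounded_mfun f -> bounded_mfun g ->
  bounded_mfun (fun x => f x * g x).
Proof.
move=> [mf [M fM]] [mg [N gN]]; split; first exact: measurable_funM.
by exists (M * N) => x; rewrite normrM ler_pM.
Qed.

Lemma bounded_mfunZ a f : bounded_mfun f -> bounded_mfun (fun x => a * f x).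
Proof. by move=> bf; apply: bounded_mfunM => //; exact: bounded_mfun_cst. Qed.

Lemma bounded_mfun_indic (D : set R) : measurable D -> bounded_mfun (\1_D).
Proof.
move=> mD; split; first exact: measurable_indic.
by exists 1 => x; rewrite indicE; case: (_ \in _); rewrite ?normr0 ?normr1.
Qed.

Lemma mehler_bound (q : R) f M x : bounded_mfun f -> (forall y, `|f y| <= M) ->
  `|mehler q f x| <= M.
Proof.
move=> bf fM; have qf := bounded_mfun_quartic bf; rewrite ler_norml; apply/andP; split.
  rewrite -(mehler_cst q (- M) x); apply: le_mehler => //; first exact: quartic_cst.
  by move=> y; have := fM y; rewrite ler_norml => /andP[].
rewrite -[leRHS](mehler_cst q M x); apply: le_mehler => //; first exact: quartic_cst.
by move=> y; have := fM y; rewrite ler_norml => /andP[].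
Qed.

Lemma bounded_mfun_mehler (q : R) f : bounded_mfun f -> bounded_mfun (mehler q f).
Proof.
move=> bf; have [mf [M fM]] := bf; split; last first.
  by exists M => x; exact: mehler_bound.
have M0 : 0 <= M by exact: le_trans (fM 0).
(* Adding the bound [M] makes the integrand nonnegative, so that measurability in [x] follows from
   Tonelli; the constant is subtracted again afterwards. *)
pose h x z : \bar R := (f (Num.sqrt q * x + Num.sqrt (1 - q) * z) + M)%:E.
have h0 x z : (0 <= h x z)%E.
  by rewrite lee_fin; have := fM (Num.sqrt q * x + Num.sqrt (1 - q) * z); rewrite ler_norml => /andP[]; lra.
have mh : measurable_fun [set: R * R] (fun xz => h xz.1 xz.2).
  apply/measurable_EFinP/measurable_funD => //.
  apply: (measurableT_comp mf); apply: measurable_funD.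
    by apply: measurable_funM.
  by apply: measurable_funM.
have mF := @measurable_fun_fubini_tonelli_F _ _ _ _ R gamma _ mh (fun xz => h0 xz.1 xz.2).
have -> : mehler q f = fun x => fine (fubini_F gamma (fun xz => h xz.1 xz.2) x) - M.
  apply/funext => x; rewrite /fubini_F /h/= -/(Rintegral _ _ _).
  have qf := bounded_mfun_quartic bf.
  rewrite Rintegral_gammaD; [|exact: quartic_affine|exact: quartic_cst].
  by rewrite Rintegral_gamma_cst addrK.
apply: measurable_funB => //.
exact: (measurableT_comp (@fine_measurable R setT measurableT) mF).
Qed.

Definition mehler_pdf (q x y : R) : R := normal_pdf (Num.sqrt q * x) (Num.sqrt (1 - q)) y.

Lemma measurable_kernel (q : R) : q < 1 ->
  measurable_fun [set: R * R] (fun xy => mehler_pdf q xy.1 xy.2).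
Proof.
move=> q1; rewrite /mehler_pdf.
have s0 : Num.sqrt (1 - q) != 0 by rewrite gt_eqF// sqrtr_gt0 subr_gt0.
have -> : (fun xy : R * R => normal_pdf (Num.sqrt q * xy.1) (Num.sqrt (1 - q)) xy.2) =
  (fun xy : R * R => normal_pdf 0 (Num.sqrt (1 - q)) (xy.2 - Num.sqrt q * xy.1)).
  by apply/funext => xy; rewrite !normal_pdfE//= /normal_fun subr0.
apply: (measurableT_comp (measurable_normal_pdf _ _)).
apply: measurable_funB => //.
by apply: measurable_funM.
Qed.

Lemma mehler_kernel (q : R) f x : q < 1 -> bounded_mfun f -> (forall y, 0 <= f y) ->
  ((mehler q f x)%:E = \int[mu]_y (f y * mehler_pdf q x y)%:E)%E.
Proof.
move=> q1 bf f0; have qf := bounded_mfun_quartic bf; have [mf _] := bf.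
have s0 : 0 < Num.sqrt (1 - q) by rewrite sqrtr_gt0 subr_gt0.
rewrite -EFin_Rintegral_gamma; last exact: quartic_affine.
have mfE : measurable_fun setT (EFin \o f) by exact/measurable_EFinP.
rewrite -(@ge0_integral_normal_affine _ (Num.sqrt q * x) _ (EFin \o f) s0)//.
by rewrite ge0_integral_normal_prob.
Qed.

(** Detailed balance: both exponents equal minus [(x ^+ 2 - 2 * Num.sqrt q * x * y + y ^+ 2) / (2 *
    (1 - q))], which is symmetric in [x] and [y]. *)
Lemma kernel_sym (q x y : R) : 0 < q < 1 ->
  normal_pdf 0 1 x * mehler_pdf q x y = normal_pdf 0 1 y * mehler_pdf q y x.
Proof.
move=> /andP[q0 q1].
have s0 : Num.sqrt (1 - q) != 0 by rewrite gt_eqF// sqrtr_gt0 subr_gt0.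
have a2 : Num.sqrt q ^+ 2 = q by rewrite sqr_sqrtr// ltW.
rewrite /mehler_pdf !normal_pdfE ?oner_eq0// /normal_fun !subr0 expr1n !mulr2n.
rewrite sqr_sqrtr; last by rewrite subr_ge0 ltW.
have M (c d A B : R) : c * expR A * (d * expR B) = c * d * expR (A + B).
  by rewrite expRD; ring.
rewrite !M; congr (_ * expR _).
move: (Num.sqrt q) a2 => r a2; rewrite -a2; field.
by rewrite a2 gt_eqF// addr_gt0// subr_gt0.
Qed.

Lemma mehler_sym (q : R) f g : 0 < q < 1 ->
  bounded_mfun f -> (forall y, 0 <= f y) -> bounded_mfun g -> (forall y, 0 <= g y) ->
  \int[gamma]_x (g x * mehler q f x) = \int[gamma]_x (f x * mehler q g x).
Proof.
move=> q01 bf f0 bg g0; have /andP[q0 q1] := q01.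
have mk := measurable_kernel q1.
have mpdf : measurable_fun [set: R] (normal_pdf 0 1 : R -> R) by exact: measurable_normal_pdf.
have E f' g' : bounded_mfun f' -> (forall y, 0 <= f' y) -> bounded_mfun g' ->
   (forall y, 0 <= g' y) ->
   (\int[gamma]_x (g' x * mehler q f' x)%:E =
    \int[mu]_x \int[mu]_y (g' x * f' y * (normal_pdf 0 1 x * mehler_pdf q x y))%:E)%E.
  move=> bf' f'0 bg' g'0; have [mf' _] := bf'; have [mg' _] := bg'.
  have [mm _] := bounded_mfun_mehler q bf'.
  have m0 x : 0 <= mehler q f' x.
    rewrite -(mehler_cst q 0 x); apply: le_mehler => //; first exact: quartic_cst.
    exact: bounded_mfun_quartic.
  rewrite ge0_integral_normal_prob; last 2 first.
  - exact/measurable_EFinP/measurable_funM.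
  - by move=> x; rewrite lee_fin mulr_ge0.
  apply: eq_integral => x _; rewrite -EFinM mulrAC EFinM mehler_kernel//.
  rewrite -ge0_integralZl//; last 3 first.
  - apply/measurable_EFinP/measurable_funM => //; exact: measurable_normal_pdf.
  - by move=> y _; rewrite lee_fin mulr_ge0// normal_pdf_ge0.
  - by rewrite lee_fin mulr_ge0// normal_pdf_ge0.
  by apply: eq_integral => y _; rewrite -EFinM; congr EFin; ring.
have [mf _] := bf; have [mg _] := bg.
rewrite /Rintegral; congr fine; apply: (eq_trans (E f g bf f0 bg g0)).
apply: esym; apply: (eq_trans (E g f bg g0 bf f0)); apply: esym.
pose F (xy : R * R) := (g xy.1 * f xy.2 * (normal_pdf 0 1 xy.1 * mehler_pdf q xy.1 xy.2))%:E.
have mF : measurable_fun setT F.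
  apply/measurable_EFinP; apply: measurable_funM; apply: measurable_funM => //.
  - exact: (measurableT_comp mg).
  - exact: (measurableT_comp mf).
  - exact: (measurableT_comp mpdf).
have F0 xy : (0 <= F xy)%E by rewrite lee_fin !mulr_ge0// normal_pdf_ge0.
apply: (eq_trans (@fubini_tonelli _ _ _ _ R mu mu F mF F0)).
apply: eq_integral => y _; apply: eq_integral => x _; rewrite /F/=.
by rewrite kernel_sym// [g x * _]mulrC.
Qed.

End mehler.

(** * Evolution killed at the points of a finite grid *)

Section killed.
Context {R : realType}.
Local Notation gamma := (@normal_prob R 0 1).
Implicit Types (D : set R) (q x : R) (qs : seq R) (f g : R -> R).

Definition Iunit : set R := `]-1, 1[%classic.

Lemma measurable_Iunit : measurable Iunit. Proof. exact: measurable_itv. Qed.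

Lemma IunitP x : Iunit x <-> 0 < 1 - x ^+ 2.
Proof.
rewrite /Iunit/= in_itv/= -ltr_norml subr_gt0 -[in X in _ <-> X](real_normK (num_real x)).
by rewrite expr_lt1.
Qed.

Lemma Iunit_norm x : Iunit x -> `|x| <= 1.
Proof. by rewrite /Iunit/= in_itv/= -ltr_norml => /ltW. Qed.

(** The list holds the successive time ratios. The indicator acts at every grid time, the first and
    the last included, so that concatenating lists composes the operators. [D] is a parameter
    because the lower bound kills outside a superlevel set of [phi]. *)
Fixpoint killed D qs f : R -> R :=
  match qs with
  | [::] => fun x => \1_D x * f x
  | q :: qs' => fun x => \1_D x * mehler q (killed D qs' f) x
  end.

Definition phi x : R := 1 - x ^+ 2.
(** The free evolution has the unbounded [phi] as exact eigenfunction; the killed one is applied to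
    this bounded nonnegative truncation. *)
Definition phi0 x : R := \1_Iunit x * phi x.

Lemma quartic_phi : quartic phi.
Proof.
have -> : phi = fun x => 1 + (- 1) * x ^+ 2 by apply/funext => x; rewrite mulN1r.
by apply: quarticD; [exact: quartic_cst|apply: quarticZ; exact: quarticX].
Qed.

Lemma phi0_in x : Iunit x -> phi0 x = phi x.
Proof. by move=> Ix; rewrite /phi0 indicE mem_set// mul1r. Qed.

Lemma phi0_ge0 x : 0 <= phi0 x.
Proof.
rewrite /phi0 indicE; have [xI|_] := boolP (x \in Iunit); last by rewrite mul0r.
by rewrite mul1r ltW//; apply/IunitP; rewrite inE in xI.
Qed.

Lemma phi0_le1 x : phi0 x <= 1.
Proof.
rewrite /phi0 indicE; case: (_ \in _); rewrite ?mul0r// mul1r /phi.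
by rewrite gerBl sqr_ge0.
Qed.

Lemma bounded_mfun_phi0 : bounded_mfun phi0.
Proof.
split; last by exists 1 => x; rewrite ger0_norm ?phi0_ge0// phi0_le1.
apply: measurable_funM; first exact: (measurable_indic measurable_Iunit).
by have [] := quartic_phi.
Qed.

Lemma killed_bounded D qs f : measurable D -> bounded_mfun f ->
  bounded_mfun (killed D qs f).
Proof.
move=> mD bf; elim: qs => [|q qs IH] /=.
  by apply: bounded_mfunM => //; exact: bounded_mfun_indic.
apply: bounded_mfunM; first exact: bounded_mfun_indic.
exact: bounded_mfun_mehler.
Qed.

Lemma killed_out D qs f x : ~ D x -> killed D qs f x = 0.
Proof. by move=> Dx; case: qs => [|q qs] /=; rewrite indicE memNset// mul0r. Qed.

Lemma killed_in D q qs f x : D x -> killed D (q :: qs) f x = mehler q (killed D qs f) x.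
Proof. by move=> Dx /=; rewrite indicE mem_set// mul1r. Qed.

Lemma killed0_in D f x : D x -> killed D [::] f x = f x.
Proof. by move=> Dx /=; rewrite indicE mem_set// mul1r. Qed.

Lemma indic_killed D qs f x : \1_D x * killed D qs f x = killed D qs f x.
Proof.
have [Dx|Dx] := pselect (D x); first by rewrite indicE mem_set// mul1r.
by rewrite killed_out// mulr0.
Qed.

Lemma eq_killed D qs f g : (forall x, D x -> f x = g x) -> killed D qs f = killed D qs g.
Proof.
move=> fg; elim: qs => [|q qs IH] /=; last by rewrite IH.
apply/funext => x; rewrite indicE; have [xD|] := boolP (x \in D).
  by rewrite !mul1r fg//; rewrite inE in xD.
by rewrite !mul0r.
Qed.

Lemma killed_cat D qs1 qs2 f : killed D (qs1 ++ qs2) f = killed D qs1 (killed D qs2 f).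
Proof.
elim: qs1 => [|q qs1 IH] /=; last by rewrite IH.
by apply/funext => x; rewrite indic_killed.
Qed.

Lemma le_killed D qs f g : measurable D -> bounded_mfun f -> bounded_mfun g ->
  (forall x, D x -> f x <= g x) -> forall x, killed D qs f x <= killed D qs g x.
Proof.
move=> mD bf bg fg; elim: qs => [|q qs IH] x /=.
  rewrite indicE; have [xD|] := boolP (x \in D); last by rewrite !mul0r.
  by rewrite !mul1r fg//; rewrite inE in xD.
apply: ler_wpM2l; first by rewrite indicE.
by apply: le_mehler => //; apply: bounded_mfun_quartic; exact: killed_bounded.
Qed.

Lemma killed_0 D qs : killed D qs (fun=> 0) = (fun=> 0).
Proof.
elim: qs => [|q qs IH] /=; apply/funext => x; first by rewrite mulr0.
by rewrite IH mehler_cst mulr0.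
Qed.

Lemma killed_ge0 D qs f : measurable D -> bounded_mfun f ->
  (forall x, D x -> 0 <= f x) -> forall x, 0 <= killed D qs f x.
Proof.
move=> mD bf f0 x; have := @le_killed D qs (fun=> 0) f mD (bounded_mfun_cst 0) bf f0 x.
by rewrite killed_0.
Qed.

Lemma killedD D qs f g : measurable D -> bounded_mfun f -> bounded_mfun g ->
  forall x, killed D qs (fun y => f y + g y) x = killed D qs f x + killed D qs g x.
Proof.
move=> mD bf bg; elim: qs => [|q qs IH] x /=; first by rewrite mulrDr.
rewrite (@eq_mehler _ _ _ (fun y => killed D qs f y + killed D qs g y))//.
rewrite mehlerD ?mulrDr//; by apply: bounded_mfun_quartic; exact: killed_bounded.
Qed.

Lemma killed1_le1 D qs x : measurable D -> killed D qs (fun=> 1) x <= 1.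
Proof.
move=> mD; elim: qs x => [|q qs IH] x /=; first by rewrite mulr1 indicE; case: (_ \in _).
have h : mehler q (killed D qs (fun=> 1)) x <= 1.
  rewrite -[leRHS](mehler_cst q 1 x); apply: le_mehler => //; last exact: quartic_cst.
  by apply: bounded_mfun_quartic; exact: killed_bounded (bounded_mfun_cst 1).
by rewrite indicE; case: (_ \in _); rewrite ?mul1r ?mul0r.
Qed.

Definition ratios qs := all (fun q => 0 < q < 1) qs.

Lemma ratios_prod qs : ratios qs -> 0 < \prod_(q <- qs) q <= 1.
Proof.
elim: qs => [|q qs IH] /=; first by rewrite big_nil ltr01 lexx.
move=> /andP[/andP[q0 q1] /IH/andP[p0 p1]].
by rewrite big_cons mulr_gt0//= mulr_ile1// ltW.
Qed.

(* A function that stays below zero off [D] and evolves by [mehler] is dominated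
   by the killed evolution; no overshoot has to be estimated. *)
Lemma killed_phi0_lower D (c : R) qs : measurable D -> D `<=` Iunit -> 0 <= c ->
  (forall x, ~ D x -> phi x <= c) -> ratios qs ->
  forall x, (\prod_(q <- qs) q) * phi x - c <= killed D qs phi0 x.
Proof.
move=> mD DI c0 Dc; elim: qs => [_ x|q qs IH /=].
  rewrite big_nil mul1r; have [Dx|Dx] := pselect (D x).
    by rewrite killed0_in// phi0_in ?gerBl//; exact: DI.
  by rewrite killed_out// subr_le0 Dc.
move=> /andP[/andP[q0 q1] rqs] x; rewrite big_cons.
have /andP[p0 p1] := ratios_prod rqs.
have [Dx|Dx] := pselect (D x); last first.
  rewrite indicE memNset// mul0r subr_le0.
  have := Dc x Dx; have [h _|h] := leP (phi x) 0.
    by rewrite (le_trans _ c0)// mulr_ge0_le0// mulr_ge0// ltW.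
  apply: le_trans; apply: ler_piMl; first exact: ltW.
  by rewrite mulr_ile1// ltW.
rewrite indicE mem_set// mul1r.
have -> : q * (\prod_(j <- qs) j) * phi x - c =
    mehler q (fun y => (\prod_(j <- qs) j) * phi y + (- c)) x.
  rewrite mehlerD; [|by apply: quarticZ; exact: quartic_phi|exact: quartic_cst].
  rewrite mehlerZ ?mehler_cst; last exact: quartic_phi.
  by rewrite mehler_phi ?(ltW q0) ?(ltW q1)// mulrCA mulrA.
apply: le_mehler.
- by apply: quarticD; [apply: quarticZ; exact: quartic_phi|exact: quartic_cst].
- by apply: bounded_mfun_quartic; exact: killed_bounded bounded_mfun_phi0.
- exact: IH.
Qed.

(** The Chapman-Kolmogorov identity, carried as an assumption until the Brownian motion supplies
    it. *)
Definition mehler_law := forall (q1 q2 : R) f x, 0 < q1 < 1 -> 0 < q2 < 1 ->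
  bounded_mfun f -> (forall y, 0 <= f y) ->
  mehler q1 (mehler q2 f) x = mehler (q1 * q2) f x.

(** Paths that have left the interval contribute at most [K] to the free expectation. Analytically,
    the free evolution minus [K] is nonpositive off the interval, and constants are preserved by
    [mehler], so it stays below the killed evolution. The bound [q0] keeps every remaining ratio in
    the range where [K] is valid. *)
Lemma killed_free_lower (K q0 : R) qs f : mehler_law -> bounded_mfun f ->
  (forall x, 0 <= f x) -> 0 <= K ->
  (forall q x, q0 <= q <= 1 -> ~ Iunit x -> mehler q f x <= K) ->
  ratios qs -> q0 <= \prod_(q <- qs) q ->
  forall x, mehler (\prod_(q <- qs) q) f x - K <= killed Iunit qs f x.
Proof.
move=> ML bf f0 K0 HK; elim: qs => [_ q01 x|q qs IH /=].
  rewrite !big_nil in q01 *; have [Dx|Dx] := pselect (Iunit x).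
    by rewrite killed0_in// mehler1 gerBl.
  by rewrite killed_out// subr_le0 HK// q01 lexx.
move=> /andP[/andP[qgt0 q1] rqs]; rewrite big_cons => hq x.
have /andP[p0 p1] := ratios_prod rqs.
have [Dx|Dx] := pselect (Iunit x); last first.
  by rewrite indicE memNset// mul0r subr_le0 HK// hq/= mulr_ile1// ltW.
rewrite indicE mem_set// mul1r.
have hp : q0 <= \prod_(j <- qs) j by apply: (le_trans hq); rewrite ler_piMl ?ltW.
have bm : bounded_mfun (mehler (\prod_(j <- qs) j) f) by exact: bounded_mfun_mehler.
have -> : mehler (q * \prod_(j <- qs) j) f x - K =
    mehler q (fun y => mehler (\prod_(j <- qs) j) f y + (- K)) x.
  rewrite mehlerD; [|exact: bounded_mfun_quartic|exact: quartic_cst].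
  rewrite mehler_cst; congr (_ + _).
  move: p1; rewrite le_eqVlt => /orP[/eqP ->|p1]; last by rewrite ML ?qgt0 ?p0.
  by rewrite mulr1; apply: eq_mehler => y; rewrite mehler1.
apply: le_mehler.
- by apply: quarticD; [exact: bounded_mfun_quartic|exact: quartic_cst].
- exact: bounded_mfun_quartic (killed_bounded _ measurable_Iunit bf).
- exact: IH.
Qed.

Lemma killed_le_mehler D qs f : mehler_law -> measurable D -> bounded_mfun f ->
  (forall x, 0 <= f x) -> ratios qs ->
  forall x, killed D qs f x <= mehler (\prod_(q <- qs) q) f x.
Proof.
move=> ML mD bf f0; elim: qs => [_ x|q qs IH /=].
  rewrite big_nil mehler1/= indicE; case: (_ \in _); rewrite ?mul1r//.
  by rewrite mul0r.
move=> /andP[/andP[q0 q1] rqs] x; rewrite big_cons.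
have /andP[p0 p1] := ratios_prod rqs.
have bk := killed_bounded qs mD bf.
have bm : bounded_mfun (mehler (\prod_(j <- qs) j) f) by exact: bounded_mfun_mehler.
have -> : mehler (q * \prod_(j <- qs) j) f x =
   mehler q (mehler (\prod_(j <- qs) j) f) x.
  move: p1; rewrite le_eqVlt => /orP[/eqP ->|p1]; last by rewrite ML ?q0 ?p0.
  by rewrite mulr1; apply: eq_mehler => y; rewrite mehler1.
have h : mehler q (killed D qs f) x <= mehler q (mehler (\prod_(j <- qs) j) f) x.
  apply: le_mehler; [exact: bounded_mfun_quartic|exact: bounded_mfun_quartic|].
  exact: IH.
apply: le_trans h; rewrite indicE; case: (_ \in _); rewrite ?mul1r// mul0r.
rewrite -(mehler_cst q 0 x); apply: le_mehler; first exact: quartic_cst.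
- exact: bounded_mfun_quartic.
- by apply: killed_ge0 => // y _.
Qed.

Section supersolution.
Variables (v : R -> R) (lam c C eps Ceps : R).
Hypotheses (qv : quartic v) (lam01 : 0 <= lam <= 1) (c0 : 0 <= c) (C0 : 0 <= C)
  (eps0 : 0 <= eps) (Ceps0 : 0 <= Ceps).
Hypothesis Hv : forall q x, 0 < q < 1 -> Iunit x ->
  mehler q v x <= (1 - lam * (1 - q)) * v x - c * (1 - q) + C * (1 - q) ^+ 2.
Hypothesis Hout : forall x y, Iunit x -> ~ Iunit y ->
  - v y <= eps + Ceps * (y - x) ^+ 4.

(** [sup_beta] is the discount produced by the rate [lam]; [sup_kappa] below collects the discounted
    gains from the constant drift [- c]. The section is used with [lam = 1, c = 0] for the
    eigenfunction and with [lam = 0, c = 1] for the survival probability. *)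
Fixpoint sup_beta qs : R :=
  if qs is q :: qs' then (1 - lam * (1 - q)) * sup_beta qs' else 1.
Fixpoint sup_kappa qs : R :=
  if qs is q :: qs' then sup_kappa qs' + c * (1 - q) * sup_beta qs' else 0.

Lemma sup_beta01 qs : ratios qs -> 0 <= sup_beta qs <= 1.
Proof.
elim: qs => [|q qs IH] /=; first by rewrite ler01 lexx.
move=> /andP[/andP[q0 q1] /IH/andP[p0 p1]]; move: lam01 => /andP[l0 l1].
have h0 : 0 <= lam * (1 - q) by rewrite mulr_ge0// subr_ge0 ltW.
have h1 : lam * (1 - q) <= 1 by rewrite mulr_ile1// ?subr_ge0 ?gerBl ltW.
by rewrite mulr_ge0 ?subr_ge0//= mulr_ile1// ?subr_ge0// gerBl.
Qed.

Let Ctot := C + Ceps * (8 * (1 + m4)).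

(** A supersolution bounds the killed evolution even though [v] may be negative where a jump lands:
    [Hout] charges that negative part to [eps] and to a fourth power of the jump, whose mean is of
    order [(1 - q) ^+ 2]. The factor [1 - killed Iunit qs (fun=> 1) x] is the exit probability, so
    [eps] is paid once on exit and not at every step. *)
Lemma killed_upper f qs : bounded_mfun f -> (forall x, Iunit x -> f x <= v x) ->
  ratios qs -> forall x, Iunit x ->
  killed Iunit qs f x + sup_kappa qs * killed Iunit qs (fun=> 1) x <=
  sup_beta qs * v x + eps * (1 - killed Iunit qs (fun=> 1) x)
  + Ctot * \sum_(q <- qs) (1 - q) ^+ 2.
Proof.
move=> bf fv; elim: qs => [_ x Ix|q qs IH].
  by rewrite !killed0_in// big_nil /= mul0r !addr0 mul1r subrr !mulr0 !addr0 fv.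
move=> /=/andP[/andP[q0 q1] rqs] x Ix.
have {}IH := IH rqs; have /andP[b0 b1] := sup_beta01 rqs.
move: (sup_beta qs) b0 b1 IH => b b0 b1 IH.
rewrite big_cons indicE mem_set// !mul1r.
pose A := killed Iunit qs f; pose B := killed Iunit qs (fun=> 1).
pose S := \sum_(q <- qs) (1 - q) ^+ 2.
have S0 : 0 <= S by rewrite sumr_ge0// => y _; exact: sqr_ge0.
have M0 := @m4_ge0 R.
have Ct0 : 0 <= Ctot by rewrite addr_ge0 ?mulr_ge0// addr_ge0.
have qA : quartic A.
  exact: bounded_mfun_quartic (killed_bounded _ measurable_Iunit bf).
have qB : quartic B.
  exact: bounded_mfun_quartic (killed_bounded _ measurable_Iunit (bounded_mfun_cst 1)).
have qI : quartic (\1_Iunit : R -> R).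
  exact: bounded_mfun_quartic (bounded_mfun_indic measurable_Iunit).
have qd := quartic_diff4 x.
have q01' : 0 <= q <= 1 by rewrite !ltW.
have mB1 : mehler q B x <= 1.
  rewrite -[leRHS](mehler_cst q 1 x); apply: le_mehler => //; first exact: quartic_cst.
  by move=> y; apply: killed1_le1; exact: measurable_Iunit.
have mI1 : mehler q (\1_Iunit) x <= 1.
  rewrite -[leRHS](mehler_cst q 1 x); apply: le_mehler => //; exact: quartic_cst.
(* [F] extends the induction bound to the whole line. Inside, its [eps] terms add up to
   [eps * (1 - B y)]; outside it is nonnegative by [Hout]. Splitting off [b * eps] leaves a
   nonnegative coefficient before the indicator, whose mean is at most 1. *)
pose F1 y := b * v y + b * Ceps * (y - x) ^+ 4.
pose F2 y := (eps - b * eps) * \1_Iunit y + - eps * B y.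
pose F y := F1 y + (b * eps + Ctot * S + F2 y).
have qF1 : quartic F1 by apply: quarticD; exact: quarticZ.
have qF2 : quartic F2 by apply: quarticD; exact: quarticZ.
have qF3 : quartic (fun y => b * eps + Ctot * S + F2 y).
  by apply: quarticD => //; exact: quartic_cst.
have PF : mehler q A x + sup_kappa qs * mehler q B x <= mehler q F x.
  rewrite -mehlerZ// -mehlerD//; last exact: quarticZ.
  apply: le_mehler; [by apply: quarticD => //; exact: quarticZ|exact: quarticD|].
  move=> y; rewrite /F /F1 /F2.
  have e4 : 0 <= b * (Ceps * (y - x) ^+ 4).
    by apply: mulr_ge0 => //; apply: mulr_ge0 => //; exact: exprn_even_ge0.
  have [Iy|Iy] := pselect (Iunit y).
    have := IH y Iy; rewrite -/A -/B -/S indicE mem_set// mulr1.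
    move: (A y) (B y) e4 => a b' e4; rewrite mulrA in e4.
    move: (b * Ceps * _) e4 => e e4; lra.
  rewrite /A /B !killed_out// indicE memNset// mulr0.
  have h1 : 0 <= b * (v y + eps + Ceps * (y - x) ^+ 4).
    by apply: mulr_ge0 => //; have := Hout Ix Iy; lra.
  have h2 := mulr_ge0 Ct0 S0; rewrite !mulr0 !addr0.
  have -> : b * v y + b * Ceps * (y - x) ^+ 4 + (b * eps + Ctot * S) =
    b * (v y + eps + Ceps * (y - x) ^+ 4) + Ctot * S by ring.
  exact: addr_ge0.
have EF : mehler q F x = b * mehler q v x + b * Ceps * mehler q (fun y => (y - x) ^+ 4) x
    + (b * eps + Ctot * S + ((eps - b * eps) * mehler q (\1_Iunit) x - eps * mehler q B x)).
  rewrite mehlerD// mehlerD//; [|exact: quarticZ|exact: quarticZ].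
  rewrite mehlerD//; [|exact: quartic_cst].
  rewrite mehler_cst /F2 mehlerD//; [|exact: quarticZ|exact: quarticZ].
  by rewrite !mehlerZ// mulNr.
rewrite EF in PF.
have T1 := ler_wpM2l b0 (@Hv q x (introT andP (conj q0 q1)) Ix).
have T2 := ler_wpM2l (mulr_ge0 b0 Ceps0) (mehler_diff4 q01' (Iunit_norm Ix)).
have T3 : (eps - b * eps) * mehler q (\1_Iunit) x <= eps - b * eps.
  by rewrite ler_piMr// subr_ge0 ler_piMl.
have T4 : b * (Ctot * (1 - q) ^+ 2) <= Ctot * (1 - q) ^+ 2.
  by rewrite ler_piMl// mulr_ge0// sqr_ge0.
have T5 : c * (1 - q) * b * mehler q B x <= c * (1 - q) * b.
  by rewrite ler_piMr// !mulr_ge0// subr_ge0 ltW.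
rewrite -/A -/B -/S; rewrite /Ctot in PF T4 *.
by lra.
Qed.

End supersolution.

(** Each Mehler step and each multiplication by the indicator is self-adjoint for the Gaussian
    measure; the adjoint of their product applies them in the opposite order. *)
Lemma killed_sym D qs f g : measurable D -> ratios qs ->
  bounded_mfun f -> (forall x, 0 <= f x) -> bounded_mfun g -> (forall x, 0 <= g x) ->
  \int[gamma]_x (g x * killed D qs f x) = \int[gamma]_x (f x * killed D (rev qs) g x).
Proof.
move=> mD; elim: qs f g => [|q qs IH] f g /=.
  move=> _ bf f0 bg g0; apply: eq_Rintegral => x _; ring.
move=> /andP[q01 rqs] bf f0 bg g0.
have bD := bounded_mfun_indic mD.
have D0 x : 0 <= \1_D x :> R by rewrite indicE.
have bk := killed_bounded qs mD bf.
have bDg : bounded_mfun (fun x => \1_D x * g x) by exact: bounded_mfunM.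
have Dg0 x : 0 <= \1_D x * g x by rewrite mulr_ge0.
have bh := bounded_mfun_mehler q bDg.
have h0 x : 0 <= mehler q (fun x => \1_D x * g x) x.
  rewrite -(mehler_cst q 0 x); apply: le_mehler => //; first exact: quartic_cst.
  exact: bounded_mfun_quartic.
transitivity (\int[gamma]_x ((fun x => \1_D x * g x) x * mehler q (killed D qs f) x)).
  by apply: eq_Rintegral => x _; rewrite mulrA [g x * _]mulrC.
rewrite mehler_sym//; last by move=> y; apply: killed_ge0.
transitivity (\int[gamma]_x (mehler q (fun x => \1_D x * g x) x * killed D qs f x)).
  by apply: eq_Rintegral => x _; rewrite mulrC.
rewrite IH//; apply: eq_Rintegral => x _; congr (_ * _).
rewrite rev_cons -cats1 killed_cat; congr (_ x); apply: eq_killed => y Dy.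
by rewrite killed_in.
Qed.

End killed.

(** * Brownian motion observed and killed along a grid *)

Section finite_pushforward.
Context {d d'} {T1 : measurableType d} {T2 : measurableType d'} {R : realType}.
Variables (m : {finite_measure set T1 -> \bar R}) (f : T1 -> T2).
Hypothesis mf : measurable_fun setT f.

(** A named copy of the pushforward that carries finiteness, so that it can be a factor in the
    uniqueness of product measures. *)
Definition finite_pushforward : set T2 -> \bar R := push_measure m mf.

HB.instance Definition _ := Measure.copy finite_pushforward (push_measure m mf).

Let finite_pushforward_fin : fin_num_fun finite_pushforward.
Proof.
move=> A mA; apply: fin_num_measure.
by rewrite -(setTI (_ @^-1` _)); exact: mf.
Qed.

HB.instance Definition _ := @Measure_isFinite.Build _ _ _ finite_pushforward
  finite_pushforward_fin.

End finite_pushforward.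

Lemma ge0_integral_mrestr {d} {T : measurableType d} {R : realType}
    (mu : {measure set T -> \bar R}) (E : set T) (mE : measurable E) (f : T -> \bar R) :
  measurable_fun setT f -> (forall x, 0 <= f x)%E ->
  (\int[mrestr mu mE]_x f x = \int[mu]_(x in E) f x)%E.
Proof.
move=> mf f0; rewrite (@ge0_integral_density _ _ _ mu _ (\1_E))//.
- rewrite [RHS]integral_mkcond; apply: eq_integral => x _.
  by rewrite patchE indicE; case: (x \in E); rewrite ?mule1 ?mule0.
by move=> A mA; rewrite integral_indic// /= /mrestr setIC.
Qed.

Section fdd.
Context {R : realType} {d : measure_display} {T : measurableType d}.
Context (P : probability T R) (W : R -> T -> R).
Hypothesis BM : is_std_BM P W.
Variables (g : nat -> R) (x : R) (D : set R).
Hypotheses (g0 : 0 <= g 0%N) (g_lt : forall i, g i < g i.+1) (mD : measurable D).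

Let X i w := Xproc W (g 0%N) x (g i) w.
Let Delta i w := W (g i.+1 - g 0%N) w - W (g i - g 0%N) w.
Let law i := normal_prob 0 (Num.sqrt (g i.+1 - g i)).

Definition grid_ratio (g : nat -> R) i : R := (g i + 1) / (g i.+1 + 1).
Let q := grid_ratio g.

Lemma grid_le i : g 0%N <= g i.
Proof. by elim: i => // i IH; rewrite (le_trans IH)// ltW. Qed.

Lemma grid_gt0 i : 0 < g i + 1.
Proof. by rewrite ltr_wpDl// (le_trans g0)// grid_le. Qed.

Lemma grid_ratio01 i : 0 < q i < 1.
Proof.
rewrite /q /grid_ratio divr_gt0 ?grid_gt0//= ltr_pdivrMr ?grid_gt0// mul1r.
by rewrite ltrD2r.
Qed.

Lemma measurable_Xproc (s y r : R) : s <= r -> measurable_fun setT (Xproc W s y r).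
Proof.
move=> sr; have [_ _ mW _] := BM; rewrite /Xproc.
apply: measurable_funM => //; apply: measurable_funD => //.
by apply: mW; rewrite subr_ge0.
Qed.

Let mX i : measurable_fun setT (X i).
Proof. by apply: measurable_Xproc; exact: grid_le. Qed.

Let mDelta i : measurable_fun setT (Delta i).
Proof.
have [_ _ mW _] := BM.
by apply: measurable_funB; apply: mW; rewrite subr_ge0 grid_le.
Qed.

(** The autoregressive step behind [mehler]: the quotient of square roots rescales the increment to
    variance [1 - q i]. *)
Let XS i w : X i.+1 w = Num.sqrt (q i) * X i w +
  Num.sqrt (1 - q i) / Num.sqrt (g i.+1 - g i) * Delta i w.
Proof.
have h0 := grid_gt0 i; have h1 := grid_gt0 i.+1.
have hd : 0 < g i.+1 - g i by rewrite subr_gt0.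
have -> : 1 - q i = (g i.+1 - g i) / (g i.+1 + 1).
  by rewrite /q /grid_ratio; field; rewrite gt_eqF.
rewrite /q /grid_ratio !sqrtrM ?ltW// !sqrtrV ?ltW//.
rewrite /X /Delta /Xproc.
have s0 : Num.sqrt (g i + 1) != 0 by rewrite gt_eqF// sqrtr_gt0.
have s1 : Num.sqrt (g i.+1 + 1) != 0 by rewrite gt_eqF// sqrtr_gt0.
have sd : Num.sqrt (g i.+1 - g i) != 0 by rewrite gt_eqF// sqrtr_gt0.
by field; rewrite s0 s1 sd.
Qed.

Definition in_grid (D : set R) n : set T := \bigcap_(i in `I_n.+1) (X i @^-1` D).

Let Fut (A : nat -> set R) n k : set T :=
  \bigcap_(i in [set i | (n <= i < k)%N]) (Delta i @^-1` A i).

Lemma measurable_in_grid n : measurable (in_grid D n).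
Proof.
apply: bigcap_measurableType => i _.
by rewrite -(setTI (_ @^-1` _)); exact: mX.
Qed.

Let mFut A n k : (forall i, measurable (A i)) -> measurable (Fut A n k).
Proof.
move=> mA; apply: bigcap_measurableType => i _.
by rewrite -(setTI (_ @^-1` _)); apply: mDelta.
Qed.

Let FutS A n k : (n < k)%N -> Fut A n k = (Delta n @^-1` A n) `&` Fut A n.+1 k.
Proof.
move=> nk; apply/seteqP; split => w.
  move=> h; split; first by apply: h; rewrite /= leqnn.
  by move=> i /= /andP[ni ik]; apply: h; rewrite /= ik ltnW.
move=> [h1 h2] i /= /andP[]; rewrite leq_eqVlt => /orP[/eqP <-//|ni ik].
by apply: h2; rewrite /= ni.
Qed.

Lemma in_gridS n : in_grid D n.+1 = in_grid D n `&` (X n.+1 @^-1` D).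
Proof.
apply/seteqP; split => w.
  move=> h; split; last by apply: h => /=.
  by move=> i /= iN; apply: h; rewrite /= ltnW.
move=> [h1 h2] i /=; rewrite ltnS leq_eqVlt => /orP[/eqP ->//|iN].
by apply: h1.
Qed.

(** Independence is only available as a product formula for increments. Carrying arbitrary
    constraints on the future increments through the induction keeps them independent of the present
    state, so each step can release one of them. *)
Let fdd_future (A : nat -> set R) n k (f : R -> R) : (n <= k)%N ->
  (forall i, measurable (A i)) -> bounded_mfun f -> (forall y, 0 <= f y) ->
  (\int[P]_(w in in_grid D n `&` Fut A n k) (f (X n w))%:E =
   (killed D (mkseq q n) f x)%:E * \prod_(n <= i < k) law i (A i))%E.
Proof.
elim: n A k f => [|n IH] A k f nk mA bf f0.
  have [W0 _ _ inc] := BM.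
  have X0 w : X 0%N w = x.
    rewrite /X /Xproc subrr W0 addr0 mulfK// gt_eqF// sqrtr_gt0.
    exact: (grid_gt0 0).
  under eq_integral do rewrite X0.
  have mE := measurableI _ _ (measurable_in_grid 0) (mFut 0 k mA).
  rewrite integral_cst//= indicE.
  have [Dx|Dx] := pselect (D x); last first.
    rewrite memNset// mul0r mul0e (_ : _ `&` _ = set0) ?measure0 ?mule0//.
    by apply/seteqP; split => // w [/(_ 0%N isT)]; rewrite /= X0.
  rewrite mem_set// mul1r; congr (_ * _)%E.
  have -> : in_grid D 0 `&` Fut A 0 k =
     \bigcap_(i in `I_k) [set w | A i (W (g i.+1 - g 0%N) w - W (g i - g 0%N) w)].
    apply/seteqP; split => w; first by move=> [_ h] i /= ik; apply: h.
    move=> h; split; last by move=> i /= ik; apply: h.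
    by move=> i /=; rewrite ltnS leqn0 => /eqP ->; rewrite X0.
  rewrite (inc k (fun i => g i - g 0%N) A)//; last first.
  - by move=> i; rewrite ltrD2r.
  - by rewrite subrr.
  rewrite big_mkord; apply: eq_bigr => i _; rewrite /law.
  by have -> : g i.+1 - g 0%N - (g i - g 0%N) = g i.+1 - g i by ring.
pose F := in_grid D n `&` Fut A n.+1 k.
have mF : measurable F := measurableI _ _ (measurable_in_grid n) (mFut n.+1 k mA).
(* Replacing the constraint on the next increment by a free set [B] turns the induction hypothesis
   into the joint law of the state and that increment. *)
pose sub B i := if i == n then B else A i.
have msub B : measurable B -> forall i, measurable (sub B i).
  by move=> mB i; rewrite /sub; case: ifP.
have subn B : sub B n = B by rewrite /sub eqxx.
have FutE B : Fut (sub B) n.+1 k = Fut A n.+1 k.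
  apply/seteqP; split => w h i /= /andP[ni ik]; have := h i; rewrite /= ni ik => /(_ isT);
    by rewrite /sub gtn_eqF.
have key B f' : measurable B -> bounded_mfun f' -> (forall y, 0 <= f' y) ->
  (\int[P]_(w in F `&` (Delta n @^-1` B)) (f' (X n w))%:E =
  (killed D (mkseq q n) f' x)%:E * (law n B * \prod_(n.+1 <= i < k) law i (A i)))%E.
  move=> mB bf' f'0.
  have := IH (sub B) k f' (ltnW nk) (msub B mB) bf' f'0.
  rewrite FutS// subn FutE big_ltn// subn.
  have -> : (\prod_(n.+1 <= i < k) law i (sub B i) = \prod_(n.+1 <= i < k) law i (A i))%E.
    rewrite big_nat [RHS]big_nat; apply: eq_bigr => i /andP[ni _].
    by rewrite /sub gtn_eqF.
  move=> <-; congr (integral _ _ _).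
  by rewrite /F -setIA [Fut A _ _ `&` _]setIC.
have lawT : law n setT = 1%E by exact: probability_setT.
have key1 f' : bounded_mfun f' -> (forall y, 0 <= f' y) ->
  (\int[P]_(w in F) (f' (X n w))%:E =
  (killed D (mkseq q n) f' x)%:E * \prod_(n.+1 <= i < k) law i (A i))%E.
  by move=> bf' f'0; have := key setT f' measurableT bf' f'0;
    rewrite preimage_setT setIT lawT mul1e.
pose m1 := @finite_pushforward _ _ T (measurableTypeR R) R (mrestr P mF) (X n) (mX n).
pose XD w := (X n w, Delta n w).
have mXD : @measurable_fun _ _ T (measurableTypeR R * measurableTypeR R)%type setT XD.
  exact: (measurable_fun_pair (mX n) (mDelta n)).
pose xi := @push_measure _ _ T (measurableTypeR R * measurableTypeR R)%type R
  (mrestr P mF) XD mXD.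
(* On the event [F], the pair of state and next increment has a product law: it suffices to check
   rectangles, where [key] applies to an indicator. *)
have rect B C : measurable B -> measurable C -> (xi (B `*` C) = m1 B * law n C)%E.
  move=> mB mC.
  have bB := bounded_mfun_indic mB.
  have B0 y : 0 <= \1_B y :> R by rewrite indicE.
  have mXB : measurable (X n @^-1` B) by rewrite -(setTI (_ @^-1` _)); exact: mX.
  have mDC : measurable (Delta n @^-1` C) by rewrite -(setTI (_ @^-1` _)); exact: mDelta.
  have m1E : (m1 B = (killed D (mkseq q n) (\1_B) x)%:E *
      \prod_(n.+1 <= i < k) law i (A i))%E.
    rewrite -key1// /m1 /finite_pushforward /= /pushforward /mrestr.
    transitivity (\int[P]_(w in F) (\1_(X n @^-1` B) w)%:E)%E => //.
    by rewrite integral_indic.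
  rewrite m1E muleAC -muleA -key//.
  transitivity (\int[P]_(w in F `&` Delta n @^-1` C) (\1_(X n @^-1` B) w)%:E)%E => //.
  rewrite integral_indic//; last exact: measurableI.
  rewrite /xi /push_measure/= /pushforward /mrestr; congr (P _).
  rewrite setICA -setIA setIC -setIA.
  by apply/seteqP; split => w /=; rewrite /XD/=; tauto.
pose c := Num.sqrt (1 - q n) / Num.sqrt (g n.+1 - g n).
pose f1 y := \1_D y * f y.
have bf1 : bounded_mfun f1 by apply: bounded_mfunM => //; exact: bounded_mfun_indic.
have f10 y : 0 <= f1 y by rewrite mulr_ge0// indicE.
pose h (yz : R * R) := (f1 (Num.sqrt (q n) * yz.1 + c * yz.2))%:E.
have mh : measurable_fun setT h.
  apply/measurable_EFinP; apply: (measurableT_comp (proj1 bf1)).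
  by apply: measurable_funD; apply: measurable_funM.
have h0 yz : (0 <= h yz)%E by rewrite lee_fin.
transitivity (\int[P]_(w in F) h (XD w))%E.
  rewrite in_gridS setIAC -/F integral_mkcondr; apply: eq_integral => w _.
  rewrite patchE /h /XD/= /c -XS /f1 indicE.
  have -> : (w \in X n.+1 @^-1` D) = (X n.+1 w \in D).
    by apply/idP/idP; rewrite !inE.
  by case: ifP => _; rewrite ?mul1r ?mul0r.
have mh' : @measurable_fun _ _ (measurableTypeR R * measurableTypeR R)%type _ setT h.
  exact: mh.
have mhXD : measurable_fun setT (fun w => h (XD w)) by exact: (measurableT_comp mh' mXD).
have E1 : (\int[P]_(w in F) h (XD w) = \int[xi]_yz h yz)%E.
  apply: (eq_trans (esym (ge0_integral_mrestr P mF mhXD (fun w => h0 (XD w))))).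
  exact: (esym (@ge0_integral_pushforward _ _ T
    (measurableTypeR R * measurableTypeR R)%type R XD mXD (mrestr P mF) setT h
    measurableT mh' (fun y _ => h0 y))).
rewrite E1.
rewrite (@eq_measure_integral _ _ _ setT (product_measure1 m1 (law n)) xi); last first.
  by move=> B mB _; exact: (esym (product_measure_unique rect mB)).
rewrite (@fubini_tonelli1 _ _ _ _ R m1 (law n) h mh' h0) /fubini_F.
have kE : killed D (mkseq q n.+1) f = killed D (mkseq q n) (mehler (q n) f1).
  rewrite mkseqS -cats1 killed_cat; apply: eq_killed => y Dy.
  by rewrite killed_in.
have s0 : 0 < Num.sqrt (g n.+1 - g n) by rewrite sqrtr_gt0 subr_gt0.
have inner y : (\int[law n]_z h (y, z) = (mehler (q n) f1 y)%:E)%E.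
  rewrite /law (@ge0_integral_normal_affine _ 0 _ (fun z => h (y, z)) s0)//; last first.
    exact: (measurableT_comp mh (measurable_pair1 y)).
  rewrite -EFin_Rintegral_gamma; last exact: quartic_affine (bounded_mfun_quartic bf1).
  apply: eq_integral => z _; rewrite /h/= add0r /c mulrA mulfVK//.
  by rewrite gt_eqF.
have bm := bounded_mfun_mehler (q n) bf1.
have m0 y : 0 <= mehler (q n) f1 y.
  rewrite -(mehler_cst (q n) 0 y); apply: le_mehler => //; first exact: quartic_cst.
  exact: bounded_mfun_quartic.
under eq_integral do rewrite inner.
rewrite kE -key1//.
have mm : measurable_fun [set: R] (fun y => (mehler (q n) f1 y)%:E).
  by apply/measurable_EFinP; case: bm.
apply: (eq_trans (@ge0_integral_pushforward _ _ T (measurableTypeR R) R (X n) (mX n)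
  (mrestr P mF) setT (fun y => (mehler (q n) f1 y)%:E) measurableT mm (fun y _ => m0 y))).
have mmX : measurable_fun [set: T] (fun w => (mehler (q n) f1 (X n w))%:E).
  by apply/measurable_EFinP; exact: (measurableT_comp (proj1 bm) (mX n)).
exact: (ge0_integral_mrestr P mF mmX (fun w => m0 (X n w))).
Qed.

Lemma fdd n (f : R -> R) : bounded_mfun f -> (forall y, 0 <= f y) ->
  (\int[P]_(w in in_grid D n) (f (Xproc W (g 0%N) x (g n) w))%:E =
   (killed D (mkseq q n) f x)%:E)%E.
Proof.
move=> bf f0.
have := @fdd_future (fun=> setT) n n f (leqnn _) (fun=> measurableT) bf f0.
rewrite big_geq// mule1 => <-; congr (integral _ _ _).
rewrite (_ : Fut _ _ _ = setT) ?setIT//.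
by apply/seteqP; split => // w _ i _.
Qed.

End fdd.

(** * Overshoot estimates and sums over a grid *)

Section bounds.
Context {R : realType}.
Implicit Types (q x y : R) (qs : seq R) (f : R -> R).

(** With [d] the jump size, [|y| <= 1 + d] bounds the left side by
    [6 * d + 7 * d ^+ 2 + 4 * d ^+ 3 + d ^+ 4]. Each lower power is at most [h + d ^+ 4 / h ^+ 3],
    by comparing [d] with [h]; as 6 + 7 + 4 = 17, the choice [h <= eps / 17] suffices. One estimate
    covers both supersolutions, since off the interval [- phi y] is at most the left side. *)
Lemma overshoot (eps : R) : 0 < eps -> exists2 C : R, 0 <= C &
  forall x y, Iunit x -> ~ Iunit y -> y ^+ 2 + y ^+ 4 - 2 <= eps + C * (y - x) ^+ 4.
Proof.
move=> e0; pose h : R := Num.min 1 (eps / 17).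
have h0 : 0 < h by rewrite lt_min ltr01 divr_gt0.
have h1 : h <= 1 by rewrite ge_min lexx.
have h17 : 17 * h <= eps.
  by rewrite mulrC -ler_pdivlMr// ge_min lexx orbT.
exists (17 / h ^+ 3 + 1); first by rewrite addr_ge0// divr_ge0// exprn_ge0// ltW.
move=> x y Ix Iy; pose d : R := `|y - x|.
have d0 : 0 <= d by exact: normr_ge0.
have x1 := Iunit_norm Ix.
have yd : `|y| <= 1 + d.
  have -> : y = x + (y - x) by ring.
  by rewrite (le_trans (ler_normD _ _))// lerD2r.
have pw k : (0 < k <= 4)%N -> d ^+ k <= h + d ^+ 4 / h ^+ 3.
  move=> /andP[k0 k4]; have [dh|hd] := leP d h.
    apply: (@le_trans _ _ h); last first.
      by rewrite lerDl divr_ge0 ?exprn_ge0// ltW.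
    apply: (le_trans _ dh); have d1 := le_trans dh h1.
    by rewrite -[leRHS]expr1 ler_wiXn2l.
  have dgt0 : 0 < d by exact: lt_trans hd.
  apply: (@le_trans _ _ (d ^+ 4 / h ^+ 3)); last by rewrite lerDr ltW.
  rewrite ler_pdivlMr ?exprn_gt0//.
  have -> : d ^+ 4 = d ^+ k * d ^+ (4 - k) by rewrite -exprD subnKC.
  apply: ler_wpM2l; first exact: exprn_ge0.
  apply: (@le_trans _ _ (h ^+ (4 - k))).
    apply: ler_wiXn2l; [exact: ltW|exact: h1|].
    by case: (k) k0 => // k' _; rewrite subSS leq_subr.
  by apply: lerXn2r; rewrite ?nnegrE// ltW.
have y2 : y ^+ 2 <= (1 + d) ^+ 2.
  by rewrite -(real_normK (num_real y)) ler_sqr ?nnegrE// addr_ge0.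
have y4 : y ^+ 4 <= (1 + d) ^+ 4.
  rewrite (exprM y 2 2) (exprM _ 2 2) ler_sqr ?nnegrE ?sqr_ge0//.
have -> : (y - x) ^+ 4 = d ^+ 4.
  by rewrite /d (exprM _ 2 2) -(real_normK (num_real (y - x))) -exprM.
have p1 := pw 1%N isT; have p2 := pw 2%N isT; have p3 := pw 3%N isT.
rewrite expr1 in p1.
have e2 : (1 + d) ^+ 2 = 1 + 2 * d + d ^+ 2 by ring.
have e4 : (1 + d) ^+ 4 = 1 + 4 * d + 6 * d ^+ 2 + 4 * d ^+ 3 + d ^+ 4 by ring.
rewrite e2 in y2; rewrite e4 in y4.
have -> : (17 / h ^+ 3 + 1) * d ^+ 4 = 17 * (d ^+ 4 / h ^+ 3) + d ^+ 4 by ring.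
move: (d ^+ 4 / h ^+ 3) p1 p2 p3 => z p1 p2 p3.
by lra.
Qed.

(** Here [phi] itself is the supersolution: the Mehler inequality is an equality with rate 1, and
    the discount is the product of the ratios. *)
Lemma killed_phi0_upper (eps : R) : 0 < eps -> exists2 C : R, 0 <= C &
  forall qs x, ratios qs -> Iunit x -> killed Iunit qs phi0 x <=
  (\prod_(q <- qs) q) * phi x + eps + C * \sum_(q <- qs) (1 - q) ^+ 2.
Proof.
move=> e0; have [C C0 HC] := overshoot e0.
exists (0 + C * (8 * (1 + m4))).
  by rewrite add0r mulr_ge0// mulr_ge0// addr_ge0// m4_ge0.
move=> qs x rqs Ix.
have Hv q y : 0 < q < 1 -> Iunit y ->
    mehler q phi y <= (1 - 1 * (1 - q)) * phi y - 0 * (1 - q) + 0 * (1 - q) ^+ 2.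
  move=> /andP[q0 q1] _; rewrite mehler_phi ?(ltW q0) ?(ltW q1)//.
  by rewrite -/(phi y) le_eqVlt; apply/orP; left; apply/eqP; ring.
have Hout x' y : Iunit x' -> ~ Iunit y -> - phi y <= eps + C * (y - x') ^+ 4.
  move=> Ix' Iy; apply: le_trans (HC x' y Ix' Iy).
  have p0 : phi y <= 0 by rewrite leNgt; apply/negP => /IunitP.
  have : 0 <= y ^+ 4 - 1.
    have -> : y ^+ 4 - 1 = (- phi y) * (y ^+ 2 + 1) by rewrite /phi; ring.
    by rewrite mulr_ge0 ?oppr_ge0// addr_ge0// sqr_ge0.
  by rewrite /phi; lra.
have := @killed_upper R phi 1 0 0 eps C quartic_phi 
  (introT andP (conj ler01 (lexx _))) (lexx _) (lexx _) (ltW e0) C0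
  Hv Hout phi0 qs bounded_mfun_phi0.
have h1 (z : R) : Iunit z -> phi0 z <= phi z by move=> Iz; rewrite phi0_in.
move=> /(_ h1 rqs x Ix).
have -> : sup_kappa 1 0 qs = 0.
  by elim: (qs) => //= q qs' ->; rewrite !mul0r addr0.
have -> : sup_beta 1 qs = \prod_(q <- qs) q.
  elim: (qs) => [|q qs' /= ->]; first by rewrite big_nil.
  by rewrite big_cons; congr (_ * _); ring.
rewrite mul0r addr0 => /le_trans; apply; rewrite lerD2r lerD2l.
apply: ler_piMr; [exact: ltW|rewrite gerBl].
by apply: killed_ge0 => //; [exact: measurable_Iunit|exact: bounded_mfun_cst].
Qed.

(** The supersolution [2 - y ^+ 2 - y ^+ 4] factors as [(1 - y ^+ 2) * (2 + y ^+ 2)], so it lies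
    between 0 and [3 * phi] inside. The Ornstein-Uhlenbeck generator sends it to
    [-1 - 5 * y ^+ 2 + 2 * y ^+ 4], at most -1 there: it bounds the expected exit time, and
    surviving long costs a factor [phi]. *)
Lemma killed1_upper (eps : R) : 0 < eps -> exists2 C : R, 0 <= C &
  forall qs x, ratios qs -> Iunit x ->
  (\sum_(q <- qs) (1 - q)) * killed Iunit qs (fun=> 1) x <=
  3 * phi x + eps + C * \sum_(q <- qs) (1 - q) ^+ 2.
Proof.
move=> e0; have [C C0 HC] := overshoot e0.
have M0 := @m4_ge0 R.
exists (6 + C * (8 * (1 + m4))).
  by rewrite addr_ge0// mulr_ge0// mulr_ge0// addr_ge0.
move=> qs x rqs Ix.
pose v y : R := 2 + (-1 * y ^+ 2 + -1 * y ^+ 4).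
have q_2 := @quarticX R 2 isT; have q_4 := @quarticX R 4 isT.
have qv' : quartic (fun y : R => -1 * y ^+ 2 + -1 * y ^+ 4).
  by apply: quarticD; exact: quarticZ.
have qv : quartic v by apply: quarticD => //; exact: quartic_cst.
have Hv q y : 0 < q < 1 -> Iunit y ->
    mehler q v y <= (1 - 0 * (1 - q)) * v y - 1 * (1 - q) + 6 * (1 - q) ^+ 2.
  move=> /andP[q0 q1] Iy; have q01 : 0 <= q <= 1 by rewrite !ltW.
  rewrite /v mehlerD//; last exact: quartic_cst.
  rewrite mehler_cst mehlerD; [|exact: quarticZ|exact: quarticZ].
  rewrite !mehlerZ// mehler_sqr// mehler_quart// mul0r subr0 !mul1r.
  have /IunitP y1 := Iy; have y0 := sqr_ge0 y.
  have -> : y ^+ 4 = (y ^+ 2) ^+ 2 by rewrite -exprM.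
  move: (y ^+ 2) y0 y1 => z z0 z1.
  have hm : 0 <= (1 - q) ^+ 2 * m4 by rewrite mulr_ge0// sqr_ge0.
  have k1 : 0 <= (1 - q) * (3 * z + 2 * z * (1 - z) + (1 - q) * z ^+ 2
    + 6 * (1 - q) * (1 - z)).
    apply: mulr_ge0; first by rewrite subr_ge0 ltW.
    have a1 : 0 <= 1 - q by rewrite subr_ge0 ltW.
    have a2 := ltW z1.
    by rewrite !addr_ge0// !mulr_ge0// ?sqr_ge0.
  nra.
have Hout x' y : Iunit x' -> ~ Iunit y -> - v y <= eps + C * (y - x') ^+ 4.
  by move=> Ix' Iy; apply: le_trans (HC x' y Ix' Iy); rewrite /v; lra.
have := @killed_upper R v 0 1 6 eps C qv 
  (introT andP (conj (lexx _) ler01)) ler01 (ler0n _ 6) (ltW e0) C0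
  Hv Hout (fun=> 0) qs (bounded_mfun_cst 0).
have v0 z : Iunit z -> 0 <= v z.
  move=> /IunitP z1; have -> : v z = (1 - z ^+ 2) * (2 + z ^+ 2) by rewrite /v; ring.
  by apply: mulr_ge0; [exact: ltW|rewrite addr_ge0// sqr_ge0].
move=> /(_ v0 rqs x Ix).
have b1 : sup_beta (0 : R) qs = 1.
  by elim: (qs) => //= q qs' ->; rewrite mul0r subr0 mul1r.
have -> : sup_kappa 0 1 qs = \sum_(q <- qs) (1 - q).
  elim: (qs) => [|q qs' /= ->]; first by rewrite big_nil.
  rewrite big_cons mul1r addrC (_ : sup_beta 0 qs' = 1) ?mulr1//.
  by elim: (qs') => //= p ps ->; rewrite mul0r subr0 mul1r.
rewrite b1 killed_0 add0r mul1r => /le_trans; apply; rewrite lerD2r.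
apply: lerD.
  have /IunitP z1 := Ix.
  have -> : v x = (1 - x ^+ 2) * (2 + x ^+ 2) by rewrite /v; ring.
  rewrite /phi mulrC; apply: ler_wpM2r; first exact: ltW.
  by move: z1; lra.
apply: ler_piMr; [exact: ltW|rewrite gerBl].
by apply: killed_ge0 => //; [exact: measurable_Iunit|exact: bounded_mfun_cst].
Qed.

Lemma grid_prod (g : nat -> R) n : 0 <= g 0%N -> (forall i, g i < g i.+1) ->
  \prod_(q <- mkseq (grid_ratio g) n) q = (g 0%N + 1) / (g n + 1).
Proof.
move=> g0 g_lt; elim: n => [|n IH].
  by rewrite big_nil divff// gt_eqF// (grid_gt0 g0 g_lt).
rewrite mkseqS -cats1 big_cat/= IH big_seq1 /grid_ratio mulrA divfK//.
by rewrite gt_eqF// (grid_gt0 g0 g_lt).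
Qed.

Lemma grid_ratios (g : nat -> R) n : 0 <= g 0%N -> (forall i, g i < g i.+1) ->
  ratios (mkseq (grid_ratio g) n).
Proof.
move=> g0 g_lt; apply/allP => q /mapP[i _ ->]; exact: grid_ratio01.
Qed.

Lemma grid_sum (g : nat -> R) n : 0 <= g 0%N -> (forall i, g i < g i.+1) ->
  1 - (g 0%N + 1) / (g n + 1) <= \sum_(q <- mkseq (grid_ratio g) n) (1 - q).
Proof.
move=> g0 g_lt; rewrite -grid_prod//.
have := grid_ratios n g0 g_lt.
elim: (mkseq _ _) => [_|q qs IH /=]; first by rewrite !big_nil subrr.
move=> /andP[/andP[q0 q1] rqs]; rewrite !big_cons.
have := IH rqs; have /andP[] := ratios_prod rqs.
by move: (\prod_(j <- qs) j) => p p0 p1; nra.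
Qed.

Lemma grid_sum_sqr (g : nat -> R) n (h : R) : 0 <= g 0%N -> (forall i, g i < g i.+1) ->
  (forall i, (i < n)%N -> g i.+1 - g i <= h) ->
  \sum_(q <- mkseq (grid_ratio g) n) (1 - q) ^+ 2 <= n%:R * h ^+ 2.
Proof.
move=> g0 g_lt; elim: n => [|n IH] gh; first by rewrite big_nil mul0r.
rewrite mkseqS -cats1 big_cat/= big_seq1 -natr1 mulrDl mul1r lerD//.
  by apply: IH => i iN; apply: gh; rewrite ltnW.
have /andP[r0 r1] := grid_ratio01 g0 g_lt n.
have hn := gh n (ltnSn n).
have gn : 1 <= g n.+1 + 1 by rewrite lerDr (le_trans g0)// (grid_le g_lt).
have r2 : 1 - grid_ratio g n <= h.
  apply: le_trans hn; have -> : 1 - grid_ratio g n = (g n.+1 - g n) / (g n.+1 + 1).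
    by rewrite /grid_ratio; field; rewrite gt_eqF// (lt_le_trans _ gn).
  rewrite ler_pdivrMr ?(lt_le_trans _ gn)// ler_peMr// subr_ge0 ltW//.
have r3 : 0 <= 1 - grid_ratio g n by rewrite subr_ge0 ltW.
by rewrite ler_sqr ?nnegrE// (le_trans r3).
Qed.

End bounds.

(** * The Mehler semigroup law *)

Section mehler_law.
Context {R : realType} {d : measure_display} {T : measurableType d}.
Context (P : probability T R) (W : R -> T -> R).
Hypothesis BM : is_std_BM P W.

Lemma killedT0 (f : R -> R) : killed setT [::] f = f.
Proof. by apply/funext => x; rewrite killed0_in. Qed.

Lemma killedTS q qs (f : R -> R) : killed setT (q :: qs) f = mehler q (killed setT qs f).
Proof. by apply/funext => x; rewrite killed_in. Qed.

(* Chapman-Kolmogorov, read off the Brownian motion itself by comparing a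
   two-step grid with a one-step grid. *)
Lemma mehler_lawP : @mehler_law R.
Proof.
move=> q1 q2 f x /andP[q10 q11] /andP[q20 q21] bf f0.
(* Started at time 0, the ratio to time [t] is the inverse of [t + 1]; these are the times at ratio
   [q1] and [q1 * q2]. *)
pose t1 := q1^-1 - 1; pose t2 := (q1 * q2)^-1 - 1.
have t10 : 0 < t1 by rewrite subr_gt0 invf_gt1.
have t12 : t1 < t2.
  rewrite ltrD2r invfM -[ltLHS]mulr1 ltr_pM2l ?invr_gt0//.
  by rewrite invf_gt1.
pose g1 (i : nat) : R := match i with 0 => 0 | 1 => t1 | k.+2 => t2 + k%:R end.
pose g2 (i : nat) : R := match i with 0 => 0 | k.+1 => t2 + k%:R end.
have g1lt i : g1 i < g1 i.+1.
  by case: i => [|[|k]] //=; rewrite ?addr0// ltrD2l ltr_nat.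
have g2lt i : g2 i < g2 i.+1.
  by case: i => [|k] /=; rewrite ?addr0 ?(lt_trans t10)// ltrD2l ltr_nat.
have gE g n : in_grid W g x setT n = setT by apply/seteqP; split.
have h1 := fdd BM x (lexx (g1 0%N)) g1lt measurableT 2 bf f0.
have h2 := fdd BM x (lexx (g2 0%N)) g2lt measurableT 1 bf f0.
rewrite gE in h1; rewrite gE in h2.
have r10 : grid_ratio g1 0 = q1.
  by rewrite /grid_ratio/= /t1 add0r subrK div1r invrK.
have r11 : grid_ratio g1 1 = q2.
  by rewrite /grid_ratio/= /t1 /t2 addr0 !subrK; field; rewrite !gt_eqF.
have r20 : grid_ratio g2 0 = q1 * q2.
  by rewrite /grid_ratio/= /t2 add0r addr0 subrK div1r invrK.
have e1 : mkseq (grid_ratio g1) 2 = [:: q1; q2] by rewrite -[in RHS]r10 -[in RHS]r11.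
have e2 : mkseq (grid_ratio g2) 1 = [:: q1 * q2] by rewrite -[in RHS]r20.
rewrite e1 in h1; rewrite e2 in h2.
have h := EFin_inj (etrans (esym h1) h2).
by rewrite !killedTS killedT0 in h.
Qed.

End mehler_law.

(** * Continuity of paths and measurability of survival *)

Section path.
Context {R : realType} {d : measure_display} {T : measurableType d}.
Context (P : probability T R) (W : R -> T -> R).
Hypothesis BM : is_std_BM P W.

Definition dyadic (s t : R) (n k : nat) : R := s + (t - s) * (k%:R / 2 ^+ n).

Lemma dyadic_itv (s t : R) n k : s <= t -> (k <= 2 ^ n)%N -> s <= dyadic s t n k <= t.
Proof.
move=> st k2; have ts : 0 <= t - s by rewrite subr_ge0.
have n0 : 0 < 2 ^+ n :> R by rewrite exprn_gt0.
rewrite /dyadic lerDl mulr_ge0 ?divr_ge0 ?(ltW n0)//=.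
rewrite -lerBrDl ler_piMr// ler_pdivrMr// mul1r.
by rewrite -natrX ler_nat.
Qed.

Lemma dyadic_dense (s t a : R) (Z : R -> R) : s <= t -> continuous Z ->
  (forall n k, (k <= 2 ^ n)%N -> Z (dyadic s t n k) <= a) ->
  forall r, s <= r <= t -> Z r <= a.
Proof.
move=> st cZ H r /andP[sr rt]; rewrite leNgt; apply/negP => aZ.
have /cvgrPdist_lt /(_ (Z r - a)) := cZ r.
rewrite subr_gt0 => /(_ aZ) [e /= e0 He].
have ts : 0 <= t - s by rewrite subr_ge0.
have [n Hn] : exists n, (t - s) / 2 ^+ n < e.
  exists (Num.trunc ((t - s) / e)).+1.
  rewrite ltr_pdivrMr ?exprn_gt0// mulrC -ltr_pdivrMr//.
  have := ltnSn (Num.trunc ((t - s) / e)).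
  move=> _; apply: (@lt_le_trans _ _ (Num.trunc ((t - s) / e)).+1%:R).
    exact: truncnS_gt.
  by rewrite -natrX ler_nat ltnW// ltn_expl.
have n0 : 0 < 2 ^+ n :> R by rewrite exprn_gt0.
have [ts0|ts0] := eqVneq (t - s) 0.
  have := H 0%N 0%N isT; rewrite /dyadic mul0r mulr0 addr0.
  have -> : s = r by apply/eqP; rewrite eq_le sr/=; lra.
  by rewrite leNgt aZ.
have tsp : 0 < t - s by rewrite lt_neqAle eq_sym ts0.
pose u := (r - s) / (t - s) * 2 ^+ n.
have u0 : 0 <= u.
  by apply: mulr_ge0; [apply: divr_ge0; rewrite subr_ge0|exact: ltW].
pose k := Num.trunc u.
have /andP[ku uk] : k%:R <= u < k.+1%:R by exact: truncn_itv.
have k2 : (k <= 2 ^ n)%N.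
  rewrite -(ler_nat R) natrX (le_trans ku)// /u ler_piMl ?(ltW n0)//.
  by rewrite ler_pdivrMr// mul1r lerD2r.
have := H n k k2; rewrite leNgt => /negP; apply.
have hu : r = s + (t - s) * (u / 2 ^+ n).
  by rewrite /u; field; rewrite ts0 gt_eqF.
suff : `|r - dyadic s t n k| < e.
  by move/He => /= /ltr_normlW; lra.
have -> : r - dyadic s t n k = (t - s) / 2 ^+ n * (u - k%:R).
  by rewrite {1}hu /dyadic; ring.
rewrite normrM ger0_norm ?divr_ge0 ?(ltW n0)//.
apply: le_lt_trans Hn; rewrite ler_piMr ?divr_ge0 ?(ltW n0)//.
rewrite ger0_norm ?subr_ge0//.
by rewrite -natr1 in uk; lra.
Qed.

(** Continuity of [W] holds only within nonnegative times. Freezing the time at 0 yields a path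
    continuous on the whole line, to which the intermediate and extreme value theorems apply
    directly. *)
Lemma path_extension (s x : R) (w : T) : 0 <= s -> exists2 Y : R -> R, continuous Y &
  forall r, s <= r -> Y r = Xproc W s x r w.
Proof.
move=> s0; have [W0 cW _ _] := BM.
have /continuous_within_itvcyP[cW1 cW2] := cW w.
pose V (r : R) := W (Num.max r 0) w.
have cV : continuous V.
  move=> r; have [r0|r0|r0] := ltgtP r 0.
  - rewrite /continuous_at /V (max_r (ltW r0)).
    apply: cvg_near_cst; near=> y; rewrite max_r// ltW//.
    by near: y; exact: lt_nbhsl.
  - have cr : {for r, continuous (fun r => W r w)}.
      by apply: cW1; rewrite in_itv/= r0.
    rewrite /continuous_at /V (max_l (ltW r0)).
    apply: cvg_trans cr; apply: near_eq_cvg; near=> y.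
    by rewrite max_l// ltW//; near: y; exact: lt_nbhsr.
  - rewrite r0; apply/left_right_continuousP; rewrite /V maxxx; split.
    + by apply: cvg_near_cst; near=> y; rewrite max_r.
    + apply: cvg_trans cW2; apply: near_eq_cvg; near=> y.
      by rewrite max_l//; near: y; exact: nbhs_right_ge.
pose D (r : R) := Num.sqrt (Num.max r 0 + 1).
exists (fun r => (x * Num.sqrt (s + 1) + V (r - s)) / D r).
  move=> r; apply: cvgM.
    apply: cvgD; first exact: cvg_cst.
    apply: (@cvg_comp _ _ _ (fun r => r - s) V _ (nbhs (r - s))); last exact: cV.
    by apply: cvgB; [exact: cvg_id|exact: cvg_cst].
  apply: cvgV; first by rewrite gt_eqF// sqrtr_gt0 ltr_wpDl// le_max lexx orbT.
  apply: (@cvg_comp _ _ _ (fun r => Num.max r 0 + 1) Num.sqrt); last exact: sqrt_continuous.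
  apply: cvgD; last exact: cvg_cst.
  by apply: continuous_max; [exact: cvg_id|exact: cvg_cst].
move=> r sr; rewrite /Xproc /V /D !max_l// ?subr_ge0//.
exact: le_trans sr.
Unshelve. all: by end_near. Qed.

Lemma survives_phi (s t x : R) w :
  survives W s t x w <-> forall r, s <= r <= t -> phi (Xproc W s x r w) != 0.
Proof.
have E y : (`|y| == 1 :> R) = (phi y == 0).
  have -> : (phi y == 0) = (y ^+ 2 == 1) by rewrite /phi subr_eq0 eq_sym.
  rewrite -(real_normK (num_real y)) sqrf_eq1.
  by rewrite [X in _ || X]gt_eqF ?orbF// (lt_le_trans (@ltrN10 R)).
split=> H r; first by move=> /andP[sr rt]; rewrite -E H.
by move=> sr rt; rewrite E H// sr.
Qed.

Lemma continuous_phi : continuous (phi : R -> R).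
Proof.
by move=> y; apply: cvgB; [exact: cvg_cst|exact: exprn_continuous].
Qed.

Let phi_path (s x : R) w : 0 <= s -> exists2 Z : R -> R, continuous Z &
  forall r, s <= r -> Z r = phi (Xproc W s x r w).
Proof.
move=> s0; have [Y cY YE] := path_extension x w s0.
exists (phi \o Y); last by move=> r sr /=; rewrite YE.
by move=> r; apply: continuous_comp; [exact: cY|exact: continuous_phi].
Qed.

Lemma survives_pos (s t x : R) w : 0 <= s -> s <= t -> 0 < phi x ->
  survives W s t x w -> forall r, s <= r <= t -> 0 < phi (Xproc W s x r w).
Proof.
move=> s0 st px /survives_phi H r /andP[sr rt].
have [Z cZ ZE] := phi_path x w s0.
rewrite lt_neqAle eq_sym H ?sr//= leNgt; apply/negP => pr.
have Zs : Z s = phi x.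
  rewrite ZE// /Xproc subrr; have [-> _ _ _] := BM.
  by rewrite addr0 mulfK// gt_eqF// sqrtr_gt0 ltr_wpDl.
have [] := @IVT R Z s r 0 sr (continuous_subspaceT cZ).
  rewrite Zs ZE// ge_min (ltW pr) orbT/= le_max (ltW px)//.
move=> c; rewrite in_itv/= => /andP[sc cr] Zc.
have := H c; rewrite sc (le_trans cr rt) => /(_ isT).
by rewrite -ZE// Zc eqxx.
Qed.

Lemma survives_dyadic (s t x c : R) w : 0 <= s -> s <= t -> 0 < c ->
  (forall n k, (k <= 2 ^ n)%N -> c <= phi (Xproc W s x (dyadic s t n k) w)) ->
  survives W s t x w.
Proof.
move=> s0 st c0 H; apply/survives_phi => r /[dup] rst /andP[sr rt].
have [Z cZ ZE] := phi_path x w s0.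
have cNZ : continuous (fun r => - Z r) by move=> y; apply: cvgN; exact: cZ.
have := @dyadic_dense s t (- c) (fun r => - Z r) st cNZ.
move=> /(_ _ r rst); rewrite lerN2 ZE// => h; rewrite gt_eqF//.
apply: lt_le_trans (h _) => // n k k2.
by rewrite lerN2 ZE ?H//; have /andP[] := dyadic_itv st k2.
Qed.

Lemma survives_dyadicN (s t x c : R) w : 0 <= s -> s <= t -> 0 < c ->
  (forall n k, (k <= 2 ^ n)%N -> phi (Xproc W s x (dyadic s t n k) w) <= - c) ->
  survives W s t x w.
Proof.
move=> s0 st c0 H; apply/survives_phi => r /[dup] rst /andP[sr rt].
have [Z cZ ZE] := phi_path x w s0.
have := @dyadic_dense s t (- c) Z st cZ.
move=> /(_ _ r rst); rewrite ZE// => h; rewrite lt_eqF//.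
have {}h : phi (Xproc W s x r w) <= - c.
  by apply: h => n k k2; rewrite ZE ?H//; have /andP[] := dyadic_itv st k2.
by rewrite (le_lt_trans h)// oppr_lt0.
Qed.

(** On a surviving path [phi] keeps its sign and, on a compact time interval, stays away from 0.
    Survival thus becomes a countable combination of closed conditions at dyadic times. The negative
    alternative is for starting points outside the closed interval, which the definition allows. *)
Lemma survives_cases (s t x : R) w : 0 <= s -> s <= t ->
  survives W s t x w <->
  (exists m : nat, forall n k, (k <= 2 ^ n)%N ->
     m.+1%:R^-1 <= phi (Xproc W s x (dyadic s t n k) w)) \/
  (exists m : nat, forall n k, (k <= 2 ^ n)%N ->
     phi (Xproc W s x (dyadic s t n k) w) <= - m.+1%:R^-1).
Proof.
move=> s0 st; split; last first.
  move=> [[m H]|[m H]].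
    by apply: (@survives_dyadic _ _ _ m.+1%:R^-1) => //; rewrite invr_gt0.
  by apply: (@survives_dyadicN _ _ _ m.+1%:R^-1) => //; rewrite invr_gt0.
move=> /survives_phi H.
have [Z cZ ZE] := phi_path x w s0.
have small (c : R) : 0 < c -> exists m : nat, m.+1%:R^-1 <= c.
  move=> c0; exists (Num.trunc c^-1); rewrite invf_ple ?posrE//.
  exact/ltW/truncnS_gt.
have Zn0 r : s <= r <= t -> Z r != 0.
  by move=> /[dup] /andP[sr _] rst; rewrite ZE// H.
have [Zs|Zs] := ltP 0 (Z s).
  left; have [c] := EVT_min st (continuous_subspaceT cZ).
  rewrite in_itv/= => cst cmin.
  have Zc : 0 < Z c.
    rewrite lt_neqAle eq_sym Zn0//= leNgt; apply/negP => Zc.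
    have /andP[sc ct] := cst.
    have [] := @IVT R Z s c 0 sc (continuous_subspaceT cZ).
      by rewrite ge_min (ltW Zc) orbT/= le_max (ltW Zs).
    move=> y; rewrite in_itv/= => /andP[sy yc] Zy.
    by have := Zn0 y; rewrite sy (le_trans yc ct) Zy eqxx => /(_ isT).
  have [m hm] := small _ Zc; exists m => n k k2; apply: (le_trans hm).
  have /andP[a b] := dyadic_itv st k2.
  by rewrite -ZE// cmin// in_itv/= a.
right; have [c] := EVT_max st (continuous_subspaceT cZ).
rewrite in_itv/= => cst cmax.
have {}Zs : Z s < 0 by rewrite lt_neqAle Zn0 ?lexx.
have Zc : Z c < 0.
  rewrite lt_neqAle Zn0//= leNgt; apply/negP => Zc.
  have /andP[sc ct] := cst.
  have [] := @IVT R Z s c 0 sc (continuous_subspaceT cZ).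
    by rewrite ge_min (ltW Zs)/= le_max (ltW Zc) orbT.
  move=> y; rewrite in_itv/= => /andP[sy yc] Zy.
  by have := Zn0 y; rewrite sy (le_trans yc ct) Zy eqxx => /(_ isT).
have [m hm] := small (- Z c) ltac:(by rewrite oppr_gt0).
exists m => n k k2; rewrite lerNr (le_trans hm)// lerN2.
have /andP[a b] := dyadic_itv st k2.
by rewrite -ZE// cmax// in_itv/= a.
Qed.

Lemma measurable_Xproc2 (s r : R) : s <= r ->
  measurable_fun [set: R * T] (fun xw => Xproc W s xw.1 r xw.2).
Proof.
move=> sr; have [_ _ mW _] := BM; rewrite /Xproc.
apply: measurable_funM => //; apply: measurable_funD.
  by apply: measurable_funM.
by apply: (measurableT_comp (mW (r - s) _)) => //; rewrite subr_ge0.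
Qed.

(** Joint measurability in the starting point and the path, so that expectations over surviving
    paths are measurable functions of the starting point. *)
Lemma measurable_survives2 (s t : R) : 0 <= s -> s <= t ->
  measurable [set xw : R * T | survives W s t xw.1 xw.2].
Proof.
move=> s0 st.
have mphi r : s <= r -> measurable_fun [set: R * T] (fun xw => phi (Xproc W s xw.1 r xw.2)).
  move=> sr; apply: (measurableT_comp (proj1 quartic_phi)).
  exact: measurable_Xproc2.
pose L m n k := [set xw : R * T | (k <= 2 ^ n)%N ->
  m.+1%:R^-1 <= phi (Xproc W s xw.1 (dyadic s t n k) xw.2)].
pose U m n k := [set xw : R * T | (k <= 2 ^ n)%N ->
  phi (Xproc W s xw.1 (dyadic s t n k) xw.2) <= - m.+1%:R^-1].
have mL m n k : measurable (L m n k).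
  rewrite /L; have [k2|k2] := boolP (k <= 2 ^ n)%N; last first.
    by rewrite (_ : [set _ | _] = setT)//; apply/seteqP; split.
  have sd : s <= dyadic s t n k by have /andP[] := dyadic_itv st k2.
  rewrite (_ : [set _ | _] = setT `&` (fun xw => phi (Xproc W s xw.1 (dyadic s t n k) xw.2))
    @^-1` `[m.+1%:R^-1, +oo[).
    by apply: mphi => //; exact: measurable_itv.
  apply/seteqP; split => xw /=; rewrite in_itv/= andbT; first by move=> h; split => //; exact: h.
  by move=> [_ h] _.
have mU m n k : measurable (U m n k).
  rewrite /U; have [k2|k2] := boolP (k <= 2 ^ n)%N; last first.
    by rewrite (_ : [set _ | _] = setT)//; apply/seteqP; split.
  have sd : s <= dyadic s t n k by have /andP[] := dyadic_itv st k2.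
  rewrite (_ : [set _ | _] = setT `&` (fun xw => phi (Xproc W s xw.1 (dyadic s t n k) xw.2))
    @^-1` `]-oo, - m.+1%:R^-1]).
    by apply: mphi => //; exact: measurable_itv.
  apply/seteqP; split => xw /=; rewrite in_itv/=; first by move=> h; split => //; exact: h.
  by move=> [_ h] _.
rewrite (_ : [set _ | _] = (\bigcup_m \bigcap_n \bigcap_k L m n k) `|`
   (\bigcup_m \bigcap_n \bigcap_k U m n k)).
  by apply: measurableU; apply: bigcupT_measurable => m; apply: bigcapT_measurable => n;
    apply: bigcapT_measurable => k.
apply/seteqP; split => xw /=.
  move/(survives_cases xw.1 xw.2 s0 st) => [[m H]|[m H]].
    by left; exists m => // n _ k _ /= k2; exact: H.
  by right; exists m => // n _ k _ /= k2; exact: H.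
move=> [[m _ H]|[m _ H]]; apply/(survives_cases xw.1 xw.2 s0 st).
  by left; exists m => n k; exact: H.
by right; exists m => n k; exact: H.
Qed.

Lemma measurable_survives (s t x : R) : 0 <= s -> s <= t ->
  measurable [set w | survives W s t x w].
Proof.
move=> s0 st; have m2 := measurable_survives2 s0 st.
have := @measurable_xsection _ _ _ _ _ x m2.
by congr measurable; apply/seteqP; split => w; rewrite /xsection/= inE.
Qed.

End path.

(** * Limits of bounds and bounded convergence *)

Section limits.
Context {R : realType}.

Lemma cvg_ge_cst (u : nat -> R) (l a : R) : u n @[n --> \oo] --> l ->
  (forall n, a <= u n) -> a <= l.
Proof.
move=> ul H; rewrite -(cvg_lim _ ul)//; apply: limr_ge; first exact: (cvgP _ ul).
exact: nearW.
Qed.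

Lemma cvg_le_cst (u : nat -> R) (l a : R) : u n @[n --> \oo] --> l ->
  (forall n, u n <= a) -> l <= a.
Proof.
move=> ul H; rewrite -(cvg_lim _ ul)//; apply: limr_le; first exact: (cvgP _ ul).
exact: nearW.
Qed.

End limits.

Section bounded_convergence.
Context {d : measure_display} {T : measurableType d} {R : realType}.
Variable mu : probability T R.

Lemma bounded_integrable (h : T -> R) M : measurable_fun setT h ->
  (forall w, `|h w| <= M) -> mu.-integrable setT (EFin \o h).
Proof.
move=> mh hM.
apply: (@le_integrable _ _ _ mu setT measurableT _ (EFin \o cst M)).
- exact/measurable_EFinP.
- by move=> w _ /=; rewrite lee_fin (le_trans (hM w))// ler_norm.
- exact: finite_measure_integrable_cst.
Qed.

Lemma Rintegral_prob_cst (a : R) : \int[mu]_w a = a.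
Proof. by rewrite Rintegral_cst//= probability_setT mulr1. Qed.

Lemma bounded_Rintegral_cvg (h : nat -> T -> R) (l : T -> R) M :
  (forall n, measurable_fun setT (h n)) -> (forall n w, `|h n w| <= M) ->
  (forall w, h n w @[n --> \oo] --> l w) ->
  \int[mu]_w h n w @[n --> \oo] --> \int[mu]_w l w.
Proof.
move=> mh hM hl.
have ml : measurable_fun setT l by exact: (measurable_fun_cvg mh (fun w _ => hl w)).
have lM w : `|l w| <= M.
  exact: (cvg_le_cst (cvg_norm (hl w)) (fun n => hM n w)).
apply: fine_cvg; rewrite fineK; last first.
  by apply: integrable_fin_num => //; exact: bounded_integrable lM.
apply: (@dominated_cvg _ _ _ mu setT measurableT (fun n w => (h n w)%:E)
  (fun w => (l w)%:E) (EFin \o cst M)) => //.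
- by move=> n; exact/measurable_EFinP.
- by move=> w _; apply: cvg_EFin; [exact: nearW|exact: hl].
- exact: finite_measure_integrable_cst.
- by move=> n w _ /=; rewrite lee_fin.
Unshelve. all: by end_near. Qed.

End bounded_convergence.

(** * The continuously killed evolution and its eigenfunction *)

Section killed_semigroup.
Context {R : realType} {d : measure_display} {T : measurableType d}.
Context (P : probability T R) (W : R -> T -> R).
Hypothesis BM : is_std_BM P W.
Implicit Types (s t u x y : R) (f : R -> R) (g : nat -> R).

Definition surv_set s t x : set T := [set w | survives W s t x w].

(** The inner expectation of [surv_expect] as a real number; from a start inside and for [f >= 0],
    grid killing approximates it from above. *)
Definition Sv s t f x : R :=
  \int[P]_w (\1_(surv_set s t x) w * f (Xproc W s x t w)).

Lemma Xproc0 s x w : 0 <= s -> Xproc W s x s w = x.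
Proof.
move=> s0; rewrite /Xproc subrr; have [-> _ _ _] := BM.
by rewrite addr0 mulfK// gt_eqF// sqrtr_gt0 ltr_wpDl.
Qed.

Lemma SvE s t f x : 0 <= s -> s <= t -> bounded_mfun f ->
  (\int[P]_(w in surv_set s t x) (f (Xproc W s x t w))%:E = (Sv s t f x)%:E)%E.
Proof.
move=> s0 st [mf [M fM]]; have mS := measurable_survives BM x s0 st.
rewrite integral_mkcond /Sv /Rintegral fineK; last first.
  apply: integrable_fin_num => //; apply: (@bounded_integrable _ _ _ _ _ M).
    apply: measurable_funM; first exact: measurable_indic.
    exact: (measurableT_comp mf (measurable_Xproc BM x st)).
  move=> w; rewrite normrM indicE; case: (_ \in _); rewrite ?normr1 ?mul1r//.
  by rewrite normr0 mul0r (le_trans _ (fM 0)).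
apply: eq_integral => w _; rewrite patchE indicE/=.
by case: (_ \in _); rewrite ?mul1r ?mul0r.
Qed.

Let integrable_on (E : set T) s t x f : measurable E -> s <= t -> bounded_mfun f ->
  P.-integrable setT (EFin \o (fun w => \1_E w * f (Xproc W s x t w))).
Proof.
move=> mE st [mf [M fM]]; apply: (@bounded_integrable _ _ _ _ _ M).
  apply: measurable_funM; first exact: measurable_indic.
  exact: (measurableT_comp mf (measurable_Xproc BM x st)).
move=> w; rewrite normrM indicE; case: (_ \in _); rewrite ?normr1 ?mul1r//.
by rewrite normr0 mul0r (le_trans _ (fM 0)).
Qed.

Lemma SvD s t f1 f2 x : 0 <= s -> s <= t -> bounded_mfun f1 -> bounded_mfun f2 ->
  Sv s t (fun y => f1 y + f2 y) x = Sv s t f1 x + Sv s t f2 x.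
Proof.
move=> s0 st b1 b2; have mS := measurable_survives BM x s0 st.
rewrite /Sv -RintegralD//; [|exact: integrable_on|exact: integrable_on].
by apply: eq_Rintegral => w _; rewrite mulrDr.
Qed.

Lemma SvZ s t a f x : 0 <= s -> s <= t -> bounded_mfun f ->
  Sv s t (fun y => a * f y) x = a * Sv s t f x.
Proof.
move=> s0 st b; have mS := measurable_survives BM x s0 st.
rewrite /Sv -RintegralZl//; last exact: integrable_on.
by apply: eq_Rintegral => w _; rewrite mulrCA.
Qed.

Lemma le_Sv s t f1 f2 x : 0 <= s -> s <= t -> Iunit x ->
  bounded_mfun f1 -> bounded_mfun f2 -> (forall y, Iunit y -> f1 y <= f2 y) ->
  Sv s t f1 x <= Sv s t f2 x.
Proof.
move=> s0 st Ix b1 b2 f12; have mS := measurable_survives BM x s0 st.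
apply: le_Rintegral => //; [exact: integrable_on|exact: integrable_on|].
move=> w _; rewrite indicE; case: (boolP (w \in _)) => [|_]; last by rewrite !mul0r.
rewrite inE => ws; rewrite !mul1r f12//; apply/IunitP.
have px : 0 < phi x by exact/IunitP.
by apply: (survives_pos BM s0 st px ws); rewrite st lexx.
Qed.

Lemma Sv_ge0 s t f x : (forall y, 0 <= f y) -> 0 <= Sv s t f x.
Proof. by move=> f0; apply: Rintegral_ge0 => w _; rewrite mulr_ge0// indicE. Qed.

Lemma Sv_bound s t f M x : 0 <= s -> s <= t -> bounded_mfun f ->
  (forall y, 0 <= f y) -> (forall y, f y <= M) -> Sv s t f x <= M.
Proof.
move=> s0 st bf f0 fM; have mS := measurable_survives BM x s0 st.
have M0 : 0 <= M by exact: le_trans (fM 0).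
apply: (@le_trans _ _ (\int[P]_w M)); last by rewrite Rintegral_prob_cst.
apply: le_Rintegral => //; first exact: integrable_on.
  exact: finite_measure_integrable_cst.
move=> w _; rewrite indicE; case: (_ \in _); rewrite ?mul1r ?mul0r//.
Qed.

Lemma bounded_mfun_Sv s t f : 0 <= s -> s <= t -> bounded_mfun f ->
  (forall y, 0 <= f y) -> bounded_mfun (Sv s t f).
Proof.
move=> s0 st bf f0; have [mf [M fM]] := bf; split; last first.
  exists M => x; rewrite ger0_norm ?Sv_ge0//; apply: Sv_bound => // y.
  by rewrite (le_trans (ler_norm _)).
have m2 := measurable_survives2 BM s0 st.
pose h (xw : R * T) : \bar R :=
  (\1_[set xw : R * T | survives W s t xw.1 xw.2] xw * f (Xproc W s xw.1 t xw.2))%:E.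
have mh : measurable_fun setT h.
  apply/measurable_EFinP/measurable_funM; first exact: measurable_indic.
  exact: (measurableT_comp mf (measurable_Xproc2 BM st)).
have h0 xw : (0 <= h xw)%E by rewrite lee_fin mulr_ge0// indicE.
have mF := @measurable_fun_fubini_tonelli_F _ _ _ _ R P h mh h0.
have -> : Sv s t f = fine \o fubini_F P h.
  apply/funext => x; rewrite -[RHS]/(fine (\int[P]_w h (x, w))%E) /Sv /Rintegral.
  have E w : (w \in surv_set s t x) =
      ((x, w) \in [set xw : R * T | survives W s t xw.1 xw.2]).
    by apply/idP/idP; rewrite !inE.
  by congr fine; apply: eq_integral => w _; rewrite /h !indicE/= E.
exact: (measurableT_comp (@fine_measurable R setT measurableT) mF).
Qed.

Lemma Sv_refl s f x : 0 <= s -> Iunit x -> Sv s s f x = f x.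
Proof.
move=> s0 Ix; rewrite /Sv.
transitivity (\int[P]_w f x); last exact: Rintegral_prob_cst.
apply: eq_Rintegral => w _; rewrite Xproc0// indicE mem_set ?mul1r//.
apply/survives_phi => r /andP[r1 r2].
have -> : r = s by apply/eqP; rewrite eq_le r1 r2.
by rewrite Xproc0// gt_eqF//; apply/IunitP.
Qed.

Section grid.
Variables (g : nat -> R) (N : nat) (t x : R).
Hypotheses (g0 : 0 <= g 0%N) (g_lt : forall i, g i < g i.+1) (gN : g N = t).
Hypothesis Ix : Iunit x.

Lemma grid_mono : {homo g : i j / (i <= j)%N >-> i <= j}.
Proof. by apply: homo_leq => //; [exact: le_trans|move=> i; exact/ltW]. Qed.

Lemma surv_in_grid : surv_set (g 0%N) t x `<=` in_grid W g x Iunit N.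
Proof.
move=> w ws i /= iN; apply/IunitP.
have st : g 0%N <= t by rewrite -gN; exact: grid_mono.
have px : 0 < phi x by exact/IunitP.
apply: (survives_pos BM g0 st px ws); rewrite -gN !grid_mono//.
Qed.

Lemma killed_grid D f : measurable D -> bounded_mfun f -> (forall y, 0 <= f y) ->
  killed D (mkseq (grid_ratio g) N) f x =
  \int[P]_w (\1_(in_grid W g x D N) w * f (Xproc W (g 0%N) x t w)).
Proof.
move=> mD bf f0; have E := fdd BM x g0 g_lt mD N bf f0.
rewrite gN integral_mkcond in E; apply: esym; rewrite /Rintegral.
rewrite -[RHS]/(fine (killed D (mkseq (grid_ratio g) N) f x)%:E) -E; congr fine.
apply: eq_integral => w _; rewrite patchE indicE/=.
by case: (_ \in _); rewrite ?mul1r ?mul0r.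
Qed.

Lemma Sv_le_killed f : bounded_mfun f -> (forall y, 0 <= f y) ->
  Sv (g 0%N) t f x <= killed Iunit (mkseq (grid_ratio g) N) f x.
Proof.
move=> bf f0; have st : g 0%N <= t by rewrite -gN; exact: grid_mono.
have mI := @measurable_Iunit R.
have mS := measurable_survives BM x g0 st.
have mG := measurable_in_grid BM x g_lt mI N.
rewrite killed_grid//; apply: le_Rintegral => //; [exact: integrable_on|exact: integrable_on|].
move=> w _; apply: ler_wpM2r => //; rewrite !indicE ler_nat.
case: (boolP (w \in surv_set _ _ _)) => //; rewrite inE => /surv_in_grid wg.
by rewrite mem_set.
Qed.

End grid.

Definition dyadic_list s t n := mkseq (grid_ratio (dyadic s t n)) (2 ^ n).

Lemma dyadic0 s t n : dyadic s t n 0 = s.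
Proof. by rewrite /dyadic mul0r mulr0 addr0. Qed.

Lemma dyadic_end s t n : dyadic s t n (2 ^ n) = t.
Proof.
rewrite /dyadic natrX divff ?mulr1; last by rewrite expf_neq0// pnatr_eq0.
by rewrite addrC subrK.
Qed.

Lemma dyadic_step s t n i : dyadic s t n i.+1 - dyadic s t n i = (t - s) / 2 ^+ n.
Proof. by rewrite /dyadic -natr1; ring. Qed.

Lemma dyadic_lt s t n i : s < t -> dyadic s t n i < dyadic s t n i.+1.
Proof. by move=> st; rewrite -subr_gt0 dyadic_step divr_gt0 ?subr_gt0// exprn_gt0. Qed.

Lemma dyadicS s t n i : dyadic s t n.+1 i.*2 = dyadic s t n i.
Proof.
rewrite /dyadic -muln2 natrM exprS; congr (_ + _ * _); field.
by rewrite expf_neq0// pnatr_eq0.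
Qed.

Lemma dyadic_sqr s t n : 0 <= s -> s < t ->
  \sum_(q <- dyadic_list s t n) (1 - q) ^+ 2 <= (t - s) ^+ 2 / 2 ^+ n.
Proof.
move=> s0 st.
have := @grid_sum_sqr R (dyadic s t n) (2 ^ n) ((t - s) / 2 ^+ n).
rewrite dyadic0 => /(_ s0 (fun i => dyadic_lt n i st)) h.
apply: (le_trans (h _)); first by move=> i _; rewrite dyadic_step.
rewrite natrX le_eqVlt; apply/orP; left; apply/eqP; field.
by rewrite expf_neq0// pnatr_eq0.
Qed.

Lemma cvg_half_pow (B : R) : B / 2 ^+ n @[n --> \oo] --> (0 : R).
Proof.
have -> : (fun n => B / 2 ^+ n) = (fun n => B * (2^-1 : R) ^+ n).
  by apply/funext => n; rewrite exprVn.
rewrite -(mulr0 B); apply: cvgM; first exact: cvg_cst.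
by apply: cvg_expr; rewrite ger0_norm ?invr_ge0// invf_lt1 ?ltr1n.
Qed.

Lemma dyadic_sqr_cvg s t : 0 <= s -> s < t ->
  \sum_(q <- dyadic_list s t n) (1 - q) ^+ 2 @[n --> \oo] --> (0 : R).
Proof.
move=> s0 st; apply: (@squeeze_cvgr _ _ _ _ (fun=> 0) (fun n => (t - s) ^+ 2 / 2 ^+ n)).
- near=> n; rewrite dyadic_sqr// andbT sumr_ge0// => q _; exact: sqr_ge0.
- exact: cvg_cst.
- exact: cvg_half_pow.
Unshelve. all: by end_near. Qed.

Lemma dyadic_ratios s t n : 0 <= s -> s < t -> ratios (dyadic_list s t n).
Proof.
move=> s0 st; apply: grid_ratios; first by rewrite dyadic0.
by move=> i; exact: dyadic_lt.
Qed.

Lemma dyadic_prod s t n : 0 <= s -> s < t ->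
  \prod_(q <- dyadic_list s t n) q = (s + 1) / (t + 1).
Proof.
move=> s0 st; rewrite /dyadic_list grid_prod ?dyadic0 ?dyadic_end//.
by move=> i; exact: dyadic_lt.
Qed.

(** Staying in the open interval at dyadic times does not exclude touching the boundary in between.
    Staying in the closed set where [c <= phi] does, by density of the dyadic times, and replacing
    the interval by that set costs at most [c]. *)
Lemma Sv_phi0_ge s t x : 0 <= s -> s < t -> Iunit x ->
  (s + 1) / (t + 1) * phi x <= Sv s t phi0 x.
Proof.
move=> s0 st Ix; rewrite leNgt; apply/negP => H.
(* Half of the supposed deficit: after losing [c], the lower bound still exceeds [Sv s t phi0 x]. *)
pose c := ((s + 1) / (t + 1) * phi x - Sv s t phi0 x) / 2.
have c0 : 0 < c by rewrite divr_gt0// subr_gt0.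
pose Dc : set R := [set y | c <= phi y].
have mDc : measurable Dc.
  rewrite (_ : Dc = setT `&` phi @^-1` `[c, +oo[); last first.
    by apply/seteqP; split => y /=; rewrite in_itv/= andbT => // -[].
  by apply: (proj1 quartic_phi) => //; exact: measurable_itv.
have DcI : Dc `<=` Iunit.
  by move=> y /= cy; apply/IunitP; exact: lt_le_trans cy.
have Dcout y : ~ Dc y -> phi y <= c.
  by move=> /negP; rewrite -ltNge => /ltW.
have glt n i := dyadic_lt n i st.
have g0 n : 0 <= dyadic s t n 0 by rewrite dyadic0.
pose E n := in_grid W (dyadic s t n) x Dc (2 ^ n).
have mE n : measurable (E n) := measurable_in_grid BM x (glt n) mDc (2 ^ n).
(* Each dyadic grid contains the previous one, so the events decrease and their integrals converge
   to that of the intersection. *)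
have Edec n : E n.+1 `<=` E n.
  move=> w Ew i /= iN; have := Ew i.*2; rewrite /= !dyadic0 dyadicS; apply.
  by rewrite ltnS expnS mul2n leq_double -ltnS.
have {}Edec n m : (n <= m)%N -> E m `<=` E n.
  elim: m => [|m IH]; first by rewrite leqn0 => /eqP ->.
  by rewrite leq_eqVlt => /orP[/eqP ->//|/IH h]; apply: subset_trans h; exact: Edec.
have lower n : (s + 1) / (t + 1) * phi x - c <=
    \int[P]_w (\1_(E n) w * phi0 (Xproc W s x t w)).
  have := killed_phi0_lower mDc DcI (ltW c0) Dcout (dyadic_ratios n s0 st) x.
  rewrite dyadic_prod// (@killed_grid _ _ t)//.
  - by rewrite dyadic0.
  - exact: dyadic_end.
  - exact: bounded_mfun_phi0.
  - exact: phi0_ge0.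
have cvgE : \int[P]_w (\1_(E n) w * phi0 (Xproc W s x t w)) @[n --> \oo] -->
    \int[P]_w (\1_(\bigcap_n E n) w * phi0 (Xproc W s x t w)).
  apply: (@bounded_Rintegral_cvg _ _ _ _ _ _ 1).
  - move=> n; apply: measurable_funM; first exact: measurable_indic.
    exact: (measurableT_comp (proj1 bounded_mfun_phi0) (measurable_Xproc BM x (ltW st))).
  - move=> n w; rewrite ger0_norm; last by rewrite mulr_ge0 ?phi0_ge0// indicE.
    by rewrite indicE; case: (_ \in _); rewrite ?mul1r ?mul0r ?phi0_le1.
  - move=> w; apply: cvgM; last exact: cvg_cst.
    have [wE|wE] := pselect ((\bigcap_n E n) w).
      apply: cvg_near_cst; apply: nearW => n; rewrite !indicE !mem_set//.
      exact: wE.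
    have [n0 wn0] : exists n, ~ E n w by apply/existsNP => h; apply: wE => n _.
    apply: cvg_near_cst; near=> n; rewrite !indicE !memNset//.
    move=> wn; apply: wn0; apply: (Edec n0 n _ w wn).
    by near: n; exact: nbhs_infty_ge.
have up : \int[P]_w (\1_(\bigcap_n E n) w * phi0 (Xproc W s x t w)) <= Sv s t phi0 x.
  have mS := measurable_survives BM x s0 (ltW st).
  have mbE : measurable (\bigcap_n E n) by exact: bigcapT_measurable.
  apply: le_Rintegral => //.
  - exact: integrable_on mbE (ltW st) bounded_mfun_phi0.
  - exact: integrable_on mS (ltW st) bounded_mfun_phi0.
  move=> w _; apply: ler_wpM2r; first exact: phi0_ge0.
  rewrite !indicE ler_nat; case: (boolP (w \in \bigcap_n E n)) => //.
  rewrite inE => wE; rewrite mem_set//.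
  apply: (survives_dyadic BM s0 (ltW st) c0) => n k k2.
  by have := wE n I k; rewrite /= dyadic0; apply.
have := le_trans (cvg_ge_cst cvgE lower) up; rewrite /c; lra.
Unshelve. all: by end_near. Qed.

Lemma Sv_phi0 s t x : 0 <= s -> s <= t -> Iunit x ->
  Sv s t phi0 x = (s + 1) / (t + 1) * phi x.
Proof.
move=> s0; rewrite le_eqVlt => /orP[/eqP <- Ix|st Ix].
  by rewrite Sv_refl// divff ?mul1r ?phi0_in// gt_eqF// ltr_wpDl.
apply/eqP; rewrite eq_le Sv_phi0_ge// andbT; apply/ler_addgt0Pr => e e0.
have [C C0 HC] := killed_phi0_upper e0.
have cv : (s + 1) / (t + 1) * phi x + e +
  C * \sum_(q <- dyadic_list s t n) (1 - q) ^+ 2 @[n --> \oo] -->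
  (s + 1) / (t + 1) * phi x + e + C * 0.
  apply: cvgD; first exact: cvg_cst.
  by apply: cvgM; [exact: cvg_cst|exact: dyadic_sqr_cvg].
rewrite mulr0 addr0 in cv.
have low n : Sv s t phi0 x <= (s + 1) / (t + 1) * phi x + e +
    C * \sum_(q <- dyadic_list s t n) (1 - q) ^+ 2.
  have := HC _ x (dyadic_ratios n s0 st) Ix; rewrite dyadic_prod//; apply: le_trans.
  have := @Sv_le_killed (dyadic s t n) (2 ^ n) t x; rewrite dyadic0; apply => //.
  - by move=> i; exact: dyadic_lt.
  - exact: dyadic_end.
  - exact: bounded_mfun_phi0.
  - exact: phi0_ge0.
exact: cvg_ge_cst cv low.
Qed.

End killed_semigroup.

(** * Convergence along grids, semigroup property and duality *)

Section killed_limit.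
Context {R : realType} {d : measure_display} {T : measurableType d}.
Context (P : probability T R) (W : R -> T -> R).
Hypothesis BM : is_std_BM P W.
Implicit Types (s t u x y : R) (f : R -> R).
Local Notation gamma := (@normal_prob R 0 1).
Local Notation Sv := (Sv P W).

Lemma bounded_ub f : bounded_mfun f -> exists2 M : R, 0 < M & forall y, f y <= M.
Proof.
move=> [_ [M fM]]; exists (`|M| + 1); first by rewrite ltr_wpDl.
by move=> y; rewrite (le_trans (ler_norm _))// (le_trans (fM y))// ler_wpDr// ler_norm.
Qed.

Lemma cvg0_near (u : nat -> R) (e : R) : u n @[n --> \oo] --> (0 : R) -> 0 < e ->
  \forall n \near \oo, u n <= e.
Proof.
move=> /cvgrPdist_le/(_ e) h /h; apply: filterS => n; rewrite sub0r normrN.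
by apply: le_trans; exact: ler_norm.
Qed.

Lemma cvg0Z (C : R) (u : nat -> R) : u n @[n --> \oo] --> (0 : R) ->
  C * u n @[n --> \oo] --> (0 : R).
Proof.
move=> u0; have : C * u n @[n --> \oo] --> C * 0 by apply: cvgM; [exact: cvg_cst|].
by rewrite mulr0.
Qed.

Lemma cvg0D (u v : nat -> R) : u n @[n --> \oo] --> (0 : R) ->
  v n @[n --> \oo] --> (0 : R) -> u n + v n @[n --> \oo] --> (0 : R).
Proof.
move=> u0 v0; have : u n + v n @[n --> \oo] --> (0 : R) + 0 by exact: cvgD.
by rewrite addr0.
Qed.

Section grids.
Variables (g : nat -> nat -> R) (N : nat -> nat) (s t x : R).
Hypotheses (s0 : 0 <= s) (st : s <= t) (g0 : forall n, g n 0%N = s)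
  (g_lt : forall n i, g n i < g n i.+1) (gN : forall n, g n (N n) = t).
Hypothesis mesh : \sum_(q <- mkseq (grid_ratio (g n)) (N n)) (1 - q) ^+ 2
  @[n --> \oo] --> (0 : R).
Hypothesis Ix : Iunit x.
Let L n := mkseq (grid_ratio (g n)) (N n).

Let rL n : ratios (L n).
Proof. by apply: grid_ratios; rewrite ?g0. Qed.

Let pL n : \prod_(q <- L n) q = (s + 1) / (t + 1).
Proof. by rewrite /L grid_prod ?g0 ?gN. Qed.

Let SvL f n : bounded_mfun f -> (forall y, 0 <= f y) ->
  Sv s t f x <= killed Iunit (L n) f x.
Proof.
move=> bf f0; have := @Sv_le_killed _ _ _ _ _ BM (g n) (N n) t x.
by rewrite g0; apply.
Qed.

Let phi0_cvg : killed Iunit (L n) phi0 x @[n --> \oo] --> Sv s t phi0 x.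
Proof.
apply/cvgrPdist_le => e e0; have e2 : 0 < e / 2 by rewrite divr_gt0.
have [C C0 HC] := killed_phi0_upper e2.
have cC : C * \sum_(q <- L n) (1 - q) ^+ 2 @[n --> \oo] --> (0 : R).
  exact: cvg0Z mesh.
near=> n; rewrite distrC ger0_norm; last first.
  by rewrite subr_ge0 SvL//; [exact: bounded_mfun_phi0|exact: phi0_ge0].
have h1 := HC (L n) x (rL n) Ix; rewrite pL in h1.
rewrite (Sv_phi0 BM)//.
have h2 : C * \sum_(q <- L n) (1 - q) ^+ 2 <= e / 2.
  by near: n; exact: cvg0_near.
by move: h1 h2; lra.
Unshelve. all: by end_near. Qed.

(** The excess comes from paths that are inside at all grid times without surviving. Where their
    endpoint has [phi0] at least the inverse of [m.+1], [f] is at most [M * m.+1%:R * phi0], and the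
    excess for [phi0] is known to vanish. The other endpoints lie in [A m], of small probability.
    The number [m] is fixed first, then [n] tends to infinity. *)
Lemma killed_cvg f : bounded_mfun f -> (forall y, 0 <= f y) ->
  killed Iunit (L n) f x @[n --> \oo] --> Sv s t f x.
Proof.
move=> bf f0; have [M M0 fM] := bounded_ub bf; have [mf _] := bf.
have mX : measurable_fun setT (Xproc W s x t) by exact: (measurable_Xproc BM x st).
(* Excluding the value 0 makes these events decrease to the empty set, so their probability tends to
   0. *)
pose A (m : nat) : set T := [set w | 0 < phi0 (Xproc W s x t w) < m.+1%:R^-1].
have mA m : measurable (A m).
  have mp : measurable_fun setT (phi0 \o Xproc W s x t).
    exact: (measurableT_comp (proj1 bounded_mfun_phi0) mX).
  rewrite (_ : A m = setT `&` (phi0 \o Xproc W s x t) @^-1` `]0, m.+1%:R^-1[).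
    by apply: mp => //; exact: measurable_itv.
  by apply/seteqP; split => w /=; rewrite in_itv/= => // -[].
have A1 m w : `|\1_(A m) w| <= 1 :> R.
  by rewrite indicE; case: (_ \in _); rewrite ?normr0 ?normr1.
have PA : \int[P]_w \1_(A m) w @[m --> \oo] --> (0 : R).
  rewrite -(Rintegral_prob_cst P 0); apply: (@bounded_Rintegral_cvg _ _ _ _ _ _ 1) => //.
    by move=> m; exact: measurable_indic.
  move=> w; apply: cvg_near_cst.
  have [p0|p0] := eqVneq (phi0 (Xproc W s x t w)) 0.
    by apply: nearW => m; rewrite indicE memNset// /A/= p0 ltxx.
  have pp : 0 < phi0 (Xproc W s x t w) by rewrite lt_neqAle eq_sym p0 phi0_ge0.
  near=> m; rewrite indicE memNset// /A/= => /andP[_].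
  rewrite ltNge => /negP; apply; rewrite invf_ple ?posrE//.
  have : (phi0 (Xproc W s x t w))^-1 <= m%:R by near: m; exact: nbhs_infty_ger.
  by move=> h; rewrite (le_trans h)// ler_nat.
pose a m : R := \int[P]_w \1_(A m) w.
have key n m : killed Iunit (L n) f x - Sv s t f x <= M * a m +
    M * m.+1%:R * (killed Iunit (L n) phi0 x - Sv s t phi0 x).
  pose E := in_grid W (g n) x Iunit (N n).
  have g00 : 0 <= g n 0%N by rewrite g0.
  have kE h : bounded_mfun h -> (forall y, 0 <= h y) -> killed Iunit (L n) h x =
      \int[P]_w (\1_E w * h (Xproc W s x t w)).
    move=> bh h0; rewrite /L (@killed_grid _ _ _ _ _ BM (g n) (N n) t x)// ?g0//.
    exact: measurable_Iunit.
  have mE : measurable E.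
    exact: (measurable_in_grid BM x (g_lt n) measurable_Iunit (N n)).
  have mV : measurable (surv_set W s t x) := measurable_survives BM x s0 st.
  have VE : surv_set W s t x `<=` E.
    by have := @surv_in_grid _ _ _ _ _ BM (g n) (N n) t x g00 (g_lt n) (gN n) Ix;
      rewrite g0.
  have int (B : set T) h : measurable B -> bounded_mfun h ->
      P.-integrable setT (EFin \o (fun w => \1_B w * h (Xproc W s x t w))).
    move=> mB [mh [K hK]]; apply: (@bounded_integrable _ _ _ _ _ K).
      apply: measurable_funM; first exact: measurable_indic.
      exact: (measurableT_comp mh mX).
    move=> w; rewrite normrM indicE; case: (_ \in _); rewrite ?normr1 ?mul1r//.
    by rewrite normr0 mul0r (le_trans _ (hK 0)).
  have bp := @bounded_mfun_phi0 R.
  pose K : R := M * m.+1%:R.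
  have K0 : 0 <= K by rewrite mulr_ge0// ltW.
  have intA : P.-integrable setT (EFin \o (fun w => M * \1_(A m) w)).
    apply: (@bounded_integrable _ _ _ _ _ M).
      by apply: measurable_funM => //; exact: measurable_indic.
    move=> w; rewrite indicE; case: (_ \in _); rewrite ?mulr1 ?mulr0 ?normr0 ?(ltW M0)//.
    by rewrite gtr0_norm.
  have intA' : P.-integrable setT (EFin \o (fun w => \1_(A m) w : R)).
    by apply: (@bounded_integrable _ _ _ _ _ 1) => //; exact: measurable_indic.
  have intZ (B : set T) : measurable B ->
      P.-integrable setT (EFin \o (fun w => K * (\1_B w * phi0 (Xproc W s x t w)))).
    by move=> mB; have := int B _ mB (bounded_mfunZ K bp);
      congr (P.-integrable _ _); apply/funext => w /=; rewrite mulrCA.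
  (* Written without subtractions, this holds pointwise: off [E] every grid and survival term
     vanishes, on surviving paths the two sides differ by [M * \1_(A m) w], and elsewhere [A m] or
     [K * phi0] absorbs [f]. *)
  have ineq : killed Iunit (L n) f x + K * Sv s t phi0 x <=
      Sv s t f x + M * a m + K * killed Iunit (L n) phi0 x.
    rewrite !kE//; last exact: phi0_ge0.
    rewrite /Sv /a -!RintegralZl//; [|exact: int|exact: int].
    have addI (h1 h2 : T -> R) : P.-integrable setT (EFin \o h1) ->
        P.-integrable setT (EFin \o h2) ->
        P.-integrable setT (EFin \o (fun w => h1 w + h2 w)).
      move=> i1 i2; apply: (@eq_integrable _ _ _ _ _ measurableT
        (fun w => (h1 w)%:E + (h2 w)%:E)%E) => //.
      exact: integrableD.
    have i1 := int E f mE bf; have i2 := intZ _ mV.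
    have j1 := int _ f mV bf; have j3 := intZ _ mE.
    have j12 := addI _ _ j1 intA.
    rewrite -(RintegralD measurableT i1 i2) -(RintegralD measurableT j1 intA).
    rewrite -(RintegralD measurableT j12 j3).
    apply: le_Rintegral => //; [exact: addI|exact: addI|].
    move=> w _; set X := Xproc W s x t w.
    have p0 := phi0_ge0 X.
    have A0 : 0 <= M * \1_(A m) w by rewrite mulr_ge0 ?(ltW M0)// indicE.
    have [wE|wE] := pselect (E w); last first.
      have wV : ~ surv_set W s t x w by move=> /VE.
      by rewrite !indicE !(memNset wE) !(memNset wV) !mul0r !mulr0 !addr0 add0r -indicE.
    have [wV|wV] := pselect (surv_set W s t x w).
      rewrite ![\1_E w]indicE ![\1_(surv_set W s t x) w]indicE.
      by rewrite !(mem_set wE) !(mem_set wV) !mul1r lerD2r lerDl.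
    rewrite ![\1_E w]indicE ![\1_(surv_set W s t x) w]indicE.
    rewrite !(mem_set wE) !(memNset wV) !mul1r !mul0r mulr0 addr0 add0r.
    have IX : Iunit X by have := wE (N n) (ltnSn _); rewrite /= g0 gN.
    have pX : 0 < phi0 X by rewrite phi0_in//; exact/IunitP.
    have [pl|pl] := ltP (phi0 X) m.+1%:R^-1.
      rewrite indicE mem_set; last by rewrite /A/= -/X pX.
      by rewrite mulr1 (le_trans (fM _))// lerDl mulr_ge0.
    rewrite (le_trans (fM _))// ler_wpDl// /K -mulrA ler_peMr ?(ltW M0)//.
    by rewrite -ler_pdivrMl// mulr1.
  by move: ineq; rewrite -/K; move: (K) => K'; lra.
apply/cvgrPdist_le => e e0.
have e2 : 0 < e / 2 by rewrite divr_gt0.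
have cMa : M * a m @[m --> \oo] --> (0 : R).
  exact: cvg0Z PA.
have [m _ Hm] := cvg0_near cMa e2.
have {}Hm := Hm m (leqnn m).
have cK : M * m.+1%:R * (killed Iunit (L n) phi0 x - Sv s t phi0 x) @[n --> \oo] --> (0 : R).
  apply: cvg0Z.
  have : killed Iunit (L n) phi0 x - Sv s t phi0 x @[n --> \oo] -->
      Sv s t phi0 x - Sv s t phi0 x by apply: cvgB; [exact: phi0_cvg|exact: cvg_cst].
  by rewrite subrr.
near=> n; rewrite distrC ger0_norm; last by rewrite subr_ge0 SvL.
apply: (le_trans (key n m)).
have h2 : M * m.+1%:R * (killed Iunit (L n) phi0 x - Sv s t phi0 x) <= e / 2.
  by near: n; exact: cvg0_near.
by move: Hm h2; lra.
Unshelve. all: by end_near. Qed.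

End grids.

Lemma dyadic_cvg s t x f : 0 <= s -> s < t -> Iunit x -> bounded_mfun f ->
  (forall y, 0 <= f y) -> killed Iunit (dyadic_list s t n) f x @[n --> \oo] --> Sv s t f x.
Proof.
move=> s0 st Ix bf f0.
apply: (@killed_cvg (dyadic s t) (fun n => (2 ^ n)%N) s t x) => //.
- exact: ltW.
- by move=> n; exact: dyadic0.
- by move=> n i; exact: dyadic_lt.
- by move=> n; exact: dyadic_end.
- exact: dyadic_sqr_cvg.
Qed.

Lemma mehler_cvg0 (h : nat -> R -> R) (q x M : R) : (forall n, measurable_fun setT (h n)) ->
  (forall n y, `|h n y| <= M) -> (forall y, h n y @[n --> \oo] --> (0 : R)) ->
  mehler q (h n) x @[n --> \oo] --> (0 : R).
Proof.
move=> mh hM h0; rewrite -(Rintegral_prob_cst gamma 0).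
apply: (@bounded_Rintegral_cvg _ _ _ gamma _ _ M) => //.
by move=> n; exact: (measurableT_comp (mh n) (measurable_affine _ _)).
Qed.

(** Along grids through the intermediate time, composition is concatenation of lists. In the limit
    the inner function varies with [n] too; its error is dominated by a free Mehler step of a
    bounded sequence tending pointwise to 0. *)
Lemma Sv_comp s t u f x : 0 <= s -> s < t -> t < u -> Iunit x -> bounded_mfun f ->
  (forall y, 0 <= f y) -> Sv s u f x = Sv s t (Sv t u f) x.
Proof.
move=> s0 st tu Ix bf f0; have su : s < u by exact: lt_trans tu.
have t0 : 0 <= t by rewrite (le_trans s0)// ltW.
have mI := @measurable_Iunit R.
(* Two dyadic grids glued at time [t]; beyond the last point [u] the second formula keeps
   increasing. *)
pose gc n i := if (i <= 2 ^ n)%N then dyadic s t n i else dyadic t u n (i - 2 ^ n).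
have gcE n j : gc n (2 ^ n + j)%N = dyadic t u n j.
  rewrite /gc; case: j => [|j]; first by rewrite addn0 leqnn dyadic_end dyadic0.
  by rewrite -{2}(addn0 (2 ^ n)%N) leq_add2l/= addKn.
have gc_lt n i : gc n i < gc n i.+1.
  have [in2|n2i] := ltnP i (2 ^ n).
    by rewrite /gc in2 ltnW//; exact: dyadic_lt.
  by rewrite -(subnKC n2i) -addnS !gcE; exact: dyadic_lt.
have gc0 n : gc n 0%N = s by rewrite /gc leq0n dyadic0.
have gcN n : gc n (2 ^ n + 2 ^ n)%N = u by rewrite gcE dyadic_end.
have cat n : mkseq (grid_ratio (gc n)) (2 ^ n + 2 ^ n) =
    dyadic_list s t n ++ dyadic_list t u n.
  rewrite /mkseq iotaD map_cat add0n; congr (_ ++ _).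
    apply/eq_in_map => i; rewrite mem_iota add0n => /andP[_ i2].
    by rewrite /grid_ratio /gc i2 ltnW.
  rewrite -[X in iota X _]addn0 iotaDl -map_comp; apply/eq_map => i /=.
  by rewrite /grid_ratio -addnS !gcE.
have mesh : \sum_(q <- mkseq (grid_ratio (gc n)) (2 ^ n + 2 ^ n)) (1 - q) ^+ 2
    @[n --> \oo] --> (0 : R).
  have -> : (fun n => \sum_(q <- mkseq (grid_ratio (gc n)) (2 ^ n + 2 ^ n)) (1 - q) ^+ 2) =
    (fun n => \sum_(q <- dyadic_list s t n) (1 - q) ^+ 2 +
       \sum_(q <- dyadic_list t u n) (1 - q) ^+ 2).
    by apply/funext => n; rewrite cat big_cat.
  by apply: cvg0D; exact: dyadic_sqr_cvg.
have c1 := @killed_cvg gc (fun n => 2 ^ n + 2 ^ n)%N s u x s0 (ltW su) gc0 gc_lt gcN mesh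
  Ix f bf f0.
pose F := Sv t u f.
have bF : bounded_mfun F by exact: (bounded_mfun_Sv BM t0 (ltW tu)).
have F0 y : 0 <= F y by exact: Sv_ge0.
have c2 := dyadic_cvg s0 st Ix bF F0.
pose k n := killed Iunit (dyadic_list t u n) f.
have bk n : bounded_mfun (k n) by exact: killed_bounded.
pose h n y := \1_Iunit y * (k n y + -1 * F y).
have bh n : bounded_mfun (h n).
  apply: bounded_mfunM; first exact: bounded_mfun_indic.
  by apply: bounded_mfunD => //; exact: bounded_mfunZ.
have h0 n y : 0 <= h n y.
  rewrite /h indicE; have [yI|_] := boolP (y \in Iunit); last by rewrite mul0r.
  rewrite mul1r mulN1r subr_ge0 /F /k; rewrite inE in yI.
  have := @Sv_le_killed _ _ _ _ _ BM (dyadic t u n) (2 ^ n) u y; rewrite dyadic0.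
  by apply => //; [move=> i; exact: dyadic_lt|exact: dyadic_end].
have [M M0 fM] := bounded_ub bf.
have kM n y : k n y <= M.
  have -> : M = M * 1 by rewrite mulr1.
  apply: (@le_trans _ _ (killed Iunit (dyadic_list t u n) (fun=> M) y)).
    by apply: le_killed => //; exact: bounded_mfun_cst.
  elim: (dyadic_list t u n) y => [|q qs IH] y /=.
    by rewrite mulrC ler_wpM2l ?(ltW M0)// indicE; case: (_ \in _).
  have hq : mehler q (killed Iunit qs (fun=> M)) y <= M * 1.
    rewrite -[leRHS](mehler_cst q (M * 1) y); apply: le_mehler => //.
    - by apply: bounded_mfun_quartic; apply: killed_bounded => //; exact: bounded_mfun_cst.
    - exact: quartic_cst.
  by rewrite indicE; case: (_ \in _); rewrite ?mul1r ?mul0r// mulr1 ltW.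
have hM n y : `|h n y| <= M.
  rewrite ger0_norm// /h indicE; case: (_ \in _); rewrite ?mul1r ?mul0r ?(ltW M0)//.
  by rewrite mulN1r lerBlDr (le_trans (kM n y))// lerDl.
have hc y : h n y @[n --> \oo] --> (0 : R).
  have [Iy|Iy] := pselect (Iunit y); last first.
    by apply: cvg_near_cst; apply: nearW => n; rewrite /h indicE memNset// mul0r.
  have -> : (fun n => h n y) = (fun n => k n y - F y).
    by apply/funext => n; rewrite /h indicE mem_set// mul1r mulN1r.
  have : k n y - F y @[n --> \oo] --> F y - F y.
    by apply: cvgB; [exact: dyadic_cvg|exact: cvg_cst].
  by rewrite subrr.
have c3 := @mehler_cvg0 h ((s + 1) / (t + 1)) x M (fun n => proj1 (bh n)) hM hc.
pose a n := killed Iunit (mkseq (grid_ratio (gc n)) (2 ^ n + 2 ^ n)) f x.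
pose b n := killed Iunit (dyadic_list s t n) F x.
(* The difference is the killed evolution of [h n] over the first stretch. Dropping the killing
   gives a single Mehler operator whose ratio is independent of [n]. *)
have ab n : b n <= a n <= b n + mehler ((s + 1) / (t + 1)) (h n) x.
  have -> : a n = b n + killed Iunit (dyadic_list s t n) (h n) x.
    rewrite /a cat killed_cat -killedD//; congr (_ x); apply: eq_killed => y Iy.
    by rewrite /h indicE mem_set// mul1r mulN1r addrC subrK.
  rewrite lerDl lerD2l killed_ge0//=.
  rewrite -(dyadic_prod n s0 st); apply: killed_le_mehler => //.
  - exact: (mehler_lawP BM).
  - exact: dyadic_ratios.
have c4 : a n @[n --> \oo] --> Sv s t F x.
  apply: (@squeeze_cvgr _ _ _ _ b (fun n => b n + mehler ((s + 1) / (t + 1)) (h n) x)).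
  - exact: nearW.
  - exact: c2.
  - by rewrite -[X in _ --> X]addr0; exact: cvgD.
exact: (cvg_unique _ c1 c4).
Qed.

(** Symmetry moves the killed evolution onto [phi0], along the reversed list. The estimates for
    [phi0] see a list only through its product and its sum of squares, which reversal preserves, so
    the eigenvalue appears in the limit. *)
Lemma Sv_dual s t f : 0 <= s -> s <= t -> bounded_mfun f -> (forall y, 0 <= f y) ->
  \int[gamma]_x (phi0 x * Sv s t f x) =
  (s + 1) / (t + 1) * \int[gamma]_x (phi0 x * f x).
Proof.
move=> s0; rewrite le_eqVlt => /orP[/eqP <-|st] bf f0.
  rewrite divff ?gt_eqF ?ltr_wpDl// mul1r; apply: eq_Rintegral => x _.
  have [Ix|Ix] := pselect (Iunit x); first by rewrite (Sv_refl BM).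
  by rewrite /phi0 indicE memNset// !mul0r.
have mI := @measurable_Iunit R; have bp := @bounded_mfun_phi0 R.
have [M M0 fM] := bounded_ub bf.
have kM n y : 0 <= killed Iunit (dyadic_list s t n) f y <= M.
  rewrite killed_ge0//= (le_trans (killed_le_mehler _ _ _ _ _ _))//.
  - exact: (mehler_lawP BM).
  - exact: dyadic_ratios.
  rewrite -[leRHS](mehler_cst (\prod_(q <- dyadic_list s t n) q) M y).
  by apply: le_mehler => //; [exact: bounded_mfun_quartic|exact: quartic_cst].
have c1 : \int[gamma]_x (phi0 x * killed Iunit (dyadic_list s t n) f x) @[n --> \oo] -->
    \int[gamma]_x (phi0 x * Sv s t f x).
  apply: (@bounded_Rintegral_cvg _ _ _ gamma _ _ M).
  - move=> n; apply: measurable_funM; first exact: (proj1 bp).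
    exact: (proj1 (killed_bounded _ mI bf)).
  - move=> n y; have /andP[k0 k1] := kM n y.
    rewrite ger0_norm; last by apply: mulr_ge0 => //; exact: phi0_ge0.
    by apply: (le_trans _ k1); apply: ler_piMl => //; exact: phi0_le1.
  - move=> y; have [Iy|Iy] := pselect (Iunit y).
      by apply: cvgM; [exact: cvg_cst|exact: dyadic_cvg].
    by apply: cvg_near_cst; apply: nearW => n; rewrite /phi0 indicE memNset// !mul0r.
have rrev n : ratios (rev (dyadic_list s t n)).
  by rewrite /ratios all_rev; exact: dyadic_ratios.
have prev n : \prod_(q <- rev (dyadic_list s t n)) q = (s + 1) / (t + 1).
  by rewrite -(dyadic_prod n s0 st); apply: perm_big; rewrite perm_rev.
have srev n : \sum_(q <- rev (dyadic_list s t n)) (1 - q) ^+ 2 =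
    \sum_(q <- dyadic_list s t n) (1 - q) ^+ 2.
  by apply: perm_big; rewrite perm_rev.
have c2 : \int[gamma]_x (f x * killed Iunit (rev (dyadic_list s t n)) phi0 x) @[n --> \oo] -->
    \int[gamma]_x (f x * ((s + 1) / (t + 1) * phi0 x)).
  apply: (@bounded_Rintegral_cvg _ _ _ gamma _ _ M).
  - move=> n; apply: measurable_funM; first by case: bf.
    exact: (proj1 (killed_bounded _ mI bp)).
  - move=> n y.
    have k0 : 0 <= killed Iunit (rev (dyadic_list s t n)) phi0 y.
      by apply: killed_ge0 => // z _; exact: phi0_ge0.
    have k1 : killed Iunit (rev (dyadic_list s t n)) phi0 y <= 1.
      apply: le_trans (killed1_le1 (rev (dyadic_list s t n)) y mI).
      by apply: le_killed => //; [exact: bounded_mfun_cst|move=> z _; exact: phi0_le1].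
    by rewrite ger0_norm ?mulr_ge0// (le_trans _ (fM y))// ler_piMr.
  - move=> y; apply: cvgM; first exact: cvg_cst.
    have [Iy|Iy] := pselect (Iunit y); last first.
      apply: cvg_near_cst; apply: nearW => n.
      by rewrite killed_out// /phi0 indicE memNset// mul0r mulr0.
    rewrite phi0_in//; apply/cvgrPdist_le => e e0.
    have e2 : 0 < e / 2 by rewrite divr_gt0.
    have [C C0 HC] := killed_phi0_upper e2.
    have cC : C * \sum_(q <- dyadic_list s t n) (1 - q) ^+ 2 @[n --> \oo] --> (0 : R).
      by apply: cvg0Z; exact: dyadic_sqr_cvg.
    near=> n.
    have h1 := HC _ y (rrev n) Iy; rewrite prev srev in h1.
    have nI (z : R) : ~ Iunit z -> phi z <= 0 by move=> Iz; rewrite leNgt; apply/negP => /IunitP.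
    have h3 := killed_phi0_lower mI (@subset_refl _ _) (lexx 0) nI (rrev n) y.
    rewrite prev subr0 in h3.
    have h2 : C * \sum_(q <- dyadic_list s t n) (1 - q) ^+ 2 <= e / 2.
      by near: n; exact: cvg0_near.
    rewrite distrC ger0_norm ?subr_ge0//.
    by move: h1 h2; lra.
have E n : \int[gamma]_x (phi0 x * killed Iunit (dyadic_list s t n) f x) =
    \int[gamma]_x (f x * killed Iunit (rev (dyadic_list s t n)) phi0 x).
  apply: killed_sym => //; [exact: dyadic_ratios|exact: phi0_ge0].
have -> : \int[gamma]_x (phi0 x * Sv s t f x) =
    \int[gamma]_x (f x * ((s + 1) / (t + 1) * phi0 x)).
  have EE := funext E.
  by apply: (cvg_unique _ c1 _) => //; rewrite EE.
rewrite -Rintegral_gammaZ; last first.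
  by apply: bounded_mfun_quartic; exact: bounded_mfunM.
by apply: eq_Rintegral => x _; rewrite mulrCA [f x * _]mulrC.
Unshelve. all: by end_near. Qed.

(** The limit of the grid bound, as the sum of the [1 - q] is at least 1 minus the product of the
    ratios. *)
Lemma Sv1_upper s t x : 0 <= s -> s < t -> Iunit x ->
  (1 - (s + 1) / (t + 1)) * Sv s t (fun=> 1) x <= 3 * phi x.
Proof.
move=> s0 st Ix; apply/ler_addgt0Pr => e e0.
have [C C0 HC] := killed1_upper e0.
have b1 := bounded_mfun_cst (1 : R).
have cv : 3 * phi x + e +
  C * \sum_(q <- dyadic_list s t n) (1 - q) ^+ 2 @[n --> \oo] --> 3 * phi x + e + C * 0.
  apply: cvgD; first exact: cvg_cst.
  by apply: cvgM; [exact: cvg_cst|exact: dyadic_sqr_cvg].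
rewrite mulr0 addr0 in cv; apply: (cvg_ge_cst cv) => n.
apply: (le_trans _ (HC _ x (dyadic_ratios n s0 st) Ix)).
have glt i := dyadic_lt n i st.
have g0 : 0 <= dyadic s t n 0 by rewrite dyadic0.
have := grid_sum (2 ^ n) g0 glt; rewrite dyadic0 dyadic_end => h1.
have h2 := @Sv_le_killed _ _ _ _ _ BM (dyadic s t n) (2 ^ n) t x g0 glt
  (dyadic_end s t n) Ix _ b1 (fun=> ler01); rewrite dyadic0 in h2.
apply: ler_pM => //; last by apply: Sv_ge0 => y; exact: ler01.
by rewrite subr_ge0 ler_pdivrMr ?mul1r ?lerD2r ?ltW// ltr_wpDl// (le_trans s0)// ltW.
Qed.

End killed_limit.

(** * Gaussian kernel comparison and minorization on a window *)

Section window.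
Context {R : realType}.
Implicit Types (q x y : R) (f : R -> R).
Local Notation gamma := (@normal_prob R 0 1).
Local Notation mu := (@lebesgue_measure R).

(** The centred Gaussian density as a function of its variance [a] and of the squared distance [D],
    the two quantities compared below. *)
Definition heat (a D : R) : R := (Num.sqrt (a * pi *+ 2))^-1 * expR (- D / (a *+ 2)).

Lemma kernel_heat q x y : q < 1 -> mehler_pdf q x y = heat (1 - q) ((y - Num.sqrt q * x) ^+ 2).
Proof.
move=> q1; have a0 : 0 < 1 - q by rewrite subr_gt0.
rewrite /mehler_pdf normal_pdfE; last by rewrite gt_eqF// sqrtr_gt0.
by rewrite /normal_peak /normal_fun sqr_sqrtr// ltW.
Qed.

Lemma heat_gt0 (a D : R) : 0 < a -> 0 < heat a D.
Proof.
move=> a0; rewrite /heat mulr_gt0 ?expR_gt0// invr_gt0 sqrtr_gt0 pmulrn_rgt0//.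
by rewrite mulr_gt0// pi_gt0.
Qed.

Lemma heat_anti (a D D' : R) : 0 < a -> D <= D' -> heat a D' <= heat a D.
Proof.
move=> a0 DD; rewrite /heat ler_wpM2l ?invr_ge0 ?sqrtr_ge0// ler_expR.
by rewrite ler_wpM2r ?lerN2// invr_ge0 mulrn_wge0// ltW.
Qed.

Lemma heat_lt (a D D' : R) : 0 < a -> D < D' -> heat a D' < heat a D.
Proof.
move=> a0 DD; rewrite /heat ltr_pM2l ?ltr_expR; last first.
  by rewrite invr_gt0 sqrtr_gt0 pmulrn_rgt0// mulr_gt0// pi_gt0.
by rewrite ltr_pM2r ?ltrN2// invr_gt0 pmulrn_lgt0.
Qed.

(* At a fixed distance, the heat kernel increases in time up to time D. *)
Lemma heat_mono (a b D : R) : 0 < a -> a <= b -> b <= D -> heat a D <= heat b D.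
Proof.
move=> a0 ab bD; have b0 : 0 < b by exact: lt_le_trans ab.
have p0 := pi_gt0 R.
have sa : 0 < Num.sqrt (a * pi *+ 2) by rewrite sqrtr_gt0 pmulrn_rgt0// mulr_gt0.
have sb : 0 < Num.sqrt (b * pi *+ 2) by rewrite sqrtr_gt0 pmulrn_rgt0// mulr_gt0.
rewrite /heat ler_pdivrMl// mulrCA ler_pdivlMl//.
pose v := D / (a *+ 2) - D / (b *+ 2).
have -> : expR (- D / (b *+ 2)) = expR (- D / (a *+ 2)) * expR v.
  by rewrite -expRD /v; congr expR; rewrite !mulNr; ring.
rewrite mulrCA [leLHS]mulrC ler_wpM2l ?expR_ge0//.
have pa : 0 <= a * pi *+ 2 by rewrite ltW// pmulrn_rgt0// mulr_gt0.
have pb : 0 <= b * pi *+ 2 by rewrite ltW// pmulrn_rgt0// mulr_gt0.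
have se : 0 <= Num.sqrt (a * pi *+ 2) * expR v by rewrite mulr_ge0 ?expR_ge0// ltW.
rewrite -(ler_sqr (ltW sb) se) exprMn -expRM_natl !sqr_sqrtr//.
have -> : b * pi *+ 2 = a * pi *+ 2 * (b / a).
  by rewrite mulrnAl [a * pi * _]mulrC mulrA divfK// gt_eqF.
rewrite ler_pM2l ?pmulrn_rgt0 ?mulr_gt0//.
apply: le_trans (expR_ge1Dx _).
have -> : 2 * v = D * (b - a) / (a * b).
  by rewrite /v -(mulr_natr a) -(mulr_natr b); field; rewrite !gt_eqF.
have -> : b / a = 1 + b * (b - a) / (a * b) by field; rewrite !gt_eqF.
by rewrite lerD2l ler_wpM2r ?invr_ge0 ?mulr_ge0 ?(ltW a0) ?(ltW b0)// ler_wpM2r ?subr_ge0.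
Qed.

Lemma le_mehler_kernel q q' x x' (c : R) f : q < 1 -> q' < 1 -> 0 <= c -> bounded_mfun f ->
  (forall y, 0 <= f y) -> (forall y, f y != 0 -> mehler_pdf q x y <= c * mehler_pdf q' x' y) ->
  mehler q f x <= c * mehler q' f x'.
Proof.
move=> q1 q1' c0 bf f0 H; have [mf _] := bf.
have mk (q0 x0 : R) : measurable_fun setT (fun y => (f y * mehler_pdf q0 x0 y)%:E).
  apply/measurable_EFinP; apply: measurable_funM => //.
  exact: measurable_normal_pdf.
have k0 (q0 x0 y : R) : (0 <= (f y * mehler_pdf q0 x0 y)%:E)%E.
  by rewrite lee_fin mulr_ge0// normal_pdf_ge0.
rewrite -lee_fin EFinM !mehler_kernel// -ge0_integralZl//; last exact: mk.
apply: ge0_le_integral => //.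
- exact: mk.
- by apply: measurable_funeM; exact: mk.
- move=> y _; rewrite -EFinM lee_fin.
  have [->|fy] := eqVneq (f y) 0; first by rewrite !mul0r mulr0.
  by rewrite mulrCA ler_wpM2l// H.
Qed.

(** The half-width is below 15/1024, half of the margin [15 / 16 - 15 / 16 * (31 / 32)]; this is
    what makes [din < dout]. *)
Definition window : set R := `[- 80^-1, 80^-1].

Lemma measurable_window : measurable window.
Proof. exact: measurable_itv. Qed.

Lemma windowP y : window y -> `|y| <= 80^-1.
Proof. by rewrite /window/= in_itv/= ler_norml. Qed.

(** A rational square, so that the displacement factor [Num.sqrt qwin] is exactly 15/16 and the
    distance comparisons are rational. *)
Definition qwin : R := (15 / 16) ^+ 2.

Let a1 : R := 1 - qwin.

(* From [16^-1 <= phi x] the window stays within [din] of [Num.sqrt qwin * x], from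
   outside the interval it stays [dout] away, and [din < dout]. *)
Let dout : R := 15 / 16 - 80^-1.

Let din : R := 15 / 16 * (31 / 32) + 80^-1.

Let theta : R := heat a1 (dout ^+ 2) / heat a1 (din ^+ 2).

Let a1_gt0 : 0 < a1.
Proof. by rewrite /a1 /qwin; lra. Qed.

Let theta01 : 0 <= theta < 1.
Proof.
rewrite /theta divr_ge0 ?ltW ?heat_gt0//= ltr_pdivrMr ?heat_gt0// mul1r.
have hd : din ^+ 2 < dout ^+ 2 by rewrite /din /dout; lra.
exact: (heat_lt a1_gt0 hd).
Qed.

Lemma sqr_le_norm (a b : R) : 0 <= a -> a <= `|b| -> a ^+ 2 <= b ^+ 2.
Proof. by move=> a0 ab; rewrite -(real_normK (num_real b)) ler_sqr ?nnegrE. Qed.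

Lemma sqr_ge_norm (a b : R) : `|b| <= a -> b ^+ 2 <= a ^+ 2.
Proof.
by move=> ab; rewrite -(real_normK (num_real b)) ler_sqr ?nnegrE// (le_trans _ ab).
Qed.

Let kernel_in x y : 16^-1 <= phi x -> window y ->
  heat a1 (din ^+ 2) <= mehler_pdf qwin x y.
Proof.
move=> px /windowP wy; rewrite kernel_heat; last by rewrite /qwin; lra.
apply: heat_anti; first exact: a1_gt0.
apply: sqr_ge_norm.
have p16 : (0 : R) <= 15 / 16 by lra.
have -> : Num.sqrt qwin = 15 / 16 by rewrite /qwin sqrtr_sqr ger0_norm.
have hx : `|x| <= 31 / 32.
  have p32 : (0 : R) <= 31 / 32 by lra.
  rewrite -(ler_sqr (normr_ge0 x) p32) real_normK ?num_real//.
  by move: px; rewrite /phi; lra.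
apply: (le_trans (ler_normB _ _)); rewrite normrM [`|15 / 16|]ger0_norm//.
by rewrite /din; move: wy hx; set u := `|y|; set v := `|x|; lra.
Qed.

(** The window is at distance at least [dout] from [Num.sqrt q * z]. As [1 - q <= a1 <= dout ^+ 2],
    [heat_mono] lets the shorter remaining time be replaced by the longest one. *)
Let kernel_out q z y : qwin <= q -> q < 1 -> ~ Iunit z -> window y ->
  mehler_pdf q z y <= heat a1 (dout ^+ 2).
Proof.
move=> hq q1 Iz /windowP wy; rewrite kernel_heat//.
have q0 : 0 <= q by apply: le_trans hq; rewrite /qwin; lra.
have sq : 15 / 16 <= Num.sqrt q.
  have p16 : (0 : R) <= 15 / 16 by lra.
  by rewrite -(ler_sqr p16 (sqrtr_ge0 q)) sqr_sqrtr.
have z1 : 1 <= `|z|.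
  rewrite -(ler_sqr ler01 (normr_ge0 z)) real_normK ?num_real// expr1n leNgt; apply/negP => z1.
  by apply/Iz/IunitP; rewrite subr_gt0.
have hD : dout ^+ 2 <= (y - Num.sqrt q * z) ^+ 2.
  apply: sqr_le_norm; first by rewrite /dout; lra.
  rewrite distrC; apply: le_trans (lerB_dist _ _).
  rewrite normrM [`|Num.sqrt q|]ger0_norm ?sqrtr_ge0//.
  have : 15 / 16 * 1 <= Num.sqrt q * `|z| by apply: ler_pM; lra.
  by rewrite /dout; move: wy; set u := `|y|; set v := _ * `|z|; lra.
apply: (@le_trans _ _ (heat (1 - q) (dout ^+ 2))).
  by apply: heat_anti; rewrite ?subr_gt0.
apply: heat_mono; [by rewrite subr_gt0|by rewrite lerD2l lerN2|].
by rewrite /a1 /qwin /dout; lra.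
Qed.

(** On functions supported in the window, the free evolution from outside, at any remaining ratio,
    is at most [theta] times the one from [x]. Hence at most a share [theta] of the free mass is
    lost by killing, and the kernel bound from [x] handles the rest. *)
Lemma killed_window : @mehler_law R -> exists2 c : R, 0 < c & forall qs f x, ratios qs ->
  \prod_(q <- qs) q = qwin -> bounded_mfun f -> (forall y, 0 <= f y) -> 16^-1 <= phi x ->
  c * \int[gamma]_y (\1_window y * f y) <= killed Iunit qs f x.
Proof.
move=> law; have /andP[t0 t1] := theta01.
have h1 := heat_gt0 0 (@ltr01 R).
have h2 := heat_gt0 (din ^+ 2) a1_gt0.
pose c := heat a1 (din ^+ 2) / heat 1 0.
have c0 : 0 < c by rewrite divr_gt0.
exists ((1 - theta) * c); first by rewrite mulr_gt0// subr_gt0.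
move=> qs f x rqs pqs bf f0 px.
pose f1 y := \1_window y * f y.
have bf1 : bounded_mfun f1.
  by apply: bounded_mfunM => //; apply: bounded_mfun_indic; exact: measurable_window.
have f10 y : 0 <= f1 y by rewrite mulr_ge0// indicE.
have f1w y : f1 y != 0 -> window y.
  move=> fy; apply/not_notP => wy; move: fy.
  by rewrite /f1 indicE memNset// mul0r eqxx.
have q1 : qwin < 1 by rewrite /qwin; lra.
have low : c * \int[gamma]_y f1 y <= mehler qwin f1 x.
  (* The Gaussian measure is the Mehler kernel at ratio 0, so kernels can be compared; its density
     is at most [heat 1 0]. *)
  have -> : \int[gamma]_y f1 y = mehler 0 f1 0.
    rewrite /mehler; apply: eq_Rintegral => y _.
    by rewrite sqrtr0 subr0 sqrtr1 mul0r add0r mul1r.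
  rewrite mulrC -ler_pdivlMr// [leRHS]mulrC.
  apply: le_mehler_kernel => //; first by rewrite invr_ge0 ltW.
  move=> y /f1w wy; rewrite [mehler_pdf 0 _ _]kernel_heat// subr0.
  apply: (@le_trans _ _ (heat 1 0)).
    by apply: heat_anti => //; exact: sqr_ge0.
  rewrite ler_pdivlMl// /c divfK ?gt_eqF//.
  exact: kernel_in.
have up q z : qwin <= q <= 1 -> ~ Iunit z -> mehler q f1 z <= theta * mehler qwin f1 x.
  move=> /andP[hq]; rewrite le_eqVlt => /orP[/eqP -> |hq1] Iz.
    rewrite mehler1 [f1 z](_ : _ = 0); last first.
      apply/eqP; apply: contra_notT Iz => /f1w/windowP hz; apply/IunitP.
      have := sqr_ge_norm hz; lra.
    rewrite mulr_ge0// (le_trans _ low)// mulr_ge0 ?(ltW c0)//.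
    by apply: Rintegral_ge0 => y _; exact: f10.
  apply: le_mehler_kernel => // y /f1w wy.
  apply: (le_trans (kernel_out hq hq1 Iz wy)).
  have := kernel_in px wy; rewrite /theta -mulrA => h.
  rewrite -{1}[heat a1 (dout ^+ 2)]mulr1 ler_wpM2l ?(ltW (heat_gt0 _ _))//.
  by rewrite ler_pdivlMl// mulr1.
have K0 : 0 <= theta * mehler qwin f1 x.
  rewrite mulr_ge0// (le_trans _ low)// mulr_ge0 ?(ltW c0)//.
  by apply: Rintegral_ge0 => y _; exact: f10.
have := killed_free_lower law bf1 f10 K0 up rqs.
rewrite pqs lexx => /(_ isT x) h.
apply: (le_trans _ (_ : killed Iunit qs f1 x <= _)); last first.
  apply: le_killed => //; first exact: measurable_Iunit.
  by move=> y _; rewrite /f1 indicE; case: (_ \in _); rewrite ?mul1r ?mul0r.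
apply: (le_trans _ h); rewrite -mulrA.
suff -> : mehler qwin f1 x - theta * mehler qwin f1 x = (1 - theta) * mehler qwin f1 x.
  by rewrite ler_wpM2l// subr_ge0 ltW.
by rewrite mulrBl mul1r.
Qed.

End window.

(** * Doeblin condition and contraction of oscillations *)

Section contraction.
Context {R : realType} {d : measure_display} {T : measurableType d}.
Context (P : probability T R) (W : R -> T -> R).
Hypothesis BM : is_std_BM P W.
Implicit Types (s t u v x y : R) (f : R -> R).
Local Notation gamma := (@normal_prob R 0 1).
Local Notation Sv := (Sv P W).

Definition wint f : R := \int[gamma]_y (\1_window y * f y).

Lemma bounded_mfun_window f : bounded_mfun f -> bounded_mfun (fun y => \1_window y * f y).
Proof. by apply: bounded_mfunM; apply: bounded_mfun_indic; exact: measurable_window. Qed.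

Lemma wintD f1 f2 : bounded_mfun f1 -> bounded_mfun f2 ->
  wint (fun y => f1 y + f2 y) = wint f1 + wint f2.
Proof.
move=> b1 b2; rewrite /wint.
rewrite -Rintegral_gammaD; [|exact/bounded_mfun_quartic/bounded_mfun_window..].
by apply: eq_Rintegral => y _; rewrite mulrDr.
Qed.

Lemma wintZ (a : R) f : bounded_mfun f -> wint (fun y => a * f y) = a * wint f.
Proof.
move=> bf; rewrite /wint.
rewrite -Rintegral_gammaZ; last exact/bounded_mfun_quartic/bounded_mfun_window.
by apply: eq_Rintegral => y _; rewrite mulrCA.
Qed.

Lemma window_Iunit (y : R) : window y -> Iunit y.
Proof.
move=> /windowP wy; apply/IunitP; have := sqr_ge_norm wy.
have : (80^-1 : R) ^+ 2 < 1 by rewrite expr_lt1//; lra.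
lra.
Qed.

Lemma Sv_window : exists2 c : R, 0 < c & forall s t f x, 0 <= s -> s < t ->
  (s + 1) / (t + 1) = qwin -> bounded_mfun f -> (forall y, 0 <= f y) -> 16^-1 <= phi x ->
  c * wint f <= Sv s t f x.
Proof.
have [c c0 H] := killed_window (mehler_lawP BM).
exists c => // s t f x s0 st qst bf f0 px.
have Ix : Iunit x by apply/IunitP; move: px; rewrite /phi; lra.
apply: (cvg_ge_cst (dyadic_cvg BM s0 st Ix bf f0)) => n; apply: H => //.
- exact: dyadic_ratios.
- by rewrite dyadic_prod.
Qed.

(** A stretch of ratio 1/2 to move away from the boundary, then one of ratio [qwin] to reach the
    window. *)
Definition qdoeb : R := qwin / 2.

Lemma qdoeb01 : 0 < qdoeb < 2^-1.
Proof. by rewrite /qdoeb /qwin; lra. Qed.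

Lemma ratio_lt s t (q : R) : 0 <= s -> (s + 1) / (t + 1) = q -> 0 < q < 1 -> s < t.
Proof.
move=> s0 E /andP[q0 q1]; have s1 : 0 < s + 1 by rewrite ltr_wpDl.
have t1 : 0 < t + 1.
  by move: q0; rewrite -E pmulr_rgt0// invr_gt0.
by rewrite -(ltrD2r 1) -[ltRHS]mul1r -ltr_pdivrMr// E.
Qed.

Lemma measurable_phi_ge (a : R) : measurable [set y : R | a <= phi y].
Proof.
have mp : measurable_fun setT (@phi R) by case: (@quartic_phi R).
rewrite (_ : [set _ | _] = setT `&` @phi R @^-1` `[a, +oo[).
  by apply: mp => //; exact: measurable_itv.
by apply/seteqP; split => y /=; rewrite in_itv/= andbT => // -[].
Qed.

(** Inside, [phi0] is at most the indicator plus 1/16. Evolving over ratio 1/2 turns the left side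
    into [phi x / 2], while survival has probability at most [6 * phi x]; the remainder is 1/2 -
    6/16 = 1/8. *)
Lemma Sv_indic_ge s u x : 0 <= s -> (s + 1) / (u + 1) = 2^-1 -> Iunit x ->
  8^-1 * phi x <= Sv s u (\1_[set y : R | 16^-1 <= phi y]) x.
Proof.
move=> s0 E Ix; have su : s < u by apply: (ratio_lt s0 E); lra.
have bp := @bounded_mfun_phi0 R; pose one := fun _ : R => (1 : R).
have b1 : bounded_mfun one := bounded_mfun_cst (1 : R).
have mJ := measurable_phi_ge (16^-1).
have bJ := bounded_mfun_indic mJ.
have := @le_Sv _ _ _ _ _ BM s u phi0 (fun y => \1_[set y : R | 16^-1 <= phi y] y +
  16^-1 * one y) x s0 (ltW su) Ix bp (bounded_mfunD bJ (bounded_mfunZ _ b1)).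
rewrite (SvD BM x s0 (ltW su) bJ (bounded_mfunZ _ b1)) (SvZ BM _ x s0 (ltW su) b1).
rewrite (Sv_phi0 BM)//; last exact: ltW.
have := Sv1_upper BM s0 su Ix; rewrite E => h1 h2.
have {}h2 := h2 _; move: h2; set A := Sv s u (\1_ _) x; set B := Sv s u _ x => h2.
have : 2^-1 * phi x <= A + 16^-1 * B.
  apply: h2 => y Iy; rewrite phi0_in// /one mulr1 indicE.
  have [_|h] := boolP (y \in _).
    rewrite (_ : true%:R = 1)//; have := phi0_le1 y; rewrite phi0_in//; lra.
  rewrite notin_setE/= in h; move/negP: h; rewrite -ltNge => h.
  by rewrite add0r ltW.
by move: h1; rewrite -/one -/B; lra.
Qed.

Lemma doeblin : exists2 c : R, 0 < c & forall s t f x, 0 <= s ->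
  (s + 1) / (t + 1) = qdoeb -> Iunit x -> bounded_mfun f -> (forall y, 0 <= f y) ->
  c * wint f * phi x <= Sv s t f x.
Proof.
have [c c0 H] := Sv_window.
exists (c / 8); first by rewrite divr_gt0.
move=> s t f x s0 E Ix bf f0.
have s1 : 0 < s + 1 by rewrite ltr_wpDl.
pose u := 2 * (s + 1) - 1.
have Eu : (s + 1) / (u + 1) = 2^-1 by rewrite /u subrK; field; rewrite gt_eqF.
have su : s < u by apply: (ratio_lt s0 Eu); lra.
have u0 : 0 <= u by rewrite (le_trans s0)// ltW.
have Et : (u + 1) / (t + 1) = qwin.
  by rewrite /u subrK -mulrA E /qdoeb; field.
have ut : u < t by apply: (ratio_lt u0 Et); rewrite /qwin; lra.
rewrite (Sv_comp BM s0 su ut)//.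
have mJ := measurable_phi_ge (16^-1).
have bJ := bounded_mfun_indic mJ.
have w0 : 0 <= wint f by apply: Rintegral_ge0 => y _; rewrite mulr_ge0// indicE.
apply: (@le_trans _ _ (Sv s u (fun y => c * wint f * \1_[set y : R | 16^-1 <= phi y] y) x)).
  rewrite (SvZ BM)//; last exact: ltW.
  have := Sv_indic_ge s0 Eu Ix; set A := Sv _ _ _ _ => h.
  have : c * wint f * (8^-1 * phi x) <= c * wint f * A.
    by rewrite ler_wpM2l// mulr_ge0// ltW.
  by apply: le_trans; rewrite le_eqVlt; apply/orP; left; apply/eqP; field.
apply: (le_Sv BM) => //; [exact: ltW|exact: bounded_mfunZ| |].
  by apply: (bounded_mfun_Sv BM) => //; exact: ltW.
move=> y Iy; rewrite indicE; have [|h] := boolP (y \in _).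
  by rewrite inE mulr1 => h; exact: H.
by rewrite mulr0; exact: Sv_ge0.
Qed.

(** The contraction applies it to differences such as [f - m * phi0], whose sign is known only
    inside the interval. *)
Lemma doeblin_Iunit : exists2 c : R, 0 < c & forall s t f x, 0 <= s ->
  (s + 1) / (t + 1) = qdoeb -> Iunit x -> bounded_mfun f -> (forall y, Iunit y -> 0 <= f y) ->
  c * wint f * phi x <= Sv s t f x.
Proof.
have [c c0 H] := doeblin; exists c => // s t f x s0 E Ix bf f0.
have st : s <= t.
  by apply/ltW/(ratio_lt s0 E); have := qdoeb01; lra.
pose g y := \1_Iunit y * f y.
have bg : bounded_mfun g.
  by apply: bounded_mfunM => //; apply: bounded_mfun_indic; exact: measurable_Iunit.
have -> : wint f = wint g.
  apply: eq_Rintegral => y _; rewrite /g.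
  have [wy|wy] := pselect (window y); last by rewrite ![\1_window _]indicE memNset// !mul0r.
  by rewrite [\1_Iunit _]indicE mem_set ?mul1r//; exact: window_Iunit.
have g0 y : 0 <= g y.
  rewrite /g indicE; have [Iy|Iy] := boolP (y \in Iunit); rewrite ?mul1r ?mul0r//.
  by apply: f0; rewrite inE in Iy.
apply: (le_trans (H _ _ _ _ s0 E Ix bg g0)); apply: (le_Sv BM) => // y Iy.
by rewrite /g indicE mem_set// mul1r.
Qed.

Lemma wint_phi0 : 0 < wint phi0.
Proof.
have bw : bounded_mfun (\1_window : R -> R) by apply: bounded_mfun_indic; exact: measurable_window.
have h1 : 2^-1 * \int[gamma]_y (\1_window y) <= wint phi0.
  rewrite -Rintegral_gammaZ; last exact: bounded_mfun_quartic.
  apply: le_Rintegral => //.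
  - by apply: integrable_gamma; apply: bounded_mfun_quartic; exact: bounded_mfunZ.
  - apply: integrable_gamma; apply: bounded_mfun_quartic; apply: bounded_mfun_window.
    exact: bounded_mfun_phi0.
  move=> y _; rewrite indicE; have [|_] := boolP (y \in window); last by rewrite mulr0 mul0r.
  rewrite inE mulr1 mul1r => wy; rewrite phi0_in; last exact: window_Iunit.
  have := sqr_ge_norm (windowP wy); rewrite /phi.
  have : (80^-1 : R) ^+ 2 <= 2^-1 by rewrite expr2; lra.
  lra.
apply: (lt_le_trans _ h1); rewrite mulr_gt0//.
have h2 : 0 < heat 1 ((80^-1) ^+ 2) :> R by exact: heat_gt0.
have bI : ((\int[gamma]_y (\1_window y))%:E = \int[@lebesgue_measure R]_y
    (\1_window y * mehler_pdf 0 0 y)%:E)%E.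
  rewrite -mehler_kernel//.
  by congr EFin; apply: eq_Rintegral => y _; rewrite sqrtr0 subr0 sqrtr1 mul0r add0r mul1r.
rewrite -lte_fin bI.
have h3 : (\int[@lebesgue_measure R]_y (heat 1 ((80^-1) ^+ 2) * \1_window y)%:E <=
   \int[@lebesgue_measure R]_y (\1_window y * mehler_pdf 0 0 y)%:E)%E.
  apply: ge0_le_integral => //.
  - by move=> y _; rewrite lee_fin mulr_ge0 ?(ltW h2)// indicE.
  - by apply/measurable_EFinP; apply: measurable_funM => //; case: bw.
  - by apply/measurable_EFinP; apply: measurable_funM; [case: bw|exact: measurable_normal_pdf].
  move=> y _; rewrite lee_fin indicE; have [|_] := boolP (y \in window).
    rewrite inE mulr1 mul1r => /windowP wy; rewrite kernel_heat// subr0 mulr0 subr0.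
    by apply: heat_anti => //; exact: sqr_ge_norm.
  by rewrite mulr0 mul0r.
apply: (lt_le_trans _ h3).
under eq_integral do rewrite EFinM.
rewrite ge0_integralZl//; last first.
- by rewrite lee_fin ltW.
- by apply/measurable_EFinP; case: bw.
rewrite integral_indic//; last exact: measurable_window.
rewrite setIT; apply: mule_gt0; first by rewrite lte_fin.
suff : (0 < @lebesgue_measure R window)%E by [].
have lt : - 80^-1 < 80^-1 :> R by lra.
by rewrite /window lebesgue_measure_itv/= lte_fin lt -EFinB lte_fin; lra.
Qed.

(* The measure [wint] is a minorant of the kernel normalized by its eigenfunction [phi]. *)
Lemma Sv_oscillation : exists2 k : R, 0 < k < 1 & forall s t f (m M : R), 0 <= s ->
  (s + 1) / (t + 1) = qdoeb -> bounded_mfun f ->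
  (forall x, Iunit x -> m * phi x <= f x <= M * phi x) -> m <= M ->
  exists m' M' : R, [/\ qdoeb * m <= m', m' <= M', M' - m' <= k * qdoeb * (M - m) &
    forall x, Iunit x -> m' * phi x <= Sv s t f x <= M' * phi x].
Proof.
have [c0 c00 H0] := doeblin_Iunit; have e0 := wint_phi0.
have bp := @bounded_mfun_phi0 R; have /andP[q0 q1] := qdoeb01.
(* Testing the minorization on [phi0] at the origin gives [c0 * e <= qdoeb]; halving the constant
   keeps the contraction factor [1 - c * e / qdoeb] strictly positive. *)
pose c := c0 / 2; set e := wint phi0 in e0 *.
have cc : 0 < c by rewrite divr_gt0.
have ce : c * e <= qdoeb / 2.
  pose t := (0 + 1) / qdoeb - 1.
  have E : (0 + 1) / (t + 1) = qdoeb by rewrite /t subrK add0r !div1r invrK.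
  have I0 : Iunit (0 : R) by apply/IunitP; rewrite expr0n/= subr0.
  have := H0 0 t phi0 0 (lexx 0) E I0 bp (fun y _ => phi0_ge0 y).
  rewrite (Sv_phi0 BM)// ?E; last by apply/ltW/(ratio_lt (lexx 0) E); lra.
  by rewrite /phi expr0n/= subr0 !mulr1 /c -/e; lra.
have H s t f x : 0 <= s -> (s + 1) / (t + 1) = qdoeb -> Iunit x -> bounded_mfun f ->
    (forall y, Iunit y -> 0 <= f y) -> 0 <= wint f /\ c * wint f * phi x <= Sv s t f x.
  move=> s0 E Ix bf f0; have h := H0 s t f x s0 E Ix bf f0.
  have w0 : 0 <= wint f.
    apply: Rintegral_ge0 => y _; have [wy|wy] := pselect (window y).
      by rewrite mulr_ge0 ?indicE//; apply: f0; exact: window_Iunit.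
    by rewrite indicE memNset// mul0r.
  split=> //; apply: le_trans h.
  have hp : 0 <= phi x by move/IunitP: Ix; rewrite /phi; lra.
  have hc : c <= c0 by rewrite /c; lra.
  by rewrite (ler_wpM2r hp)// ler_wpM2r.
exists (1 - c * e / qdoeb).
  have h : 0 < c * e / qdoeb by rewrite divr_gt0// mulr_gt0.
  have : c * e / qdoeb <= 2^-1 by rewrite ler_pdivrMr//; lra.
  by lra.
move=> s t f m M s0 E bf fmM mM.
have st : s <= t by apply/ltW/(ratio_lt s0 E); lra.
have bm := bounded_mfunD bf (bounded_mfunZ (- m) bp).
have bM := bounded_mfunD (bounded_mfunZ M bp) (bounded_mfunZ (- 1) bf).
have fm y : Iunit y -> 0 <= f y + - m * phi0 y.
  by move=> Iy; have := fmM y Iy; rewrite phi0_in//; lra.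
have fM y : Iunit y -> 0 <= M * phi0 y + - 1 * f y.
  by move=> Iy; have := fmM y Iy; rewrite phi0_in//; lra.
have I0 : Iunit (0 : R) by apply/IunitP; rewrite expr0n/= subr0.
have [wm _] := H s t _ 0 s0 E I0 bm fm.
have [wM _] := H s t _ 0 s0 E I0 bM fM.
have lo x (Ix : Iunit x) := (H s t _ x s0 E Ix bm fm).2.
have up x (Ix : Iunit x) := (H s t _ x s0 E Ix bM fM).2.
move: wm wM lo up.
rewrite !wintD//; [|exact: bounded_mfunZ..]; rewrite !wintZ// -/e => wm wM lo up.
(* The minorization of [f - m * phi0] raises the lower constant and that of [M * phi0 - f] lowers
   the upper one; together they gain [c * e * (M - m)], whatever [wint f] is. *)
exists (qdoeb * m + c * (wint f - m * e)), (qdoeb * M - c * (M * e - wint f)).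
have hm : 0 <= c * (wint f - m * e) by apply: mulr_ge0; [exact: ltW|lra].
have hM : 0 <= c * (M * e - wint f) by apply: mulr_ge0; [exact: ltW|lra].
have diff : qdoeb * M - c * (M * e - wint f) - (qdoeb * m + c * (wint f - m * e)) =
    (qdoeb - c * e) * (M - m) by ring.
split.
- by rewrite lerDl.
- by rewrite -subr_ge0 diff mulr_ge0 ?subr_ge0//; lra.
- rewrite diff le_eqVlt; apply/orP; left; apply/eqP; field; lra.
move=> x Ix; have := lo x Ix; have := up x Ix.
rewrite !(SvD BM)//; [|exact: bounded_mfunZ..].
rewrite !(SvZ BM)// (Sv_phi0 BM)// E => h1 h2; apply/andP; split.
- move: h2; set A := Sv _ _ _ _; rewrite -subr_ge0 => h2; rewrite -subr_ge0.
  by apply: (le_trans h2); rewrite le_eqVlt; apply/orP; left; apply/eqP; ring.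
- move: h1; set A := Sv _ _ _ _; rewrite -subr_ge0 => h1; rewrite -subr_ge0.
  by apply: (le_trans h1); rewrite le_eqVlt; apply/orP; left; apply/eqP; ring.
Qed.

End contraction.

(** * A probability measure given by a Lebesgue density *)

Section density_probability.
Context {R : realType}.
Variable h : R -> R.
Hypotheses (mh : measurable_fun setT h) (h0 : forall x, 0 <= h x).
Local Notation mu := (@lebesgue_measure R).
Hypothesis h1 : (\int[mu]_x (h x)%:E = 1)%E.

Let density (A : set R) : \bar R := (\int[mu]_(x in A) (h x)%:E)%E.

Let density0 : density set0 = 0%E.
Proof. by rewrite /density integral_set0. Qed.

Let density_ge0 A : (0 <= density A)%E.
Proof. by apply: integral_ge0 => x _; rewrite lee_fin. Qed.

Let density_sigma_additive : @semi_sigma_additive _ R R density.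
Proof.
have ih : mu.-integrable setT (EFin \o h).
  apply/integrableP; split; first exact/measurable_EFinP.
  under eq_integral do rewrite /= ger0_norm//.
  by rewrite h1 ltry.
move=> /= A mA tA mUA; rewrite /density/= integral_bigcup//=; last first.
  by apply: (integrableS _ _ (subsetT _)) => //.
apply: is_cvg_ereal_nneg_natsum_cond => n _ _.
by apply: integral_ge0 => /= x ?; rewrite lee_fin.
Qed.

HB.instance Definition _ := isMeasure.Build _ R R density
  density0 density_ge0 density_sigma_additive.

HB.instance Definition _ := @Measure_isProbability.Build _ R R density h1.

Lemma exists_density : exists alpha : probability R R,
  (forall A, alpha A = (\int[mu]_(x in A) (h x)%:E)%E) /\
  (forall f : R -> \bar R, measurable_fun setT f -> (forall x, 0 <= f x)%E ->
    (\int[alpha]_x f x = \int[mu]_x (f x * (h x)%:E))%E).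
Proof.
pose alpha : probability R R := density; exists alpha; split => // f mf f0.
(* Lebesgue measure is attached to [measurableTypeR R] and [alpha] to [R]; pushing along the
   identity brings both to the same measurable type. *)
pose idR : measurableTypeR R -> R := idfun.
have mid : measurable_fun setT idR := @measurable_id _ _ setT.
pose nu := push_measure mu mid.
have mhE : measurable_fun setT (fun x : R => (h x)%:E) by exact/measurable_EFinP.
have nuE (D : set R) (g : R -> \bar R) : measurable D -> measurable_fun setT g ->
    (forall x, 0 <= g x)%E -> (\int[nu]_(x in D) g x = \int[mu]_(x in D) g x)%E.
  move=> mD mg g0; rewrite ge0_integral_pushforward//.
  exact: measurable_funTS.
rewrite (@ge0_integral_density _ _ _ nu alpha h f)//.
- rewrite nuE//; first by apply: emeasurable_funM.
  by move=> x; rewrite mule_ge0// lee_fin.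
- by move=> A mA; rewrite nuE// => x; rewrite lee_fin.
Qed.

End density_probability.

(** * Iterated contraction and integration over initial laws *)

Section iteration.
Context {R : realType} {d : measure_display} {T : measurableType d}.
Context (P : probability T R) (W : R -> T -> R).
Hypothesis BM : is_std_BM P W.
Implicit Types (s t u v x y : R) (f : R -> R).
Local Notation gamma := (@normal_prob R 0 1).
Local Notation Sv := (Sv P W).
Local Notation qd := (@qdoeb R).

Lemma ratio_le s t (q : R) : 0 <= s -> (s + 1) / (t + 1) = q -> 0 < q <= 1 -> s <= t.
Proof.
move=> s0 E /andP[q0]; rewrite le_eqVlt => /orP[/eqP q1|q1].
  by rewrite -(lerD2r 1) (divr1_eq (etrans E q1)).
by apply/ltW/(ratio_lt s0 E); rewrite q0.
Qed.

(** Stretches are added at the start, so the semigroup property applies the contraction to the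
    evolution already bounded. The lower bound [qd ^+ n * m <= m'] is kept as well: applied to
    survival, it bounds a denominator, and relative to [qd ^+ n] the oscillation decays like
    [k ^+ n]. *)
Lemma Sv_oscillation_iter : exists2 k : R, 0 < k < 1 & forall n s v t f (m M : R), 0 <= s ->
  (s + 1) / (v + 1) = qd ^+ n -> v < t -> bounded_mfun f -> (forall y, 0 <= f y) ->
  (forall x, Iunit x -> m * phi x <= Sv v t f x <= M * phi x) -> m <= M ->
  exists m' M' : R, [/\ qd ^+ n * m <= m', m' <= M', M' - m' <= (k * qd) ^+ n * (M - m) &
    forall x, Iunit x -> m' * phi x <= Sv s t f x <= M' * phi x].
Proof.
have [k k01 H] := Sv_oscillation BM; exists k => //.
have /andP[q0 q1] := @qdoeb01 R; have /andP[k0 k1] := k01.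
have qd1 : qd < 1 by lra.
elim=> [|n IH] s v t f m M s0 E vt bf f0 fmM mM.
  have sv : s = v by apply/(addIr 1)/divr1_eq.
  by exists m, M; split => //; rewrite ?expr0 ?mul1r// sv.
pose u := (s + 1) / qd - 1.
have s1 : 0 < s + 1 by rewrite ltr_wpDl.
have Eu : (s + 1) / (u + 1) = qd.
  by rewrite /u subrK invf_div mulrC divfK ?gt_eqF.
have su : s < u by apply: (ratio_lt s0 Eu); rewrite q0.
have u0 : 0 <= u by rewrite (le_trans s0)// ltW.
have Ev : (u + 1) / (v + 1) = qd ^+ n.
  by rewrite /u subrK mulrAC E exprSr mulfK ?gt_eqF.
have uv : u <= v.
  by apply: (ratio_le u0 Ev); rewrite exprn_gt0//= exprn_ile1// ltW.
have ut : u < t by exact: le_lt_trans vt.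
have [m1 [M1 [h1 h2 h3 h4]]] := IH u v t f m M u0 Ev vt bf f0 fmM mM.
have bF : bounded_mfun (Sv u t f) by apply: (bounded_mfun_Sv BM) => //; exact: ltW.
have [m2 [M2 [i1 i2 i3 i4]]] := H s u (Sv u t f) m1 M1 s0 Eu bF h4 h2.
exists m2, M2; split => //.
- by apply: le_trans i1; rewrite exprS -mulrA ler_wpM2l// ltW.
- apply: (le_trans i3); rewrite exprS -[leRHS]mulrA ler_wpM2l//.
  by rewrite mulr_ge0// ltW.
by move=> x Ix; rewrite (Sv_comp BM s0 su ut)//; exact: i4.
Qed.

(** Taking out [n] stretches of ratio [qd] leaves a last ratio in []qd / 2, 1 / 2]]: small enough
    for the upper bound on survival, and bounded below. *)
Lemma choose_power (q : R) : 0 < q -> q <= 2^-1 ->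
  exists n, qd ^+ n * (qd / 2) < q <= qd ^+ n / 2.
Proof.
move=> q0 q12; have /andP[d0 d1] := @qdoeb01 R.
have ex : exists n, qd ^+ n < 2 * q.
  have : qd ^+ n @[n --> \oo] --> (0 : R) by apply: cvg_expr; rewrite gtr0_norm//; lra.
  move=> /cvgrPdist_lt/(_ (2 * q)) [|N _ /(_ N (leqnn N))]; first by rewrite mulr_gt0.
  by rewrite sub0r normrN => h; exists N; apply: le_lt_trans h; exact: ler_norm.
case: (ex_minnP ex) => -[|n] h min; first by move: h; rewrite expr0; lra.
exists n; apply/andP; split; first by move: h; rewrite exprSr; lra.
have : ~~ (qd ^+ n < 2 * q) by apply/negP => /min; rewrite ltnn.
by rewrite -leNgt; lra.
Qed.

Lemma ratio_diff (a a' b b' e c : R) : 0 <= a -> a <= b -> 0 <= a' -> a' <= b' ->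
  0 < c -> c <= b -> c <= b' -> `|a - a'| <= e -> `|b - b'| <= e ->
  `|a / b - a' / b'| <= 2 * e / c.
Proof.
move=> a0 ab a0' ab' c0 cb cb' ea eb.
have b0 : 0 < b by lra.
have b0' : 0 < b' by lra.
have e0 : 0 <= e by exact: le_trans ea.
have -> : a / b - a' / b' = (a - a') / b + (a' / b') * ((b' - b) / b).
  by field; rewrite !gt_eqF.
have eb' : e / b <= e / c by rewrite ler_wpM2l// lef_pV2.
have h1 : `|(a - a') / b| <= e / c.
  by apply: le_trans eb'; rewrite normrM [`|b^-1|]gtr0_norm ?invr_gt0// ler_pM2r ?invr_gt0.
have h2 : `|(a' / b') * ((b' - b) / b)| <= e / c.
  rewrite normrM -[leRHS]mul1r; apply: ler_pM => //.
    by rewrite ger0_norm ?divr_ge0 ?(ltW b0')// ler_pdivrMr// mul1r.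
  apply: le_trans eb'; rewrite normrM [`|b^-1|]gtr0_norm ?invr_gt0// ler_pM2r ?invr_gt0//.
  by rewrite distrC.
by apply: (le_trans (ler_normD _ _)); move: h1 h2; lra.
Qed.

Section measures.
Variable mu : probability R R.
Hypothesis mu1 : on_open_unit mu.

Lemma integrable_bounded f : bounded_mfun f -> mu.-integrable setT (EFin \o f).
Proof. by move=> [mf [M fM]]; exact: (bounded_integrable _ mf fM). Qed.

Let muC : mu (~` Iunit) = 0.
Proof.
rewrite probability_setC; last exact: measurable_Iunit.
by rewrite (_ : mu Iunit = 1)%E ?subee.
Qed.

Lemma le_Rintegral_Iunit f g : bounded_mfun f -> bounded_mfun g ->
  (forall x, Iunit x -> f x <= g x) -> \int[mu]_x f x <= \int[mu]_x g x.
Proof.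
move=> bf bg fg; have mI := @measurable_Iunit R.
have mC : measurable (~` @Iunit R) by exact: measurableC.
have H h : bounded_mfun h -> \int[mu]_x h x = \int[mu]_(x in Iunit) h x.
  move=> bh; rewrite /Rintegral (negligible_integral mC measurableT _ muC).
    by rewrite setTD setCK.
  exact: integrable_bounded.
rewrite !H//; apply: le_Rintegral => //.
- by apply: (integrableS measurableT) => //; exact: integrable_bounded.
- by apply: (integrableS measurableT) => //; exact: integrable_bounded.
Qed.

(** A vanishing integral would make [phi0] null almost everywhere, yet it is positive on a set of
    full measure. This permits normalizing by the integral of [phi0]. *)
Lemma Rintegral_phi0_gt0 : 0 < \int[mu]_x phi0 x.
Proof.
have [mp _] := @bounded_mfun_phi0 R.
rewrite lt_neqAle Rintegral_ge0 ?andbT; last by move=> x _; exact: phi0_ge0.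
apply/eqP => /esym p0.
have e0 : (\int[mu]_x `|(phi0 x)%:E| = 0)%E.
  under eq_integral do rewrite gee0_abs ?lee_fin ?phi0_ge0//.
  rewrite -[LHS]fineK; first by rewrite -[fine _]/(\int[mu]_x phi0 x) p0.
  by apply: integrable_fin_num => //; exact/integrable_bounded/bounded_mfun_phi0.
have mpE : measurable_fun setT (fun x : R => (phi0 x)%:E) by exact/measurable_EFinP.
have [N [mN N0 sub]] := (ae_eq_integral_abs mu measurableT mpE).1 e0.
have IN : Iunit `<=` N.
  move=> x Ix; apply: sub => /= /(_ I) [] /eqP; rewrite phi0_in// gt_eqF//.
  exact/IunitP.
have : (mu Iunit <= mu N)%E by apply: le_measure => //; rewrite inE//; exact: measurable_Iunit.
by rewrite N0 (_ : mu Iunit = 1)%E// lee_fin ler10.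
Qed.

Lemma Rintegral_boundedZ (a : R) f : bounded_mfun f ->
  \int[mu]_x (a * f x) = a * \int[mu]_x f x.
Proof. by move=> bf; rewrite RintegralZl//; exact: integrable_bounded. Qed.

Lemma Rintegral_boundedD f g : bounded_mfun f -> bounded_mfun g ->
  \int[mu]_x (f x + g x) = \int[mu]_x f x + \int[mu]_x g x.
Proof. by move=> bf bg; rewrite RintegralD//; exact: integrable_bounded. Qed.

Lemma cond_expectE s t f : 0 <= s -> s <= t -> bounded_mfun f ->
  cond_expect P W mu s t f = (\int[mu]_x Sv s t f x) / \int[mu]_x Sv s t (fun=> 1) x.
Proof.
move=> s0 st bf; rewrite /cond_expect /surv_expect /Rintegral; congr (fine _ / fine _).
  by apply: eq_integral => x _; exact: (SvE BM).
by apply: eq_integral => x _; apply: (SvE BM _ s0 st); exact: bounded_mfun_cst.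
Qed.

Lemma Rintegral_Sv_phi0 s t : 0 <= s -> s <= t ->
  \int[mu]_x Sv s t phi0 x = (s + 1) / (t + 1) * \int[mu]_x phi0 x.
Proof.
move=> s0 st; have bp := @bounded_mfun_phi0 R.
have bS : bounded_mfun (Sv s t phi0) := bounded_mfun_Sv BM s0 st bp (@phi0_ge0 R).
rewrite -Rintegral_boundedZ//; apply/eqP; rewrite eq_le; apply/andP; split;
  by apply: le_Rintegral_Iunit => //; [exact: bounded_mfunZ|move=> x Ix;
    rewrite (Sv_phi0 BM)// phi0_in].
Qed.

Lemma Rintegral_Sv1_gt0 s t : 0 <= s -> s <= t -> 0 < \int[mu]_x Sv s t (fun=> 1) x.
Proof.
move=> s0 st; have bp := @bounded_mfun_phi0 R.
have b1 := bounded_mfun_cst (1 : R).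
apply: (@lt_le_trans _ _ (\int[mu]_x Sv s t phi0 x)).
  rewrite Rintegral_Sv_phi0// mulr_gt0 ?Rintegral_phi0_gt0// divr_gt0 ?ltr_wpDl//.
  exact: le_trans st.
apply: le_Rintegral_Iunit.
- exact: (bounded_mfun_Sv BM s0 st bp (@phi0_ge0 R)).
- by apply: (bounded_mfun_Sv BM s0 st b1) => ?.
- by move=> x Ix; apply: (le_Sv BM) => // y _; exact: phi0_le1.
Qed.

Lemma cond_expect01 s t f : 0 <= s -> s <= t -> bounded_mfun f ->
  (forall y, 0 <= f y <= 1) -> 0 <= cond_expect P W mu s t f <= 1.
Proof.
move=> s0 st bf f01; have b1 := bounded_mfun_cst (1 : R).
have f0 y : 0 <= f y by have /andP[] := f01 y.
rewrite cond_expectE// ler_pdivrMr ?Rintegral_Sv1_gt0// mul1r divr_ge0/=.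
- apply: le_Rintegral_Iunit.
  + exact: (bounded_mfun_Sv BM s0 st bf f0).
  + by apply: (bounded_mfun_Sv BM s0 st b1) => ?.
  + by move=> x Ix; apply: (le_Sv BM) => // y _; have /andP[] := f01 y.
- by apply: Rintegral_ge0 => x _; exact: Sv_ge0.
- by apply: Rintegral_ge0 => x _; apply: Sv_ge0.
Qed.

End measures.

End iteration.

(** * Polynomial rate and the quasi-stationary law *)

Section final.
Context {R : realType} {d : measure_display} {T : measurableType d}.
Context (P : probability T R) (W : R -> T -> R).
Hypothesis BM : is_std_BM P W.
Implicit Types (s t u v x y : R) (f : R -> R).
Local Notation gamma := (@normal_prob R 0 1).
Local Notation Sv := (Sv P W).
Local Notation qd := (@qdoeb R).

Lemma powR_power (a k : R) n : 0 < a < 1 -> 0 < k < 1 ->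
  k ^+ n = (a ^+ n) `^ (ln k / ln a).
Proof.
move=> /andP[a0 a1] /andP[k0 k1].
have la : ln a != 0 by rewrite lt_eqF// ln_lt0// a0 a1.
have ka : a `^ (ln k / ln a) = k by rewrite /powR gt_eqF// divfK// lnK.
move: ka; set g := ln k / ln a => ka.
by rewrite -(powR_mulrn n (ltW a0)) -powRrM mulrC powRrM ka powR_mulrn// ltW.
Qed.

Lemma Sv_le_phi v t f x : 0 <= v -> v < t -> (v + 1) / (t + 1) <= 2^-1 -> Iunit x ->
  bounded_mfun f -> (forall y, f y <= 1) -> Sv v t f x <= 6 * phi x.
Proof.
move=> v0 vt hr Ix bf f1; have b1 := bounded_mfun_cst (1 : R).
have h := Sv1_upper BM v0 vt Ix.
have : Sv v t f x <= Sv v t (fun=> 1) x by apply: (le_Sv BM) => //; exact: ltW.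
have : 0 <= Sv v t (fun=> 1) x by apply: Sv_ge0.
move: h; set A := Sv v t (fun=> 1) x; set r := (v + 1) / (t + 1) in hr *.
move=> h A0; have : 2^-1 * A <= (1 - r) * A by rewrite ler_wpM2r//; lra.
lra.
Qed.

(** Divided by the integral of [phi0] under the initial law, numerator and denominator of the
    conditional expectation fall into intervals independent of that law. Their widths are of order
    [(k * qd) ^+ n], while the denominator is at least [qd ^+ n * r], so two initial laws give
    quotients within a multiple of [k ^+ n]. *)
Lemma cond_expect_contraction : exists C g : R, [/\ 0 < C, 0 < g & forall mu nu : probability R R,
  on_open_unit mu -> on_open_unit nu -> forall s t f, 0 <= s -> s <= t -> bounded_mfun f ->
  (forall y, 0 <= f y <= 1) ->
  `|cond_expect P W mu s t f - cond_expect P W nu s t f| <= C * ((s + 1) / (t + 1)) `^ g].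
Proof.
have [k k01 H] := Sv_oscillation_iter BM; have /andP[k0 k1] := k01.
have /andP[d0 d1] := @qdoeb01 R.
have d01 : 0 < qd < 1 by rewrite d0/=; lra.
pose g := ln k / ln qd.
have g0 : 0 < g by rewrite /g nmulr_rgt0 ?invr_lt0 ?ln_lt0.
have B0 : 0 < (2 / qd) `^ g by rewrite powR_gt0// divr_gt0.
(* The quotient estimate gives [12 / r * k ^+ n]; [r > qd / 2] yields 24, and [k ^+ n] is the power
   [g] of [qd ^+ n], which is below [2 / qd * q]. *)
exists (24 / qd * (2 / qd) `^ g), g; split => //; first by rewrite mulr_gt0// divr_gt0.
move=> mu nu mu1 nu1 s t f s0 st bf f01.
have s1 : 0 < s + 1 by rewrite ltr_wpDl.
have t1 : 0 < t + 1 by rewrite ltr_wpDl// (le_trans s0).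
set q := (s + 1) / (t + 1); have q0 : 0 < q by rewrite divr_gt0.
have f0 y : 0 <= f y by have /andP[] := f01 y.
have f1 y : f y <= 1 by have /andP[] := f01 y.
have b1 := bounded_mfun_cst (1 : R); have bp := @bounded_mfun_phi0 R.
have d2 : 0 <= 2 / qd by rewrite divr_ge0// ltW.
rewrite -[leRHS]mulrA -(powRM g d2 (ltW q0)).
(* For large ratios the claim is trivial: the difference is at most 1 and the right side is at least
   1. *)
have [q2|q2] := ltP 2^-1 q.
  have /andP[a0 a1] := cond_expect01 BM mu1 s0 st bf f01.
  have /andP[c0 c1] := cond_expect01 BM nu1 s0 st bf f01.
  apply: (@le_trans _ _ 1).
    by rewrite ler_norml; move: a0 a1 c0 c1; set a := cond_expect _ _ mu _ _ _;
      set c := cond_expect _ _ nu _ _ _; lra.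
  have h : 1 <= (2 / qd * q) `^ g.
    have p1 : 1 `^ g = 1 :> R by rewrite powR1.
    rewrite -[leLHS]p1; apply: ge0_ler_powR; rewrite ?nnegrE ?(ltW g0)//.
      by rewrite mulr_ge0 ?(ltW q0)// divr_ge0// ltW.
    rewrite mulrAC ler_pdivlMr// mul1r; lra.
  rewrite -[leLHS]mul1r; apply: ler_pM => //.
  by rewrite ler_pdivlMr// mul1r; lra.
have [n /andP[n1 n2]] := choose_power q0 q2.
have dn0 : 0 < qd ^+ n by rewrite exprn_gt0.
pose v := (s + 1) / qd ^+ n - 1.
have Ev : (s + 1) / (v + 1) = qd ^+ n.
  by rewrite /v subrK invf_div mulrC divfK ?gt_eqF.
pose r := (v + 1) / (t + 1).
have Er : r = q / qd ^+ n by rewrite /r /v subrK mulrAC.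
have r0 : 0 < r by rewrite Er divr_gt0.
have r2 : r <= 2^-1 by rewrite Er ler_pdivrMr// mulrC.
have rd : qd / 2 < r by rewrite Er ltr_pdivlMr// mulrC.
have sv : s <= v.
  by apply: (ratio_le s0 Ev); rewrite dn0/= exprn_ile1//; lra.
have v0 : 0 <= v by exact: le_trans sv.
have vt : v < t by apply: (ratio_lt v0 (erefl r)); rewrite r0/=; lra.
have hf x : Iunit x -> 0 * phi x <= Sv v t f x <= 6 * phi x.
  by move=> Ix; rewrite mul0r Sv_ge0// Sv_le_phi.
have h1 x : Iunit x -> r * phi x <= Sv v t (fun=> 1) x <= 6 * phi x.
  move=> Ix; rewrite Sv_le_phi// andbT -(Sv_phi0 BM v0 (ltW vt) Ix).
  by apply: (le_Sv BM) => //; [exact: ltW|move=> y _; exact: phi0_le1].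
have [a [a' [a1 a2 a3 a4]]] := H n s v t f 0 6 s0 Ev vt bf f0 hf ltac:(lra).
have [b [b' [b1' b2 b3 b4]]] := H n s v t (fun=> 1) r 6 s0 Ev vt b1 (fun=> ler01) h1 ltac:(lra).
rewrite mulr0 in a1.
pose e := (k * qd) ^+ n * 6.
have kq0 : 0 <= (k * qd) ^+ n by rewrite exprn_ge0// mulr_ge0 ?ltW.
have {}a3 : a' - a <= e by move: a3; rewrite subr0.
have {}b3 : b' - b <= e.
  by apply: (le_trans b3); rewrite ler_wpM2l// gerBl ltW.
have bSf : bounded_mfun (Sv s t f) := bounded_mfun_Sv BM s0 st bf f0.
have bS1 : bounded_mfun (Sv s t (fun=> 1)) by apply: (bounded_mfun_Sv BM s0 st b1) => ?.
have main (m : probability R R) : on_open_unit m -> exists al be : R,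
    [/\ cond_expect P W m s t f = al / be, a <= al <= a', b <= be <= b' & al <= be].
  move=> m1; have p0 := Rintegral_phi0_gt0 m1; set p := \int[m]_x phi0 x in p0.
  exists ((\int[m]_x Sv s t f x) / p), ((\int[m]_x Sv s t (fun=> 1) x) / p).
  have J c : c * p = \int[m]_x (c * phi0 x) by rewrite Rintegral_boundedZ.
  have le h1' h2' := @le_Rintegral_Iunit _ _ m1 h1' h2'.
  split.
  - by rewrite (cond_expectE BM)// invf_div mulrA divfK// gt_eqF.
  - rewrite ler_pdivlMr// ler_pdivrMr// !J; apply/andP; split; apply: le => //;
      by [exact: bounded_mfunZ|move=> x Ix; rewrite phi0_in//; have /andP[] := a4 x Ix].
  - rewrite ler_pdivlMr// ler_pdivrMr// !J; apply/andP; split; apply: le => //;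
      by [exact: bounded_mfunZ|move=> x Ix; rewrite phi0_in//; have /andP[] := b4 x Ix].
  - rewrite ler_pM2r ?invr_gt0//; apply: le => // x Ix.
    by apply: (le_Sv BM).
have [al [be [-> /andP[i1 i2] /andP[i3 i4] i5]]] := main mu mu1.
have [al' [be' [-> /andP[j1 j2] /andP[j3 j4] j5]]] := main nu nu1.
have c0 : 0 < qd ^+ n * r by rewrite mulr_gt0.
have nae : `|al - al'| <= e by rewrite ler_norml; lra.
have nbe : `|be - be'| <= e by rewrite ler_norml; lra.
have := @ratio_diff _ al al' be be' e (qd ^+ n * r) ltac:(lra) i5 ltac:(lra) j5 c0
  ltac:(lra) ltac:(lra) nae nbe.
move=> /le_trans; apply.
have kn : k ^+ n <= (2 / qd * q) `^ g.
  rewrite (powR_power n d01 k01); apply: ge0_ler_powR; rewrite ?nnegrE ?(ltW g0) ?(ltW dn0)//.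
    by rewrite mulr_ge0 ?(ltW q0)// divr_ge0// ltW.
  by rewrite mulrAC ler_pdivlMr//; lra.
have -> : 2 * e / (qd ^+ n * r) = 12 / r * k ^+ n.
  by rewrite /e exprMn; field; rewrite !gt_eqF.
apply: ler_pM => //; [by rewrite divr_ge0// ltW|by rewrite exprn_ge0// ltW|].
by rewrite ler_pdivrMr// mulrAC ler_pdivlMr//; lra.
Qed.

Lemma phi0_gamma_gt0 : 0 < \int[gamma]_x phi0 x.
Proof.
apply: (lt_le_trans (@wint_phi0 R)); apply: le_Rintegral => //.
- by apply: integrable_gamma; apply: bounded_mfun_quartic; apply: bounded_mfun_window;
    exact: bounded_mfun_phi0.
- by apply: integrable_gamma; apply: bounded_mfun_quartic; exact: bounded_mfun_phi0.
move=> y _; rewrite indicE; case: (_ \in _); rewrite ?mul1r ?mul0r//; exact: phi0_ge0.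
Qed.

Lemma exists_alpha : exists alpha : probability R R,
  [/\ is_alpha_OU alpha, on_open_unit alpha &
    forall f, bounded_mfun f -> (forall y, 0 <= f y) ->
      \int[alpha]_x f x = (\int[gamma]_x (phi0 x * f x)) / \int[gamma]_x phi0 x].
Proof.
have Z0 := phi0_gamma_gt0; set Z := \int[gamma]_x phi0 x in Z0 *.
have bp := @bounded_mfun_phi0 R; have [mp _] := bp.
pose h (x : R) : R := phi0 x * normal_pdf 0 1 x / Z.
have mh : measurable_fun setT h.
  apply: measurable_funM => //; apply: measurable_funM => //; exact: measurable_normal_pdf.
have h0 x : 0 <= h x by rewrite /h divr_ge0 ?(ltW Z0)// mulr_ge0 ?phi0_ge0 ?normal_pdf_ge0.
have I f : bounded_mfun f -> (forall y, 0 <= f y) ->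
    (\int[@lebesgue_measure R]_x (f x * h x)%:E =
     ((\int[gamma]_x (phi0 x * f x)) / Z)%:E)%E.
  move=> bf f0; have bpf := bounded_mfunM bp bf; have [mpf _] := bpf.
  rewrite mulrC EFinM -EFin_Rintegral_gamma; last exact: bounded_mfun_quartic.
  rewrite ge0_integral_normal_prob//; first last.
  - by move=> x; rewrite lee_fin mulr_ge0 ?phi0_ge0.
  - exact/measurable_EFinP.
  rewrite -ge0_integralZl//; first last.
  - by rewrite lee_fin invr_ge0 ltW.
  - move=> x _; rewrite -EFinM lee_fin; apply: mulr_ge0; last exact: normal_pdf_ge0.
    by apply: mulr_ge0 => //; exact: phi0_ge0.
  - apply/measurable_EFinP; apply: measurable_funM => //; exact: measurable_normal_pdf.
  apply: eq_integral => x _; rewrite -!EFinM /h; congr EFin.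
  by rewrite [RHS]mulrC -!mulrA mulrCA; congr (_ * _); rewrite mulrCA.
have h1 : (\int[@lebesgue_measure R]_x (h x)%:E = 1)%E.
  have := I (fun=> 1) (bounded_mfun_cst 1) (fun=> ler01).
  under eq_integral do rewrite mul1r; move=> ->.
  under eq_Rintegral do rewrite mulr1.
  by rewrite divff// gt_eqF.
have [alpha [aE aI']] := exists_density mh h0 h1.
have aI f : bounded_mfun f -> (forall y, 0 <= f y) ->
    (\int[alpha]_x (f x)%:E = ((\int[gamma]_x (phi0 x * f x)) / Z)%:E)%E.
  move=> bf f0; rewrite -I//.
  by rewrite (aI' (EFin \o f))//; apply/measurable_EFinP; case: bf.
exists alpha; split.
(* The constant combines the peak of the Gaussian density with the Gaussian integral of [phi0]. *)
- exists (normal_peak 1 / Z) => A mA; rewrite aE.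
  have c0 : 0 < normal_peak 1 / Z :> R by rewrite divr_gt0// normal_peak_gt0// oner_eq0.
  pose D (x : R) : R := \1_Iunit x * dens_OU x.
  have hD x : h x = normal_peak 1 / Z * D x.
    rewrite /h /phi0 /D normal_pdfE ?oner_eq0// /normal_fun subr0 expr1n /dens_OU /phi.
    by move: (\1_Iunit x : R) (expR _) (normal_peak 1) => a b c; ring.
  have Dh x : D x = (normal_peak 1 / Z)^-1 * h x by rewrite hD mulKf// gt_eqF.
  have D0 x : A x -> (0 <= (D x)%:E)%E.
    by move=> _; rewrite lee_fin Dh mulr_ge0// invr_ge0 ltW.
  have mD : measurable_fun A (fun x => (D x)%:E).
    apply/measurable_EFinP; apply: measurable_funTS; rewrite (funext Dh).
    exact: measurable_funM.
  have -> : (\int[@lebesgue_measure R]_(x in A `&` Iunit) (dens_OU x)%:E =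
      \int[@lebesgue_measure R]_(x in A) (D x)%:E)%E.
    rewrite integral_mkcondr; apply: eq_integral => x _; rewrite patchE /D indicE.
    by case: (x \in Iunit); rewrite ?mul1r ?mul0r.
  rewrite -ge0_integralZl//; try exact: mD; try exact: D0; try by rewrite lee_fin ltW.
  by apply: eq_integral => x _; rewrite hD.
- rewrite /on_open_unit -[X in alpha X]setTI -/(@Iunit R).
  have := aI (\1_Iunit) (bounded_mfun_indic (@measurable_Iunit R)).
  rewrite integral_indic//; last exact: measurable_Iunit.
  rewrite setIT setTI => ->; last by move=> y; rewrite indicE.
  congr EFin; rewrite (_ : (\int[gamma]_x _) = Z) ?divff ?gt_eqF//.
  apply: eq_Rintegral => x _; rewrite /phi0 indicE; case: (x \in _).
    by rewrite mulr1.
  by rewrite !mul0r.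
- by move=> f bf f0; rewrite /Rintegral aI.
Qed.

(** By duality, numerator and denominator of the conditional expectation both pick up the
    eigenvalue, which cancels. *)
Lemma alpha_QSD (alpha : probability R R) : on_open_unit alpha ->
  (forall f, bounded_mfun f -> (forall y, 0 <= f y) ->
    \int[alpha]_x f x = (\int[gamma]_x (phi0 x * f x)) / \int[gamma]_x phi0 x) ->
  forall s t f, 0 <= s -> s <= t -> bounded_mfun f -> (forall y, 0 <= f y) ->
    cond_expect P W alpha s t f = \int[alpha]_x f x.
Proof.
move=> a1 aI s t f s0 st bf f0; have b1 := bounded_mfun_cst (1 : R).
have Z0 := phi0_gamma_gt0.
have q0 : 0 < (s + 1) / (t + 1) by rewrite divr_gt0 ?ltr_wpDl// (le_trans s0).
have bS h : bounded_mfun h -> (forall y, 0 <= h y) -> bounded_mfun (Sv s t h).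
  exact: (bounded_mfun_Sv BM).
have S0 h : (forall y, 0 <= h y) -> forall y, 0 <= Sv s t h y.
  by move=> h0 y; exact: Sv_ge0.
rewrite (cond_expectE BM)// (aI _ (bS _ bf f0) (S0 _ f0)) (aI _ bf f0).
rewrite (aI _ (bS _ b1 (fun=> ler01)) (S0 _ (fun=> ler01))).
rewrite !(Sv_dual BM)//.
have -> : \int[gamma]_x (phi0 x * 1) = \int[gamma]_x phi0 x.
  by apply: eq_Rintegral => x _; rewrite mulr1.
move: q0 Z0; set q := (s + 1) / _; set Z := \int[gamma]_x phi0 x.
set X := \int[gamma]_x _ => q0 Z0.
by field; rewrite !gt_eqF.
Qed.

Lemma cond_expect_affine (mu : probability R R) s t f (a b : R) : on_open_unit mu ->
  0 <= s -> s <= t -> bounded_mfun f -> (forall y, 0 <= f y) ->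
  cond_expect P W mu s t (fun y => a * f y + b) = a * cond_expect P W mu s t f + b.
Proof.
move=> mu1 s0 st bf f0; pose one := fun _ : R => 1 : R.
have b1 : bounded_mfun one := bounded_mfun_cst (1 : R).
have -> : (fun y => a * f y + b) = (fun y => a * f y + b * one y).
  by apply/funext => y; rewrite mulr1.
have bab := bounded_mfunD (bounded_mfunZ a bf) (bounded_mfunZ b b1).
have bSf : bounded_mfun (Sv s t f) := bounded_mfun_Sv BM s0 st bf f0.
have bS1 : bounded_mfun (Sv s t one) by apply: (bounded_mfun_Sv BM s0 st b1) => ?.
have S1 : 0 < \int[mu]_x Sv s t one x := Rintegral_Sv1_gt0 BM mu1 s0 st.
rewrite !(cond_expectE BM)// -/one.
have -> : \int[mu]_x Sv s t (fun y => a * f y + b * one y) x =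
    \int[mu]_x (a * Sv s t f x + b * Sv s t one x).
  apply: eq_Rintegral => x _.
  rewrite (SvD BM x s0 st (bounded_mfunZ a bf) (bounded_mfunZ b b1)).
  by rewrite (SvZ BM a x s0 st bf) (SvZ BM b x s0 st b1).
rewrite Rintegral_boundedD; [|exact: bounded_mfunZ..].
by rewrite !Rintegral_boundedZ// mulrDl mulrA mulfK// gt_eqF.
Qed.

Lemma cvg_rate s (C g e : R) : 0 <= s -> 0 < C -> 0 < g -> 0 < e ->
  \forall t \near +oo, s <= t /\ C * ((s + 1) / (t + 1)) `^ g <= e.
Proof.
move=> s0 C0 g0 e0; pose b := (e / C) `^ g^-1.
have b0 : 0 < b by rewrite powR_gt0// divr_gt0.
have s1 : 0 < s + 1 by rewrite ltr_wpDl.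
near=> t; have st : s <= t by near: t; apply: nbhs_pinfty_ge; exact: num_real.
have bt : (s + 1) / b <= t by near: t; apply: nbhs_pinfty_ge; exact: num_real.
have t1 : 0 < t + 1 by rewrite ltr_wpDl// (le_trans s0).
split => //; rewrite mulrC -ler_pdivlMr//.
have -> : e / C = b `^ g.
  by rewrite /b -powRrM mulVf ?gt_eqF// powRr1// ltW// divr_gt0.
apply: ge0_ler_powR; rewrite ?nnegrE ?(ltW g0) ?(ltW b0) ?(ltW (divr_gt0 s1 t1))//.
rewrite ler_pdivrMr//; move: bt; rewrite ler_pdivrMr// => bt.
by apply: (le_trans bt); rewrite mulrC ler_wpM2l ?(ltW b0)// lerDl.
Unshelve. all: by end_near. Qed.

End final.

Theorem theorem2 (R : realType) (d : measure_display) (T : measurableType d)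
    (P : probability T R) (W : R -> T -> R) :
  is_std_BM P W ->
  exists alpha : probability R R,
    [/\ is_alpha_OU alpha,
        is_QSD_X P W alpha,
        (forall beta : probability R R, is_QSD_X P W beta ->
           forall A, measurable A -> beta A = alpha A),
        (exists C gamma : R, [/\ 0 < C, 0 < gamma &
           forall mu : probability R R, on_open_unit mu ->
           forall s t : R, 0 <= s -> s <= t ->
           forall f : R -> R, measurable_fun setT f ->
             (forall x, `|f x| <= 1) ->
             `| cond_expect P W mu s t f - fine (\int[alpha]_x (f x)%:E)%E |
               <= C * ((s + 1) / (t + 1)) `^ gamma]) &
        (forall mu : probability R R, on_open_unit mu ->
         forall s : R, 0 <= s ->
         forall f : R -> R, continuous f -> (exists M, forall x, `|f x| <= M) ->
           cond_expect P W mu s t f @[t --> +oo] -->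
             fine (\int[alpha]_x (f x)%:E)%E)].
Proof.
move=> BM; have [alpha [aOU a1 aI]] := @exists_alpha R.
have Q := alpha_QSD BM a1 aI.
have [C [g [C0 g0 H]]] := cond_expect_contraction BM.
have TV (mu : probability R R) : on_open_unit mu -> forall (s t M : R) (f : R -> R),
    0 <= s -> s <= t -> 0 < M -> measurable_fun setT f -> (forall x, `|f x| <= M) ->
    `|cond_expect P W mu s t f - \int[alpha]_x f x| <=
      2 * M * C * ((s + 1) / (t + 1)) `^ g.
  move=> mu1 s t M f s0 st M0 mf fM; have bf : bounded_mfun f by split => //; exists M.
  (* The contraction is for values between 0 and 1; undoing this affine rescaling costs the factor
     [2 * M]. The integral against [alpha] is itself a conditional expectation started from [alpha],
     so the two initial laws [mu] and [alpha] are compared. *)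
  pose h y := (2 * M)^-1 * (f y + M).
  have bh : bounded_mfun h.
    by apply: bounded_mfunZ; apply: bounded_mfunD => //; exact: bounded_mfun_cst.
  have M2 : 0 < 2 * M by rewrite mulr_gt0.
  have h01 y : 0 <= h y <= 1.
    have := fM y; rewrite ler_norml /h => /andP[f1 f2].
    by rewrite ler_pdivlMl// ler_pdivrMl// mulr0 mulr1; lra.
  have h0 y : 0 <= h y by have /andP[] := h01 y.
  have fE : f = (fun y => 2 * M * h y + - M).
    by apply/funext => y; rewrite /h mulVKf ?gt_eqF// addrK.
  have -> : \int[alpha]_x f x = 2 * M * \int[alpha]_x h x + - M.
    rewrite [in LHS]fE Rintegral_boundedD//; [|exact: bounded_mfunZ|exact: bounded_mfun_cst].
    by rewrite Rintegral_boundedZ// Rintegral_prob_cst.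
  rewrite [in X in X <= _]fE (cond_expect_affine BM _ _ mu1 s0 st bh h0) -(Q s t h s0 st bh h0).
  rewrite opprD addrACA subrr addr0 -mulrBr normrM gtr0_norm// -mulrA ler_wpM2l ?(ltW M2)//.
  exact: (H mu alpha mu1 a1).
exists alpha; split => //.
- split => // s t s0 st A mA; rewrite /cond_law Q//; last exact: bounded_mfun_indic.
  by rewrite /Rintegral integral_indic// setIT fineK// fin_num_measure.
- move=> beta [b1 bQ] A mA.
  have mf : measurable_fun setT (\1_A : R -> R) by exact: measurable_indic.
  have A1 (x : R) : `|\1_A x| <= 1 :> R.
    by rewrite indicE; case: (_ \in _); rewrite ?normr0 ?normr1.
  have aA : \int[alpha]_x (\1_A x) = fine (alpha A) by rewrite /Rintegral integral_indic// setIT.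
  rewrite -[LHS]fineK ?fin_num_measure// -[RHS]fineK ?fin_num_measure//; congr EFin.
  (* Conditioning does not change [beta], so its distance to [alpha] is bounded by the rate at every
     time [t], and the rate tends to 0. *)
  apply/eqP; rewrite -subr_eq0 -normr_le0; apply/ler_addgt0Pr => e e0; rewrite add0r.
  have [t [t0 te]] : exists t : R, 0 <= t /\ 2 * 1 * C * ((0 + 1) / (t + 1)) `^ g <= e.
    have C2 : 0 < 2 * 1 * C by rewrite !mulr_gt0.
    have := cvg_rate (lexx 0) C2 g0 e0; move=> near_t.
    by have [t] := filter_ex near_t; exists t.
  apply: (le_trans _ te); rewrite -aA -(bQ 0 t (lexx 0) t0 A mA)/=.
  exact: TV.
- exists (2 * 1 * C), g; split => //; first by rewrite !mulr_gt0.
  by move=> mu mu1 s t s0 st f mf f1; exact: TV.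
- move=> mu mu1 s s0 f cf [M fM].
  have mf : measurable_fun setT f by exact: continuous_measurable_fun.
  pose M' := `|M| + 1; have M'0 : 0 < M' by rewrite ltr_wpDl.
  have fM' x : `|f x| <= M'.
    by rewrite (le_trans (fM x))// (le_trans (ler_norm M))// lerDl.
  have C2 : 0 < 2 * M' * C by rewrite !mulr_gt0.
  apply/cvgrPdist_le => e e0; apply: filterS (cvg_rate s0 C2 g0 e0) => t [st te].
  by rewrite distrC; apply: (le_trans (TV mu mu1 s t M' f s0 st M'0 mf fM') te).
Qed.
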